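(* Let $\mathcal S\le\mathcal R$ be an inclusion of discrete, probability measure-preserving equivalence relations over a standard probability space $(X,\mu)$ with $\mathcal R$ ergodic. Suppose that $\nu\in\mathrm{Prob}([\mathcal R])$ is countably supported, symmetric, and generates $\mathcal R$. Assume moreover that $\langle\mathrm{supp}(\nu)\rangle\curvearrowright(X,\mu)$ has spectral gap. Then $\mathcal S$ is coamenable in $\mathcal R$ if and only if $\rho(\mathcal R/\mathcal S,\nu)=1$.
   Context: A discrete, probability measure-preserving equivalence relation on $(X,\mu)$ is a Borel set $\mathcal R\subseteq X\times X$ which is an equivalence relation with countable classes $[x]_{\mathcal R}$ satisfying $\int_X\sum_{y\in[x]_{\mathcal R}}f(x,y)\,d\mu(x)=\int_X\sum_{y\in[x]_{\mathcal R}}f(y,x)\,d\mu(x)$ for all Borel $f\colon\mathcal R\to[0,\infty]$. $\mathcal S\le\mathcal R$ means $\mathcal S$ is a Borel subset of $\mathcal R$ that is an equivalence relation on $X$. $[\mathcal R]$ is the group of bimeasurable bijections $\gamma$ of $X$ with $\gamma(x)\in[x]_{\mathcal R}$ for a.e. $x$, modulo a.e. equality. $[x]_{\mathcal R}/\mathcal S$ is the set of $\mathcal S$-classes contained in $[x]_{\mathcal R}$; $\mathcal R/\mathcal S=\{(x,c):x\in X,c\in[x]_{\mathcal R}/\mathcal S\}$, with the standard Borel structure in which $B$ is Borel iff $\{x:(x,[\gamma(x)]_{\mathcal S})\in B\}$ is Borel for every Borel $\gamma\in[\mathcal R]$, and with the measure $\mu_{\mathcal R/\mathcal S}(B)=\int_X|\{c:(x,c)\in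 B\}|\,d\mu(x)$. For $\xi\in L^2(\mathcal R/\mathcal S)$ put $\xi_x(c)=\xi(x,c)$. $(\lambda_{\mathcal R/\mathcal S}(\gamma)\xi)(x,c)=\xi(\gamma^{-1}(x),c)$ and $\lambda_{\mathcal R/\mathcal S}(\nu)=\sum_\gamma\nu(\{\gamma\})\lambda_{\mathcal R/\mathcal S}(\gamma)$. $\mathcal S$ is coamenable in $\mathcal R$ if there is a sequence $\xi^{(n)}\in L^2(\mathcal R/\mathcal S)$ with $\|\xi^{(n)}_x\|_2=1$ for a.e. $x\in X$ and $\|\xi^{(n)}_x-\xi^{(n)}_y\|_2\to_{n\to\infty}0$ for $\mu_{\mathcal R}$-a.e. $(x,y)\in\mathcal R$, where $\mu_{\mathcal R}(B)=\int_X|\{y:(x,y)\in B\}|\,d\mu(x)$. A countably supported $\nu$ is symmetric if $\nu(\{\gamma\})=\nu(\{\gamma^{-1}\})$ for all $\gamma$; it generates $\mathcal R$ if $\langle\mathrm{supp}(\nu)\rangle x=[x]_{\mathcal R}$ for a.e. $x$. For symmetric $\nu$, consider the random walk on $[x]_{\mathcal R}$ started at $x$ with transition probabilities $p_{y,z}=\nu(\{\gamma:\gamma(y)=z\})$, let $p_{k,x,\mathcal S}$ be the probability that it lies in $[x]_{\mathcal S}$ after $k$ steps, and $\rho^{\mathcal S}_\nu(x)=\lim_{k\to\infty}p_{2k,x,\mathcal S}^{1/2k}$, which exists a.e. For $\nu$ symmetric and generating, $\rho(\mathcal R/\mathcal S,\nu):=\|\rho^{\mathcal S}_\nu\|_\infty=\|\lambda_{\mathcal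 R/\mathcal S}(\nu)\|_{B(L^2(\mathcal R/\mathcal S))}$ (existence of the limit and the equality are known theorems of Abért–Frączyk–Hayes). A pmp action $\Gamma\curvearrowright(X,\mu)$ of a countable group has spectral gap if the representation $(\alpha(\gamma)f)(x)=f(\gamma^{-1}x)$ on $\{f\in L^2(X,\mu):\int f\,d\mu=0\}$ has no sequence of almost invariant unit vectors; i.e. there is no sequence of unit vectors $f_n$ in it with $\|\alpha(\gamma)f_n-f_n\|_2\to0$ for all $\gamma\in\Gamma$. *)

(* Defs.v *)
From HB Require Import structures.
From mathcomp Require Import all_boot all_order all_algebra.
From mathcomp Require Import all_classical all_reals all_analysis.
From mathcomp Require Import measurable_realfun ess_sup_inf metric_structure.
From mathcomp Require Import monoid generic_quotient.
From mathcomp.real_closed Require Import complex.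
Set Implicit Arguments.
Unset Strict Implicit.
Unset Printing Implicit Defensive.
Import Order.TTheory GRing.Theory Num.Theory numFieldNormedType.Exports.
Local Open Scope classical_set_scope.
Local Open Scope ring_scope.
Local Open Scope ereal_scope.

Section standard.
Context (K : realType).

Definition polish (P : metricType K) : Prop :=
  (exists2 D : set P, countable D & dense D) /\
  (forall F : set_system P, ProperFilter F -> cauchy F ->
     exists p : P, F --> p).

Definition standard_borel d (X : measurableType d) : Prop :=
  exists (P : metricType K) (phi : X -> P),
    [/\ polish P, bijective phi &
        @measurable d X = preimage_set_system [set: X] phi <<s @open P >>].

Record standard_probability d (X : measurableType d) := StandardProbability {
  std_prob :> probability X K;
  std_borel : standard_borel X }.

End standard.

Definition eqrel (X : Type) (E : set (X * X)) : Prop :=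
  [/\ forall x, E (x, x), forall x y, E (x, y) -> E (y, x) &
      forall x y z, E (x, y) -> E (y, z) -> E (x, z)].

Definition eqclass (X : Type) (E : set (X * X)) (x : X) : set X :=
  [set y | E (x, y)].

Section relations.
Context (K : realType) d (X : measurableType d).

Record pmp_eqrel (mu : standard_probability K X) := PmpEqrel {
  pmp_rel :> set (X * X);
  pmp_measurable : measurable pmp_rel;
  pmp_eqrelP : eqrel pmp_rel;
  pmp_countable : forall x, countable (eqclass pmp_rel x);
  pmp_mass_transport : forall f : X * X -> \bar K,
    @measurable_fun _ _ (X * X)%type (\bar K) pmp_rel f ->
    (forall p, pmp_rel p -> 0 <= f p) ->
    (\int[mu]_x (\esum_(y in eqclass pmp_rel x) f (x, y))) =
    (\int[mu]_x (\esum_(y in eqclass pmp_rel x) f (y, x))) }.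

Definition ergodic (mu : standard_probability K X) (R : pmp_eqrel mu) : Prop :=
  forall A : set X, measurable A ->
    (forall x y, eqclass R x y -> A x -> A y) -> mu A = 0 \/ mu A = 1.

Record sub_eqrel (mu : standard_probability K X) (R : pmp_eqrel mu) :=
  SubEqrel {
    sub_rel :> set (X * X);
    sub_measurable : measurable sub_rel;
    sub_eqrelP : eqrel sub_rel;
    sub_subset : sub_rel `<=` R }.

End relations.

Section full_group.
Context (K : realType) d (X : measurableType d).
Context (mu : standard_probability K X) (R : pmp_eqrel mu).

Record full_rep := FullRep {
  rep_fun :> X -> X;
  rep_inv : X -> X;
  rep_measurable : measurable_fun [set: X] rep_fun;
  rep_inv_measurable : measurable_fun [set: X] rep_inv;
  rep_funK : cancel rep_fun rep_inv;
  rep_invK : cancel rep_inv rep_fun;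
  rep_in : \forall x \ae mu, eqclass R x (rep_fun x) }.

HB.instance Definition _ := gen_eqMixin full_rep.
HB.instance Definition _ := gen_choiceMixin full_rep.

Definition rep_eq (g h : full_rep) : bool :=
  `[< \forall x \ae mu, g x = h x >].

Lemma rep_eq_refl : reflexive rep_eq.
Proof. by move=> g; apply/asboolP; apply: aeW. Qed.

Lemma rep_eq_sym : symmetric rep_eq.
Proof.
by move=> g h; apply/idP/idP => /asboolP H; apply/asboolP;
   apply: filterS H => x ->.
Qed.

Lemma rep_eq_trans : transitive rep_eq.
Proof.
move=> h g k /asboolP gh /asboolP hk; apply/asboolP.
by apply: filterS2 gh hk => x -> ->.
Qed.

Canonical rep_eq_equiv := EquivRel rep_eq rep_eq_refl rep_eq_sym rep_eq_trans.

Local Open Scope quotient_scope.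

Definition full_group : Type := {eq_quot rep_eq}.
HB.instance Definition _ := Choice.on full_group.
HB.instance Definition _ := EqQuotient.on full_group.

(* By mass transport, representatives preserve mu. This is what makes
   composition and inversion well defined modulo null sets. *)

Lemma open_mball (P : metricType K) (p : P) (r : K) :
  open [set z | mdist p z < r]%R.
Proof.
rewrite openE => z /= pz; rewrite /interior.
have e0 : (0 < r - mdist p z)%R by rewrite subr_gt0.
apply/nbhs_ballP; exists (r - mdist p z)%R => // y.
rewrite ballEmdist /= => zy.
by rewrite (le_lt_trans (metric_triangle p z y))// -ltrBrDl.
Qed.

Lemma bigcup_countable_measurable d' (T : measurableType d') (I : choiceType)
    (D : set I) (F : I -> set T) : countable D ->
  (forall i, measurable (F i)) -> measurable (\bigcup_(i in D) F i).
Proof.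
move=> /countable_injP [e einj] mF.
have -> : \bigcup_(i in D) F i =
    \bigcup_n [set x | exists i, [/\ D i, e i = n & F i x]].
  apply/seteqP; split=> x /=.
    by move=> [i Di Fx]; exists (e i) => //; exists i.
  by move=> [n _ [i [Di _ Fx]]]; exists i.
apply: bigcupT_measurable => n.
have [[i [Di ein]]|nex] := pselect (exists i, D i /\ e i = n).
  have -> : [set x | exists i, [/\ D i, e i = n & F i x]] = F i => //.
  apply/seteqP; split=> x /=; last by exists i.
  by move=> [j [Dj ejn]]; rewrite (einj j i) ?inE// ejn.
have -> : [set x | exists i, [/\ D i, e i = n & F i x]] = set0 => //.
by apply/seteqP; split=> x //= [i [Di ein _]]; apply: nex; exists i.
Qed.

Lemma measurable_diagonal : measurable [set p : X * X | p.1 = p.2].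
Proof.
have [P [phi [[[D cD dD] _] [psi phiK psiK] mE]]] := std_borel mu.
pose r n : K := (n.+1%:R^-1)%R.
pose B n q : set X := phi @^-1` [set z | mdist q z < r n]%R.
have mB n q : measurable (B n q).
  rewrite mE; exists [set z | mdist q z < r n]%R; last by rewrite setTI.
  by apply: sub_sigma_algebra; exact: open_mball.
have -> : [set p : X * X | p.1 = p.2] =
    ~` \bigcup_n \bigcup_(q in D) (B n q `*` ~` B n q).
  apply/seteqP; split=> -[x y] /=.
    by move=> -> [n _ [q _ [Bx By]]].
  move=> H; apply: contrapT => xy; apply: H.
  have : phi x <> phi y by move=> /(can_inj phiK).
  move=> /eqP; rewrite -mdist_gt0 => xy0.
  have e0 : (0 < mdist (phi x) (phi y) / 2)%R by rewrite divr_gt0.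
  have [N _ HN] := near_infty_natSinv_lt (PosNum e0).
  have {HN}nlt : (r N < mdist (phi x) (phi y) / 2)%R by apply: HN => /=.
  have [q [/= xq Dq]] : [set z : P | mdist (phi x) z < r N]%R `&` D !=set0.
    apply: dD; last exact: open_mball.
    by exists (phi x); rewrite /= mdistxx invr_gt0.
  exists N => //; exists q => //; split; rewrite /B /=.
    by rewrite metric_sym.
  move=> qy.
  have := metric_triangle (phi x) q (phi y); apply/negP; rewrite -ltNge.
  rewrite [ltRHS]splitr; apply: ltrD; apply: (lt_trans _ nlt) => //.
apply: measurableC; apply: bigcupT_measurable => n.
apply: bigcup_countable_measurable => // q.
by apply: measurableX => //; exact: measurableC.
Qed.

Lemma esum_single (D : set X) (a : X -> \bar K) (z : X) :
  (forall y, 0 <= a y) -> (forall y, D y -> y <> z -> a y = 0) ->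
  \esum_(y in D) a y = if `[< D z >] then a z else 0.
Proof.
move=> a0 aD; case: ifPn => /asboolP Dz.
  rewrite -[RHS]esum_set1// esum_mkcond [RHS]esum_mkcond.
  apply: eq_esum => y _; case: ifPn => [|/negP]; rewrite inE => Dy.
    by case: ifPn => // /negP; rewrite inE => /aD ->.
  by case: ifPn => //; rewrite inE => /= yz; rewrite yz in Dy.
by apply: esum1 => y Dy; apply: aD => // yz; rewrite yz in Dy.
Qed.

Lemma measurable_eqclass_rep (f : X -> X) (E : set (X * X)) :
  measurable E -> measurable_fun [set: X] f ->
  measurable [set x | eqclass E x (f x)].
Proof.
move=> mE mf.
have mp : measurable_fun [set: X] (fun x => (x, f x)).
  apply: measurable_fun_pair; first exact: measurable_id. exact: mf.
by have := mp measurableT _ mE; rewrite setTI.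
Qed.

Lemma conull_setI (A E : set X) : measurable A -> measurable E ->
  (\forall x \ae mu, E x) -> mu (A `&` E) = mu A.
Proof.
move=> mA mE aeE; rewrite [RHS](@measureDI _ _ _ mu A E)//.
rewrite (@measure_negligible _ _ _ mu (A `\` E)) ?add0e//.
  exact: measurableD.
by apply: (negligibleS _ aeE) => x [].
Qed.

Lemma mass_transport_rep (g : full_rep) (A : set X) : measurable A ->
  mu (g @^-1` A) = mu (A `&` [set x | eqclass R x (rep_inv g x)]).
Proof.
move=> mA.
pose G : set (X * X) := [set p | g p.1 = p.2 /\ A p.2].
have mG : measurable G.
  have m1 : measurable_fun [set: X * X] (fun p : X * X => (g p.1, p.2)).
    apply: measurable_fun_pair; last exact: measurable_snd.
    by apply: measurableT_comp; [exact: rep_measurable|exact: measurable_fst].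
  have -> : G = ((fun p : X * X => (g p.1, p.2)) @^-1` [set p | p.1 = p.2]) `&`
                (snd @^-1` A) by [].
  apply: measurableI.
    by have := m1 measurableT _ measurable_diagonal; rewrite setTI.
  by have := @measurable_snd _ _ X X measurableT _ mA; rewrite setTI.
have mR := pmp_measurable R.
have m2 : measurable_fun (R : set (X * X)) (EFin \o \1_G : X * X -> \bar K).
  by apply/measurable_EFinP; exact: measurable_indic.
have G0 p : pmp_rel R p -> 0 <= (\1_G p)%:E :> \bar K by rewrite lee_fin.
have e1 x : \esum_(y in eqclass R x) (\1_G (x, y))%:E =
    (\1_(g @^-1` A `&` [set x | eqclass R x (g x)]) x)%:E :> \bar K.
  rewrite (@esum_single _ _ (g x)) => [|y|y _ yg]; [|by rewrite lee_fin|].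
    rewrite !indicE; have [Rg|nRg] := pselect (eqclass R x (g x)).
      rewrite asboolT//; congr (_%:R%:E); congr nat_of_bool.
      by apply/idP/idP; rewrite !inE /G /= => -[].
    by rewrite asboolF// memNset//= => -[].
  by rewrite indicE memNset//= /G /= => -[/esym].
have e2 x : \esum_(y in eqclass R x) (\1_G (y, x))%:E =
    (\1_(A `&` [set x | eqclass R x (rep_inv g x)]) x)%:E :> \bar K.
  rewrite (@esum_single _ _ (rep_inv g x)) => [|y|y _ yg];
    [|by rewrite lee_fin|].
    rewrite !indicE; have [Rg|nRg] := pselect (eqclass R x (rep_inv g x)).
      rewrite asboolT//; congr (_%:R%:E); congr nat_of_bool.
      by apply/idP/idP; rewrite !inE /G /= rep_invK => -[].
    by rewrite asboolF// memNset//= => -[].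
  rewrite indicE memNset//= /G /= => -[gy _].
  by apply: yg; rewrite -gy rep_funK.
have := pmp_mass_transport m2 G0.
under eq_integral do rewrite e1.
under [in RHS]eq_integral do rewrite e2.
have mE1 : measurable [set x | eqclass R x (g x)].
  by apply: measurable_eqclass_rep => //; exact: rep_measurable.
have mE2 : measurable [set x | eqclass R x (rep_inv g x)].
  by apply: measurable_eqclass_rep => //; exact: rep_inv_measurable.
have mgA : measurable (g @^-1` A).
  by have := rep_measurable g measurableT mA; rewrite setTI.
rewrite !integral_indic ?setIT//; try exact: measurableI.
by move=> <-; apply/esym/conull_setI => //; exact: rep_in.
Qed.

Lemma rep_inv_in (g : full_rep) : \forall x \ae mu, eqclass R x (rep_inv g x).
Proof.
have mE : measurable [set x | eqclass R x (rep_inv g x)].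
  apply: measurable_eqclass_rep; first exact: pmp_measurable.
  exact: rep_inv_measurable.
exists (~` [set x | eqclass R x (rep_inv g x)]); split => //.
  exact: measurableC.
have := mass_transport_rep g (@measurableT _ X).
rewrite preimage_setT setTI probability_setT => /esym E1.
by apply/eqP; rewrite probability_setC// E1 subee.
Qed.

Lemma rep_preserves (g : full_rep) (A : set X) : measurable A ->
  mu (g @^-1` A) = mu A.
Proof.
move=> mA; rewrite mass_transport_rep// conull_setI//; last exact: rep_inv_in.
apply: measurable_eqclass_rep; first exact: pmp_measurable.
exact: rep_inv_measurable.
Qed.

Lemma ae_rep (g : full_rep) (P : X -> Prop) :
  (\forall x \ae mu, P x) -> \forall x \ae mu, P (g x).
Proof.
move=> [N [mN N0 PN]]; exists (g @^-1` N); split.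
- by have := rep_measurable g measurableT mN; rewrite setTI.
- by rewrite rep_preserves.
- by move=> x; exact: PN.
Qed.

Definition rep_one : full_rep.
Proof.
refine (@FullRep id id (@measurable_id _ _ _) (@measurable_id _ _ _) _ _ _) => //.
by apply: aeW => x; have [Rrefl _ _] := pmp_eqrelP R; exact: Rrefl.
Defined.

Definition rep_mul (g h : full_rep) : full_rep.
Proof.
refine (@FullRep (g \o h) (rep_inv h \o rep_inv g) _ _ _ _ _).
- by apply: measurableT_comp; exact: rep_measurable.
- by apply: measurableT_comp; exact: rep_inv_measurable.
- by move=> x /=; rewrite !rep_funK.
- by move=> x /=; rewrite !rep_invK.
- have [_ _ Rtrans] := pmp_eqrelP R.
  apply: filterS2 (rep_in h) (ae_rep h (rep_in g)) => x; exact: Rtrans.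
Defined.

Definition rep_invg (g : full_rep) : full_rep :=
  FullRep (rep_inv_measurable g) (rep_measurable g) (rep_invK g) (rep_funK g)
    (rep_inv_in g).

Definition pi_full (g : full_rep) : full_group := \pi g.

Lemma repr_pi_full (g : full_rep) : \forall x \ae mu, repr (pi_full g) x = g x.
Proof.
have /eqmodP /asboolP // : repr (pi_full g) = g %[mod full_group].
by rewrite reprK.
Qed.

Lemma pi_full_eq (g h : full_rep) : (\forall x \ae mu, g x = h x) -> pi_full g = pi_full h.
Proof. by move=> gh; apply/eqmodP/asboolP. Qed.

Definition full_one : full_group := pi_full rep_one.
Definition full_mul (g h : full_group) : full_group :=
  pi_full (rep_mul (repr g) (repr h)).
Definition full_inv (g : full_group) : full_group :=
  pi_full (rep_invg (repr g)).

Lemma pi_full_mul g h : full_mul (pi_full g) (pi_full h) = pi_full (rep_mul g h).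
Proof.
apply: pi_full_eq.
apply: filterS2 (repr_pi_full h) (ae_rep (repr (pi_full h)) (repr_pi_full g)).
by move=> x /= -> ->.
Qed.

Lemma full_mulA : associative full_mul.
Proof.
move=> g h k; rewrite -(reprK g) -(reprK h) -(reprK k) -!/(pi_full _).
by rewrite !pi_full_mul; apply: pi_full_eq; apply: aeW.
Qed.

Lemma full_mul1g : left_id full_one full_mul.
Proof.
move=> g; rewrite -[in LHS](reprK g) -/(pi_full _) pi_full_mul.
rewrite -[RHS]reprK -/(pi_full _).
by apply: pi_full_eq; apply: aeW.
Qed.

Lemma full_mulg1 : right_id full_one full_mul.
Proof.
move=> g; rewrite -[in LHS](reprK g) -/(pi_full _) pi_full_mul.
rewrite -[RHS]reprK -/(pi_full _).
by apply: pi_full_eq; apply: aeW.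
Qed.

Lemma full_mulVg : left_inverse full_one full_inv full_mul.
Proof.
move=> g; rewrite -[X in full_mul _ X](reprK g) -/(pi_full _) pi_full_mul.
by apply: pi_full_eq; apply: aeW => x /=; rewrite rep_funK.
Qed.

Lemma full_mulgV : right_inverse full_one full_inv full_mul.
Proof.
move=> g; rewrite -[X in full_mul X _](reprK g) -/(pi_full _) pi_full_mul.
by apply: pi_full_eq; apply: aeW => x /=; rewrite rep_invK.
Qed.

HB.instance Definition _ := isGroup.Build full_group
  full_mulA full_mul1g full_mulg1 full_mulVg full_mulgV.

End full_group.

Definition full_fun (K : realType) d (X : measurableType d)
    (mu : standard_probability K X) (R : pmp_eqrel mu) (g : full_group R) :
  X -> X := repr g.
Coercion full_fun : full_group >-> Funclass.

Section probabilities.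
Context (K : realType) d (X : measurableType d).
Context (mu : standard_probability K X) (R : pmp_eqrel mu).
Implicit Types (nu : full_group R -> K) (H : set (full_group R)).

Definition supp nu : set (full_group R) := [set g | nu g != 0%R].

(* A countably supported probability measure is encoded by its weights
   nu g = nu({g}). *)
Definition countable_prob nu : Prop :=
  [/\ forall g, (0 <= nu g)%R, countable (supp nu) &
      \esum_(g in [set: full_group R]) (nu g)%:E = 1].

Definition symmetric_prob nu : Prop := forall g, nu g = nu (g^-1)%g.

Definition is_subgroup H : Prop :=
  [/\ H 1%g, forall g h, H g -> H h -> H (g * h)%g &
      forall g, H g -> H (g^-1)%g].

Definition generated H : set (full_group R) := smallest is_subgroup H.

Definition generates nu : Prop :=
  \forall x \ae mu, [set g x | g in generated (supp nu)] = eqclass R x.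

End probabilities.

Section L2.
Context (K : realType).

Definition cabs2 (z : complex K) : \bar K := ((Normc.normc z) ^+ 2)%R%:E.

Definition cmeasurable d (T : measurableType d) (f : T -> complex K) : Prop :=
  measurable_fun [set: T] (@complex.Re K \o f) /\
  measurable_fun [set: T] (@complex.Im K \o f).

(* [Lnorm] requires a [measure] structure, which the set function [mu_RS]
   below does not carry, hence the raw set function here. *)
Definition L2norm d (T : measurableType d) (m : set T -> \bar K)
    (f : T -> complex K) : \bar K :=
  (\int[m]_x cabs2 (f x)) `^ 2^-1.

Definition L2 d (T : measurableType d) (m : set T -> \bar K) :
    set (T -> complex K) :=
  [set f | cmeasurable f /\ L2norm m f < +oo].

Definition L2_0 d (T : measurableType d) (m : set T -> \bar K) :
    set (T -> complex K) :=
  [set f | [/\ L2 m f, \int[m]_x (@complex.Re K (f x))%:E = 0 &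
               \int[m]_x (@complex.Im K (f x))%:E = 0]].

Definition l2norm (I : choiceType) (A : set I) (u : I -> complex K) : \bar K :=
  (\esum_(i in A) cabs2 (u i)) `^ 2^-1.

End L2.

Section spectral_gap.
Context (K : realType) d (X : measurableType d).
Context (mu : standard_probability K X) (R : pmp_eqrel mu).

Definition koopman (g : full_group R) (f : X -> complex K) : X -> complex K :=
  fun x => f (full_fun (g^-1)%g x).

Definition spectral_gap (H : set (full_group R)) : Prop :=
  ~ exists f : nat -> X -> complex K,
      [/\ forall n, L2_0 mu (f n), forall n, L2norm mu (f n) = 1 &
          forall g, H g ->
            L2norm mu (fun x => koopman g (f n) x - f n x)%R
              @[n --> \oo] --> (0 : \bar K)].

End spectral_gap.

Section coset_space.
Context (K : realType) d (X : measurableType d).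
Context (mu : standard_probability K X) (R : pmp_eqrel mu) (S : sub_eqrel R).

Definition quotient_class (x : X) : set (set X) :=
  [set c | (exists y, c = eqclass S y) /\ c `<=` eqclass R x].

Record coset_space := Coset {
  coset_pt : X;
  coset_cls : set X;
  coset_in : quotient_class coset_pt coset_cls }.

Lemma eqclass_quotient x y : eqclass R x y -> quotient_class x (eqclass S y).
Proof.
have [_ _ Rtrans] := pmp_eqrelP R.
move=> Rxy; split; first by exists y.
by move=> z Syz; apply: Rtrans Rxy _; exact: sub_subset Syz.
Qed.

Lemma quotient_eqclass x y : quotient_class x (eqclass S y) -> eqclass R x y.
Proof. by have [Srefl _ _] := sub_eqrelP S; move=> [_]; apply; exact: Srefl. Qed.

Definition coset_point : coset_space :=
  Coset (eqclass_quotient (let: And3 Rrefl _ _ := pmp_eqrelP R in Rrefl point)).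

HB.instance Definition _ := gen_eqMixin coset_space.
HB.instance Definition _ := gen_choiceMixin coset_space.
HB.instance Definition _ := isPointed.Build coset_space coset_point.

Lemma coset_space_inj (p q : coset_space) :
  coset_pt p = coset_pt q -> coset_cls p = coset_cls q -> p = q.
Proof.
case: p q => [x c h] [y e k] /= xy ce; subst.
by rewrite (Prop_irrelevance h k).
Qed.

Definition coset_graph (g : full_rep R) (B : set coset_space) : set X :=
  [set x | exists2 p, B p & coset_pt p = x /\ coset_cls p = eqclass S (g x)].

Definition coset_borel : set (set coset_space) :=
  [set B | forall g : full_rep R, measurable (coset_graph g B)].

Lemma coset_borel0 : coset_borel set0.
Proof.
move=> g; rewrite (_ : coset_graph g set0 = set0)//.
by apply/seteqP; split=> x // [].
Qed.

Lemma coset_borelC B : coset_borel B -> coset_borel (~` B).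
Proof.
move=> mB g.
have -> : coset_graph g (~` B) =
    [set x | eqclass R x (g x)] `\` coset_graph g B.
  apply/seteqP; split=> x.
    move=> [p nBp [px pc]]; split=> [/=|[q Bq [qx qc]]].
      apply: quotient_eqclass; rewrite -pc; move: (coset_in p); by rewrite px.
    by apply: nBp; rewrite (@coset_space_inj p q)// ?px ?pc ?qx ?qc.
  move=> [Rx nB]; exists (Coset (eqclass_quotient Rx)) => // Bx.
  by apply: nB; exists (Coset (eqclass_quotient Rx)).
apply: measurableD => //; apply: measurable_eqclass_rep.
- exact: pmp_measurable.
- exact: rep_measurable.
Qed.

Lemma coset_borel_bigcup (F : (set coset_space)^nat) :
  (forall i, coset_borel (F i)) -> coset_borel (\bigcup_i F i).
Proof.
move=> mF g.
rewrite (_ : coset_graph g _ = \bigcup_i coset_graph g (F i)).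
  by apply: bigcupT_measurable => i; exact: mF.
apply/seteqP; split=> x.
  by move=> [p [i _ Fp] px]; exists i => //; exists p.
by move=> [i _ [p Fp px]]; exists p => //; exists i.
Qed.

HB.instance Definition _ := @isMeasurable.Build default_measure_display
  coset_space coset_borel coset_borel0 coset_borelC coset_borel_bigcup.

Definition mu_RS (B : set coset_space) : \bar K :=
  \int[mu]_x counting [set c | exists2 p, B p & coset_pt p = x /\ coset_cls p = c].

(* xi_x, extended by 0 outside [x]_R/S. *)
Definition fibre (xi : coset_space -> complex K) (x : X) (c : set X) :
    complex K :=
  if pselect (quotient_class x c) is left h then xi (Coset h) else 0%R.

Definition mu_R (B : set (X * X)) : \bar K :=
  \int[mu]_x counting [set y | eqclass R x y /\ B (x, y)].

(* For (x, y) in R the quotients [x]_R/S and [y]_R/S coincide. *)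
Definition coamenable : Prop :=
  exists xi : nat -> coset_space -> complex K,
    [/\ forall n, L2 mu_RS (xi n),
        forall n, \forall x \ae mu,
          l2norm (quotient_class x) (fibre (xi n) x) = 1 &
        almost_everywhere mu_R [set p | eqclass R p.1 p.2 ->
          l2norm (quotient_class p.1)
              (fun c => fibre (xi n) p.1 c - fibre (xi n) p.2 c)%R
            @[n --> \oo] --> (0 : \bar K)]].

End coset_space.

Section random_walk.
Context (K : realType) d (X : measurableType d).
Context (mu : standard_probability K X) (R : pmp_eqrel mu) (S : sub_eqrel R).
Variable nu : full_group R -> K.

(* These quantities depend on the representatives chosen by [full_fun] only on
   a null set, as nu is countably supported. *)
Definition transition (y z : X) : \bar K :=
  \esum_(g in [set g : full_group R | g y = z]) (nu g)%:E.

Fixpoint walk (k : nat) (x z : X) : \bar K :=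
  if k is k'.+1 then \esum_(y in eqclass R x) (walk k' x y * transition y z)
  else (z == x)%:R%:E.

Definition return_prob (k : nat) (x : X) : \bar K :=
  \esum_(z in eqclass S x) walk k x z.

(* [lim] takes a default value at the points of divergence, which form a null
   set by a theorem of Abert, Fraczyk and Hayes. *)
Definition cospectral_fun (x : X) : \bar K :=
  lim (return_prob (2 * k) x `^ (2 * k)%:R^-1 @[k --> \oo]).

Definition cospectral_radius : \bar K := 'N[mu]_+oo[cospectral_fun].

End random_walk.

(* Main.v *)
(* The averaging operator lambda(nu) is self-adjoint on nonnegative functions on
   R/S, and p_(k,x,S) is the value at (x, [x]_S) of u_k := lambda(nu)^k 1_diag,
   that is u_k(x, c) = P_x(X_k \in c). Cauchy-Schwarz for iterates of
   self-adjoint operators shows that if p_(2m) <= s^m for infinitely many m at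
   almost every point of an S-invariant set, then p_(2m) decays at rate s on
   average there; Borel-Cantelli then gives the a.e. existence of the limit
   that defines the cospectral radius.

   If the radius is less than 1 then, for some s < 1, almost every x satisfies
   p_(2i) <= s^(2i) for i large. The walk decays at rate s on functions dominated
   by a finite combination of the lambda(nu)^m 1_diag restricted to points where
   this holds from a fixed i on, so <lambda(nu) F, F> <= s |F|^2 for these F and,
   by monotone approximation, for all 0 <= F <= 1. Applied to F = |xi_n| this
   contradicts coamenability.

   If the radius is 1 then the integral a_k of p_(2k) does not decay
   geometrically, so a_(k+1) >= (1 - eps) a_k for some k, and the normalization
   in L^2(R/S) of u_k + u_(k+1) is almost invariant. (The second term removes the
   part of u_k near the spectral value -1.) The norms of its fibres form an almost
   invariant vector of L^2(X), hence are close to 1 by spectral gap; dividing each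
   fibre by its norm and passing to a fast subsequence gives coamenability. *)
Require Import Defs.
From mathcomp Require Import all_boot all_order all_algebra finmap.
From mathcomp Require Import all_classical all_reals all_analysis.
From mathcomp Require Import measurable_realfun ess_sup_inf.
From mathcomp Require Import monoid generic_quotient.
From mathcomp.real_closed Require Import complex.
From mathcomp Require Import ring lra.
Set Implicit Arguments.
Unset Strict Implicit.
Unset Printing Implicit Defensive.
Import Order.TTheory GRing.Theory Num.Theory numFieldNormedType.Exports.
Import HBNNSimple.
Local Open Scope classical_set_scope.
Local Open Scope ring_scope.
Local Open Scope ereal_scope.

(** * Sums of families of nonnegative extended reals *)

(** All estimates are made with nonnegative extended real functions, so sums, integrals and pairings
    always exist. Cauchy-Schwarz appears as 2t <F, H> <= <F, F> + t^2 <H, H>, where t is chosen only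
    once the numbers involved are known to be finite. No spectral measure is built. A bound <L^n F,
    F> <= M s^n loses its constant at n = 1 because r_n^2 <= r_0 r_(2n), iterated along powers of 2,
    wipes out M; and the test vector is estimated by expanding the square of a combination of
    consecutive u_k into moments. The other obstacle is null sets. Elements of the full group are
    classes modulo null sets, so their representatives compose only almost everywhere. The analysis
    is therefore done for an abstract action with exact identities, and the given group is then made
    to satisfy them on an invariant conull set. The fibre of R/S over a point is reached through an
    enumeration of the group, which turns sums over cosets into series of measurable functions. *)

Section esum_complements.
Context (K : realType).

Lemma le_esumZl (T : choiceType) (D : set T) (a : T -> \bar K) (k : K) :
  (0 <= k)%R -> (forall i, D i -> 0 <= a i) ->
  \esum_(i in D) (k%:E * a i) <= k%:E * \esum_(i in D) a i.
Proof.
move=> k0 a0; apply: ge_ereal_sup => _ [A [finA AD] <-].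
rewrite fsbig_finite//= big_seq -ge0_sume_distrr; last first.
  by move=> i; rewrite in_fset_set// inE => /AD/a0.
rewrite -big_seq lee_wpmul2l ?lee_fin// -fsbig_finite//.
by apply: ereal_sup_ubound; exists A.
Qed.

Lemma esumZl (T : choiceType) (D : set T) (a : T -> \bar K) (k : K) :
  (0 <= k)%R -> (forall i, D i -> 0 <= a i) ->
  \esum_(i in D) (k%:E * a i) = k%:E * \esum_(i in D) a i.
Proof.
move=> k0 a0; apply/eqP; rewrite eq_le le_esumZl//=.
have [->|kN0] := eqVneq k 0%R.
  by rewrite mul0e esum_ge0// => i Di; rewrite mul0e.
have {kN0}k0 : (0 < k)%R by rewrite lt_neqAle eq_sym kN0.
rewrite -[leRHS]mul1e -(divff (lt0r_neq0 k0)) EFinM -muleA lee_pmul2l//.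
have := @le_esumZl T D (fun i => k%:E * a i) (k^-1)%R.
rewrite invr_ge0 => /(_ (ltW k0)); under eq_esum do
  rewrite muleA -EFinM mulVf ?(lt0r_neq0 k0)// mul1e.
by apply => i Di; rewrite mule_ge0 ?a0// lee_fin ltW.
Qed.

Lemma ge0_esumZl (T : choiceType) (D : set T) (a : T -> \bar K) (k : \bar K) :
  0 <= k -> (forall i, D i -> 0 <= a i) ->
  \esum_(i in D) (k * a i) = k * \esum_(i in D) a i.
Proof.
case: k => [r r0 a0|_ a0|//]; first exact: esumZl.
have [[i Di ai0]|noa] := pselect (exists2 i, D i & a i != 0).
  have leS (b : T -> \bar K) : (forall j, D j -> 0 <= b j) ->
      b i <= \esum_(j in D) b j.
    by move=> b0; apply: esum_ge; exists [set i];
      [split=> // _ ->|rewrite fsbig_set1].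
  have ai : 0 < a i by rewrite lt0e ai0 a0.
  rewrite gt0_mulye; last by apply: lt_le_trans ai _; exact: leS.
  apply/eqP; rewrite -leye_eq; apply: (@le_trans _ _ (+oo * a i)).
    by rewrite gt0_mulye.
  by apply: (leS (fun j => +oo * a j)) => j Dj; rewrite mule_ge0 ?a0.
have aE i : D i -> a i = 0.
  by move=> Di; apply/eqP; apply: contrapT => /negP ai; apply: noa; exists i.
by rewrite [X in _ * X]esum1 ?mule0 ?esum1// => i /aE ->; rewrite mule0.
Qed.

Lemma exchange_esum (T U : choiceType) (D : set T) (E : set U)
    (a : T -> U -> \bar K) :
  (forall i j, 0 <= a i j) ->
  \esum_(i in D) \esum_(j in E) a i j = \esum_(j in E) \esum_(i in D) a i j.
Proof.
move=> a0; rewrite !esum_esum//.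
rewrite (reindex_esum (E `*`` fun=> D) _ (fun p => (p.2, p.1)))//.
split=> [[i j] [/= Ei Dj]//|[i j] [k l] _ _ /= [-> ->]//|[i j] [/= Di Ej]].
by exists (j, i).
Qed.

(** The enumeration takes values in [option] because [D] may be finite or empty. It does not depend
    on [a], so a single one serves under an integral sign. *)
Lemma esum_countable (T : choiceType) (D : set T) : countable D ->
  exists s : nat -> option T, (forall n t, s n = Some t -> D t) /\
  forall a : T -> \bar K, (forall i, D i -> 0 <= a i) ->
    \esum_(i in D) a i = \sum_(0 <= n <oo) oapp a 0 (s n).
Proof.
move=> /countable_injP[e einj].
pose Q n t := D t /\ e t = n.
pose s n : option T :=
  if pselect (exists t, Q n t) is left h then Some (projT1 (cid h)) else None.
have sD n t : s n = Some t -> D t /\ e t = n.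
  by rewrite /s; case: pselect => // h [<-]; case: cid.
have sE t : D t -> s (e t) = Some t.
  move=> Dt; rewrite /s; case: pselect => [h|[]]; last by exists t.
  by case: cid => u /= [Du ue]; congr Some; apply: einj; rewrite ?inE.
exists s; split=> [n t /sD[]//|a a0].
have b0 n : 0 <= oapp a 0 (s n) by case E : (s n) => [t|]//=; apply/a0/(sD _ _ E).1.
rewrite nneseries_esumT//.
rewrite [RHS](_ : _ = \esum_(n in e @` D) oapp a 0 (s n)).
  by rewrite esum_image//; apply: eq_esum => i Di; rewrite sE.
rewrite [RHS]esum_mkcond; apply: eq_esum => n _; case: ifPn => // /negP; rewrite inE => nD.
by case E : (s n) => [t|]//=; exfalso; apply: nD; exists t; have [] := sD _ _ E.
Qed.

Lemma measurable_esum d (X : measurableType d) (T : choiceType) (D : set T)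
    (f : T -> X -> \bar K) : countable D ->
  (forall i x, D i -> 0 <= f i x) ->
  (forall i, D i -> measurable_fun [set: X] (f i)) ->
  measurable_fun [set: X] (fun x => \esum_(i in D) f i x).
Proof.
move=> cD f0 mf; have [s [sD sE]] := esum_countable cD.
rewrite (_ : (fun x => _) = fun x => \sum_(0 <= n <oo) oapp (f ^~ x) 0 (s n));
  last by apply/funext => x; rewrite sE// => i; exact: f0.
apply: (@ge0_emeasurable_sum _ _ _ _ _ xpredT) => [n x _ _|n _].
  by case E : (s n) => [t|]//=; apply/f0/(sD _ _ E).
by case E : (s n) => [t|]//=; apply/mf/(sD _ _ E).
Qed.

Lemma integral_esum d (X : measurableType d) (mu : {measure set X -> \bar K})
    (T : choiceType) (D : set T) (f : T -> X -> \bar K) : countable D ->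
  (forall i x, D i -> 0 <= f i x) ->
  (forall i, D i -> measurable_fun [set: X] (f i)) ->
  \int[mu]_x (\esum_(i in D) f i x) = \esum_(i in D) \int[mu]_x f i x.
Proof.
move=> cD f0 mf; have [s [sD sE]] := esum_countable cD.
rewrite sE => [|i Di]; last by apply: integral_ge0 => x _; exact: f0.
transitivity (\int[mu]_x \sum_(0 <= n <oo) oapp (f ^~ x) 0 (s n)).
  by apply: eq_integral => x _; rewrite sE// => i; exact: f0.
rewrite integral_nneseries//.
- apply: eq_eseriesr => n _; case E : (s n) => [t|]//=.
  by rewrite integral0_eq.
- move=> n; case E : (s n) => [t|]//=.
  by apply/mf/(sD _ _ E).
- by move=> n x _; case E : (s n) => [t|]//=; apply/f0/(sD _ _ E).
Qed.

(** Finite partial sums pass to the limit, which bounds the sum of the limits from above; the other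
    inequality is termwise. *)
Lemma cvg_esum (T : choiceType) (D : set T) (a : nat -> T -> \bar K)
    (b : T -> \bar K) :
  (forall n i, D i -> 0 <= a n i) ->
  (forall i, D i -> nondecreasing_seq (a ^~ i)) ->
  (forall i, D i -> a ^~ i @ \oo --> b i) ->
  (fun n => \esum_(i in D) a n i) @ \oo --> \esum_(i in D) b i.
Proof.
move=> a0 nd ab.
have ndS : nondecreasing_seq (fun n => \esum_(i in D) a n i).
  by move=> m n mn; apply: le_esum => i Di; exact: nd.
have aleb n i : D i -> a n i <= b i.
  move=> Di; have -> : b i = ereal_sup (range (a ^~ i)).
    rewrite -(cvg_lim _ (ab i Di))//.
    by apply/cvg_lim => //; apply: ereal_nondecreasing_cvgn; exact: nd.
  by apply: ereal_sup_ubound; exists n.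
have cS := ereal_nondecreasing_is_cvgn ndS.
suff -> : \esum_(i in D) b i = limn (fun n => \esum_(i in D) a n i) by [].
apply/eqP; rewrite eq_le; apply/andP; split.
  apply: ge_ereal_sup => _ [A [finA AD] <-].
  have cA : (fun n => \sum_(i \in A) a n i) @ \oo --> \sum_(i \in A) b i.
    rewrite fsbig_finite//= big_seq.
    rewrite (_ : (fun n => _) =
        fun n => \sum_(i <- fset_set A | i \in fset_set A) a n i); last first.
      by apply/funext => n; rewrite fsbig_finite//= big_seq.
    by apply: cvg_nnesum => [i|i]; rewrite in_fset_set// inE => /AD Di;
      [apply: nearW => n; exact: a0|exact: ab].
  rewrite -(cvg_lim _ cA)//; apply: lee_lim => //.
    by apply/cvg_ex; eexists; exact: cA.
  by apply: nearW => n; apply: ereal_sup_ubound; exists A.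
apply: lime_le => //; apply: nearW => n.
by apply: le_esum => i Di; exact: aleb.
Qed.

End esum_complements.

(** * Functions on the coset space *)

(* [act] is the action of [supp nu] corrected on a null set so that its
   identities hold everywhere, [cls x] stands for [x]_S, [orb x] for [x]_R/S,
   and [elt] enumerates elements that reach every coset. A function on R/S is
   encoded as [F : X -> C -> \bar K], read only at (x, c) with [orb x c]. *)
Record coset_walk (K : realType) d (X : measurableType d)
    (mu : probability X K) (G C : choiceType) := CosetWalk {
  act : G -> X -> X;
  ginv : G -> G;
  cls : X -> C;
  orb : X -> set C;
  wt : G -> K;
  elt : nat -> G;
  act_measurable : forall g, measurable_fun [set: X] (act g);
  act_preserves : forall g A, measurable A -> mu (act g @^-1` A) = mu A;
  act_comp : forall g h, exists k, forall x, act k x = act g (act h x);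
  act_ginv : forall g x, act g (act (ginv g) x) = x;
  ginvK : involutive ginv;
  act_word : forall g, exists l : seq G, all (fun h => 0 < wt h)%R l /\
    forall x, act g x = foldr act x l;
  orb_act : forall g x, orb (act g x) = orb x;
  orb_elt : forall x, orb x = range (fun n => cls (act (elt n) x));
  cls_measurable : forall g h, measurable [set x | cls (act g x) = cls (act h x)];
  elt_act : forall g, exists n, forall x, act g x = act (elt n) x;
  elt1 : exists n, forall x, act (elt n) x = x;
  wt_ge0 : forall g, (0 <= wt g)%R;
  wt_countable : countable [set g | wt g != 0%R];
  wt_sum : \esum_(g in [set g | wt g != 0%R]) (wt g)%:E = 1;
  wt_ginv : forall g, wt (ginv g) = wt g }.

Section coset_functions.
Context (K : realType) d (X : measurableType d) (mu : probability X K).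
Context (G C : choiceType) (W : coset_walk mu G C).
Implicit Types (F H : X -> C -> \bar K).

(* Nonnegative and Borel on R/S: Borel along every section x |-> (x, [g x]_S). *)
Definition adm F : Prop := (forall x c, 0 <= F x c) /\
  forall g, measurable_fun [set: X] (fun x => F x (cls W (act W g x))).

Definition tot F : \bar K := \int[mu]_x \esum_(c in orb W x) F x c.

Definition pairing F H : \bar K := tot (fun x c => F x c * H x c).

Definition markov_op F : X -> C -> \bar K := fun x c =>
  \esum_(g in [set g | wt W g != 0%R]) (wt W g)%:E * F (act W g x) c.

(** The points at which the n-th element reaches a coset that no earlier element reaches. Each coset
    of an orbit is thus counted at exactly one index. *)
Definition new_coset n : set X :=
  \bigcap_(m in `I_n) ~` [set x | cls W (act W (elt W m) x) = cls W (act W (elt W n) x)].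

Lemma measurable_new_coset n : measurable (new_coset n).
Proof. by apply: bigcap_measurableType => m _; apply/measurableC/cls_measurable. Qed.

(** Each coset is listed at its first index in the enumeration. This series is what makes fibre sums
    measurable in x. *)
Lemma esum_orb x (a : C -> \bar K) : (forall c, 0 <= a c) ->
  \esum_(c in orb W x) a c =
  \sum_(0 <= n <oo) (\1_(new_coset n) x)%:E * a (cls W (act W (elt W n) x)).
Proof.
move=> a0; pose e n := cls W (act W (elt W n) x).
have -> : orb W x = e @` [set n | new_coset n x].
  apply/seteqP; split; last by move=> _ [n _ <-]; rewrite orb_elt; exists n.
  rewrite orb_elt => _ [n _ <-]; rewrite -/(e n).
  have exn : exists m, e m == e n by exists n.
  exists (ex_minn exn); last by case: ex_minnP => m /eqP.
  case: ex_minnP => m /eqP mn mmin k /= km ke.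
  by have := mmin k; rewrite leqNgt km -mn => /(_ (introT eqP ke)).
rewrite esum_image; last first.
  move=> m n; rewrite !inE => Dm Dn emn; case: (ltngtP m n) => // lt.
    by exfalso; apply: (Dn m lt).
  by exfalso; apply: (Dm n lt); rewrite /= -/(e n) -emn.
rewrite nneseries_esumT => [|n]; last by rewrite mule_ge0// lee_fin.
rewrite esum_mkcond; apply: eq_esum => n _.
rewrite indicE; case: ifPn => [|/negP]; rewrite inE /= => nx.
  by rewrite mem_set// mul1e.
by rewrite memNset// mul0e.
Qed.

Lemma cls_orb x : orb W x (cls W x).
Proof. by rewrite orb_elt; have [n nE] := elt1 W; exists n => //; rewrite nE. Qed.

Lemma wt_pos : exists g, (0 < wt W g)%R.
Proof.
apply: contrapT => nog; have := wt_sum W; rewrite esum1.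
  by move=> /eqP; rewrite eqe eq_sym oner_eq0.
move=> g /negP wg; exfalso; apply: wg; apply/eqP/le_anti; rewrite wt_ge0 andbT.
by rewrite leNgt; apply/negP => g0; apply: nog; exists g.
Qed.

Lemma adm_ge0 F x c : adm F -> 0 <= F x c.
Proof. by case. Qed.

Lemma measurable_fsum F : adm F ->
  measurable_fun [set: X] (fun x => \esum_(c in orb W x) F x c).
Proof.
move=> [F0 mF].
rewrite (_ : (fun x => _) = fun x => \sum_(0 <= n <oo)
    (\1_(new_coset n) x)%:E * F x (cls W (act W (elt W n) x))); last first.
  by apply/funext => x; exact: esum_orb.
apply: (@ge0_emeasurable_sum _ _ _ _ _ xpredT) => [n x _ _|n _].
  by rewrite mule_ge0// lee_fin.
apply: emeasurable_funM => //.
by apply/measurable_EFinP/measurable_indic/measurable_new_coset.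
Qed.

Lemma fsum_ge0 F x : adm F -> 0 <= \esum_(c in orb W x) F x c.
Proof. by move=> [F0 _]; apply: esum_ge0. Qed.

Lemma integral_act g (f : X -> \bar K) : measurable_fun [set: X] f ->
  (forall x, 0 <= f x) -> \int[mu]_x f (act W g x) = \int[mu]_x f x.
Proof.
move=> mf f0.
rewrite -(@ge0_integral_pushforward _ _ _ _ _ _ (act_measurable W g) mu setT f)//.
apply: eq_measure_integral => [|mg A mA _]; first exact: act_measurable.
exact: act_preserves.
Qed.

Lemma measurable_act g h : exists k, forall x,
  act W g x = act W k (act W h x).
Proof.
have [k kE] := act_comp W g (ginv W h); exists k => x.
by rewrite kE -[in X in act W _ (act W _ X)](ginvK W h) act_ginv.
Qed.

(** The section of h over x, after translation of the function by g, is the section of h g^-1 read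
    at the point g x. *)
Lemma adm_act g F : adm F -> adm (fun x => F (act W g x)).
Proof.
move=> [F0 mF]; split=> // h.
have [k kE] := measurable_act h g.
rewrite (_ : (fun x => _) = (fun x => F x (cls W (act W k x))) \o act W g).
  by apply: measurableT_comp => //; exact: act_measurable.
by apply/funext => x /=; rewrite -kE.
Qed.

Lemma admZ (k : K) F : (0 <= k)%R -> adm F -> adm (fun x c => k%:E * F x c).
Proof.
move=> k0 [F0 mF]; split=> [x c|g]; first by rewrite mule_ge0.
by apply: emeasurable_funM => //; exact: measurable_cst.
Qed.

Lemma admM F H : adm F -> adm H -> adm (fun x c => F x c * H x c).
Proof.
move=> [F0 mF] [H0 mH]; split=> [x c|g]; first by rewrite mule_ge0.
exact: emeasurable_funM.
Qed.

Lemma admD F H : adm F -> adm H -> adm (fun x c => F x c + H x c).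
Proof.
move=> [F0 mF] [H0 mH]; split=> [x c|g]; first by rewrite adde_ge0.
exact: emeasurable_funD.
Qed.

Lemma adm_Lam F : adm F -> adm (markov_op F).
Proof.
move=> aF; split=> [x c|h].
  by apply: esum_ge0 => g _; rewrite mule_ge0 ?lee_fin ?wt_ge0 ?(adm_ge0 _ _ aF).
apply: measurable_esum; first exact: wt_countable.
  by move=> g x _; rewrite mule_ge0 ?lee_fin ?wt_ge0 ?(adm_ge0 _ _ aF).
move=> g _; apply: emeasurable_funM; first exact: measurable_cst.
exact: (adm_act g aF).2.
Qed.

Lemma adm_iter n F : adm F -> adm (iter n markov_op F).
Proof. by move=> aF; elim: n => //= n; exact: adm_Lam. Qed.

Lemma tot_ge0 F : adm F -> 0 <= tot F.
Proof. by move=> aF; apply: integral_ge0 => x _; exact: fsum_ge0. Qed.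

Lemma ip_ge0 F H : adm F -> adm H -> 0 <= pairing F H.
Proof. by move=> aF aH; apply/tot_ge0/admM. Qed.

Lemma le_tot F H : adm F -> adm H -> (forall x c, F x c <= H x c) ->
  tot F <= tot H.
Proof.
by move=> aF aH FH; apply: ge0_le_integral => //;
  first [exact: measurable_fsum|by move=> x _; exact: fsum_ge0
        |by move=> x _; apply: le_esum].
Qed.

Lemma totD F H : adm F -> adm H ->
  tot (fun x c => F x c + H x c) = tot F + tot H.
Proof.
move=> aF aH; rewrite /tot -ge0_integralD//;
  try solve [exact: measurable_fsum|by move=> x _; exact: fsum_ge0].
by apply: eq_integral => x _; rewrite esumD// => c _; exact: adm_ge0.
Qed.

Lemma totZ (k : K) F : (0 <= k)%R -> adm F ->
  tot (fun x c => k%:E * F x c) = k%:E * tot F.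
Proof.
move=> k0 aF; rewrite /tot -ge0_integralZl//;
  try solve [exact: measurable_fsum|by move=> x _; exact: fsum_ge0].
by apply: eq_integral => x _; rewrite esumZl// => c _; exact: adm_ge0.
Qed.

Lemma tot_act g F : adm F -> tot (fun x => F (act W g x)) = tot F.
Proof.
move=> aF; rewrite /tot -[RHS](integral_act g)//.
- by apply: eq_integral => x _; rewrite orb_act.
- exact: measurable_fsum.
- by move=> x; exact: fsum_ge0.
Qed.

Lemma ipC F H : pairing F H = pairing H F.
Proof.
by rewrite /pairing; congr tot; apply/funext => x; apply/funext => c; rewrite muleC.
Qed.

Lemma le_ip F F' H H' : adm F -> adm F' -> adm H -> adm H' ->
  (forall x c, F x c <= F' x c) -> (forall x c, H x c <= H' x c) ->
  pairing F H <= pairing F' H'.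
Proof.
move=> aF aF' aH aH' FF' HH'; apply: le_tot; [exact: admM|exact: admM|].
by move=> x c; apply: lee_pmul; rewrite ?(adm_ge0 _ _ aF) ?(adm_ge0 _ _ aH).
Qed.

Lemma ipDl F F' H : adm F -> adm F' -> adm H ->
  pairing (fun x c => F x c + F' x c) H = pairing F H + pairing F' H.
Proof.
move=> aF aF' aH; rewrite /pairing -totD; [|exact: admM|exact: admM].
congr tot; apply/funext => x; apply/funext => c.
by rewrite ge0_muleDl ?(adm_ge0 _ _ aF) ?(adm_ge0 _ _ aF').
Qed.

Lemma ipZl (k : K) F H : (0 <= k)%R -> adm F -> adm H ->
  pairing (fun x c => k%:E * F x c) H = k%:E * pairing F H.
Proof.
move=> k0 aF aH; rewrite /pairing -totZ//; last exact: admM.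
by congr tot; apply/funext => x; apply/funext => c; rewrite muleA.
Qed.

Lemma ip_act g F H : adm F -> adm H ->
  pairing (fun x => F (act W g x)) (fun x => H (act W g x)) = pairing F H.
Proof. by move=> aF aH; rewrite /pairing -[RHS](tot_act g)//; exact: admM. Qed.

Lemma ip_LamE F H : adm F -> adm H ->
  pairing (markov_op F) H = \esum_(g in [set g | wt W g != 0%R])
    (wt W g)%:E * pairing (fun x => F (act W g x)) H.
Proof.
move=> aF aH.
have F0 := adm_ge0 _ _ aF; have H0 := adm_ge0 _ _ aH.
have w0 g : 0 <= (wt W g)%:E by rewrite lee_fin wt_ge0.
have aFH g : adm (fun x c => F (act W g x) c * H x c).
  by apply: admM => //; exact: adm_act.
transitivity (\int[mu]_x \esum_(g in [set g | wt W g != 0%R])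
    ((wt W g)%:E * \esum_(c in orb W x) (F (act W g x) c * H x c))).
  apply: eq_integral => x _.
  rewrite (eq_esum (b := fun c => \esum_(g in [set g | wt W g != 0%R])
      ((wt W g)%:E * (F (act W g x) c * H x c)))); last first.
    move=> c _; rewrite muleC -ge0_esumZl//; last by move=> g _; rewrite mule_ge0.
    by apply: eq_esum => g _; rewrite muleCA [H x c * _]muleC.
  rewrite exchange_esum; last by move=> *; rewrite !mule_ge0.
  by apply: eq_esum => g _; rewrite esumZl ?wt_ge0// => c _; rewrite mule_ge0.
rewrite integral_esum; first last.
- move=> g _; apply: emeasurable_funM; first exact: measurable_cst.
  exact: (measurable_fsum (aFH g)).
- by move=> g x _; apply: mule_ge0 => //; exact: (fsum_ge0 _ (aFH g)).
- exact: wt_countable.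
apply: eq_esum => g _; rewrite ge0_integralZl//.
  exact: (measurable_fsum (aFH g)).
by move=> x _; exact: (fsum_ge0 _ (aFH g)).
Qed.

(** Symmetry of the weights exchanges g with its inverse, and invariance of mu moves the translation
    from one factor of the pairing to the other. *)
Lemma ip_Lam F H : adm F -> adm H -> pairing (markov_op F) H = pairing F (markov_op H).
Proof.
move=> aF aH; rewrite [RHS]ipC !ip_LamE//.
rewrite (reindex_esum [set g | wt W g != 0%R] _ (ginv W)); last first.
  split=> [g|g h _ _|g]; rewrite /= ?wt_ginv//.
    exact: (can_inj (ginvK W)).
  by move=> g0; exists (ginv W g); rewrite /= ?wt_ginv ?ginvK.
apply: eq_esum => g _; rewrite wt_ginv; congr (_ * _).
rewrite -(ip_act g)//; last exact: adm_act.
rewrite ipC; congr pairing.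
by apply/funext => x; rewrite -[in X in act W _ (act W X _)](ginvK W g) ?act_ginv.
Qed.

Lemma ip_iter m n F H : adm F -> adm H ->
  pairing (iter m markov_op F) (iter n markov_op H) = pairing (iter (m + n) markov_op F) H.
Proof.
move=> aF aH; elim: n m => [|n IHn] m; first by rewrite addn0.
rewrite iterS -ip_Lam; [|exact: adm_iter|exact: adm_iter].
by rewrite -iterS IHn addSnnS.
Qed.

Lemma le_Lam F H : (forall x c, F x c <= H x c) ->
  forall x c, markov_op F x c <= markov_op H x c.
Proof.
by move=> FH x c; apply: le_esum => g _; rewrite lee_wpmul2l// lee_fin wt_ge0.
Qed.

Lemma le_iter_Lam n F H : (forall x c, F x c <= H x c) ->
  forall x c, iter n markov_op F x c <= iter n markov_op H x c.
Proof. by move=> FH; elim: n => //= n; exact: le_Lam. Qed.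

(** The expansion of (a - t b)^2 >= 0, stated without subtraction so that infinite values are
    allowed. *)
Lemma amgm (t : K) (a b : \bar K) : (0 <= t)%R -> 0 <= a -> 0 <= b ->
  (2 * t)%:E * (a * b) <= a * a + (t ^+ 2)%:E * (b * b).
Proof.
move=> t0; case: a b => [a| |] [b| |]// a0 b0.
- rewrite -!EFinM -EFinD lee_fin -subr_ge0.
  by rewrite [leRHS](_ : _ = (a - t * b) ^+ 2)%R ?sqr_ge0//; ring.
- have [->|t1] := eqVneq t 0%R.
    by rewrite mulr0 mul0e expr0n/= mul0e adde0 -EFinM lee_fin mulr_ge0.
  suff -> : (t ^+ 2)%:E * (+oo * +oo) = +oo :> \bar K by rewrite addey// leey.
  by rewrite mulyy gt0_muley// lte_fin exprn_gt0// lt_neqAle eq_sym t1.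
- by rewrite mulyy addye ?leey// -EFinM.
- rewrite mulyy; have [->|t1] := eqVneq t 0%R.
    by rewrite mulr0 mul0e expr0n/= mul0e adde0 leey.
  suff -> : (t ^+ 2)%:E * +oo = +oo :> \bar K by rewrite leey.
  by rewrite gt0_muley// lte_fin exprn_gt0// lt_neqAle eq_sym t1.
Qed.

Lemma ip_amgm (t : K) F H : (0 <= t)%R -> adm F -> adm H ->
  (2 * t)%:E * pairing F H <= pairing F F + (t ^+ 2)%:E * pairing H H.
Proof.
move=> t0 aF aH; rewrite /pairing -!totZ ?mulr_ge0 ?exprn_ge0//; try exact: admM.
rewrite -totD; [|exact: admM|by apply: admZ; [exact: exprn_ge0|exact: admM]].
apply: le_tot => [||x c].
- by apply: admZ; [rewrite mulr_ge0|exact: admM].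
- by apply: admD; [|apply: admZ; [exact: exprn_ge0|]]; exact: admM.
- by apply: amgm => //; exact: adm_ge0.
Qed.

End coset_functions.

(** * Return probabilities *)

(** Bernoulli's inequality: if r = 1 + e with e > 0, then r^(2^j) >= 1 + 2^j e is unbounded. *)
Lemma exprn_le_bound (K : realType) (r C : K) :
  (0 <= r)%R -> (forall j, r ^+ (2 ^ j) <= C)%R -> (r <= 1)%R.
Proof.
move=> r0 rC; rewrite leNgt; apply/negP => r1.
pose e := (r - 1)%R; have e0 : (0 < e)%R by rewrite subr_gt0.
have B n : (1 + n%:R * e <= r ^+ n)%R.
  elim: n => [|n IHn]; first by rewrite mul0r addr0 expr0.
  rewrite exprS (_ : r = 1 + e)%R; last by rewrite /e; ring.
  rewrite (_ : r = 1 + e)%R in IHn; last by rewrite /e; ring.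
  apply: (@le_trans _ _ ((1 + e) * (1 + n%:R * e)))%R; last first.
    by rewrite ler_pM2l// addr_gt0.
  have n0 : (0 <= n%:R * (e * e))%R by rewrite !mulr_ge0// ltW.
  by rewrite -natr1; lra.
have [n nC] : exists n, (C / e < n%:R)%R.
  exists (Num.bound `|C / e|%R); apply: le_lt_trans (ler_norm _) _.
  exact: archi_boundP.
have := rC n; apply/negP; rewrite -ltNge.
apply: lt_le_trans (B _); rewrite ltr_pdivrMr// in nC.
apply: (lt_trans nC); apply: (@le_lt_trans _ _ ((2 ^ n)%:R * e)%R).
  by rewrite ler_pM2r// ler_nat ltnW// ltn_expl.
by rewrite ltrDr.
Qed.

(** Iterating the doubling inequality gives r_1^(2^j) <= r_(2^j) <= C s^(2^j), so the powers of r_1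
    / s along 2^j stay below C and r_1 / s cannot exceed 1. *)
Lemma doubling_bound (K : realType) (r : nat -> K) (C s : K) :
  (0 < s)%R -> (forall n, 0 <= r n)%R -> (forall n, r n ^+ 2 <= r (2 * n)%N)%R ->
  (forall n, r n <= C * s ^+ n)%R -> (r 1%N <= s)%R.
Proof.
move=> s0 r0 r2 rC.
have rj j : (r 1%N ^+ (2 ^ j) <= r (2 ^ j)%N)%R.
  elim: j => [|j IHj]; first by rewrite expn0 expr1.
  rewrite expnS; apply: le_trans (r2 _); rewrite mulnC exprM.
  by rewrite lerXn2r ?nnegrE ?exprn_ge0.
rewrite -[leRHS]mul1r -ler_pdivrMr//; apply: (@exprn_le_bound _ _ C) => [|j].
  by rewrite divr_ge0// ltW.
by rewrite expr_div_n ler_pdivrMr ?exprn_gt0//; exact: le_trans (rj j) (rC _).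
Qed.

(** * Positivity, paths and monotone limits of the averaging operator *)

Section walk.
Context (K : realType) d (X : measurableType d) (mu : probability X K).
Context (G C : choiceType) (W : coset_walk mu G C).
Implicit Types (F H : X -> C -> \bar K) (f h : X -> \bar K).
Local Notation Lam := (markov_op W).
Local Notation adm := (adm W).
Local Notation ip := (pairing W).
Local Notation tot := (tot W).
Local Notation cls := (cls W).
Local Notation orb := (orb W).

Definition diag_part f : X -> C -> \bar K := fun x c => if cls x == c then f x else 0.

Lemma diag_cls f x : diag_part f x (cls x) = f x.
Proof. by rewrite /diag_part eqxx. Qed.

Lemma adm_diag f : measurable_fun [set: X] f -> (forall x, 0 <= f x) ->
  adm (diag_part f).
Proof.
move=> mf f0; split=> [x c|g]; first by rewrite /diag_part; case: ifP.
rewrite (_ : (fun x => _) = fun x =>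
    (\1_[set y | cls y = cls (act W g y)] x)%:E * f x); last first.
  apply/funext => x; rewrite /diag_part indicE; case: ifPn => /eqP xg.
    by rewrite mem_set// mul1e.
  by rewrite memNset// mul0e.
apply: emeasurable_funM => //; apply/measurable_EFinP/measurable_indic.
have [n nE] := elt1 W.
have := cls_measurable W (elt W n) g.
by rewrite (_ : mkset _ = [set y | cls y = cls (act W g y)])//;
  apply/seteqP; split=> x /=; rewrite nE.
Qed.

Lemma measurable_cls F : adm F -> measurable_fun [set: X] (fun x => F x (cls x)).
Proof.
move=> [_ mF]; have [n nE] := elt1 W.
rewrite (_ : (fun x => _) = fun x => F x (cls (act W (elt W n) x)))//.
by apply/funext => x; rewrite nE.
Qed.

Lemma ip_diag F f : adm F -> (forall x, 0 <= f x) ->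
  ip F (diag_part f) = \int[mu]_x (F x (cls x) * f x).
Proof.
move=> aF f0; apply: eq_integral => x _.
rewrite esum_mkcond -[RHS](@esum_set1 _ _ (cls x) (fun c => F x c * f x)).
  2: by rewrite mule_ge0 ?(adm_ge0 _ _ aF).
rewrite [RHS]esum_mkcond; apply: eq_esum => c _; rewrite /diag_part.
have [<-|xc] := eqVneq (cls x) c.
  by rewrite !mem_set//; exact: cls_orb.
rewrite mule0 if_same memNset//= => cx.
by rewrite cx eqxx in xc.
Qed.

Lemma Lam_ge0 F : (forall x c, 0 <= F x c) -> forall x c, 0 <= Lam F x c.
Proof.
by move=> F0 x c; apply: esum_ge0 => g _; rewrite mule_ge0// lee_fin wt_ge0.
Qed.

Lemma iter_Lam_ge0 n F : (forall x c, 0 <= F x c) ->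
  forall x c, 0 <= iter n Lam F x c.
Proof. by move=> F0; elim: n => //= n; exact: Lam_ge0. Qed.

Lemma LamZ (k : K) F : (0 <= k)%R -> (forall x c, 0 <= F x c) ->
  Lam (fun x c => k%:E * F x c) = (fun x c => k%:E * Lam F x c).
Proof.
move=> k0 F0; apply/funext => x; apply/funext => c.
rewrite /markov_op -esumZl//; first by apply: eq_esum => g _; rewrite muleCA.
by move=> g _; rewrite mule_ge0// lee_fin wt_ge0.
Qed.

Lemma iter_LamZ n (k : K) F : (0 <= k)%R -> (forall x c, 0 <= F x c) ->
  iter n Lam (fun x c => k%:E * F x c) = (fun x c => k%:E * iter n Lam F x c).
Proof.
by move=> k0 F0; elim: n => //= n ->; rewrite LamZ//; exact: iter_Lam_ge0.
Qed.

Lemma LamD F H : (forall x c, 0 <= F x c) -> (forall x c, 0 <= H x c) ->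
  Lam (fun x c => F x c + H x c) = (fun x c => Lam F x c + Lam H x c).
Proof.
move=> F0 H0; apply/funext => x; apply/funext => c.
rewrite /markov_op -esumD//.
- by apply: eq_esum => g _; rewrite ge0_muleDr.
- by move=> g _; rewrite mule_ge0// lee_fin wt_ge0.
- by move=> g _; rewrite mule_ge0// lee_fin wt_ge0.
Qed.

Lemma Lam_le1 F : (forall x c, F x c <= 1) -> forall x c, Lam F x c <= 1.
Proof.
move=> F1 x c; rewrite -(wt_sum W); apply: le_esum => g _.
by rewrite -[leRHS]mule1 lee_wpmul2l// lee_fin wt_ge0.
Qed.

Lemma iter_Lam_le1 n F : (forall x c, F x c <= 1) ->
  forall x c, iter n Lam F x c <= 1.
Proof. by move=> F1; elim: n => //= n; exact: Lam_le1. Qed.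

Lemma Lam_ge F g x c : (forall x c, 0 <= F x c) -> (0 < wt W g)%R ->
  (wt W g)%:E * F (act W g x) c <= Lam F x c.
Proof.
move=> F0 g0; apply: esum_ge; exists [set g].
  by split=> // _ ->; rewrite /= gt_eqF.
by rewrite fsbig_set1.
Qed.

(** A nonzero iterate is witnessed by a path of positive weight from x to y, and e is the product of
    its weights. The path is found from [F] but bounds the iterates of every [H] from below. *)
Lemma iter_Lam_neq0 n F x c : (forall x c, 0 <= F x c) ->
  iter n Lam F x c != 0 -> exists y (e : K), [/\ F y c != 0, (0 < e)%R &
    forall H, (forall x c, 0 <= H x c) -> e%:E * H y c <= iter n Lam H x c].
Proof.
move=> F0; elim: n x => [|n IHn] x /= FN0.
  by exists x, 1%R; split=> // H _; rewrite mul1e.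
have [[g g0 gF]|nog] := pselect (exists2 g, wt W g != 0%R &
    iter n Lam F (act W g x) c != 0).
  have [y [e [Fy e0 eH]]] := IHn _ gF.
  have wg : (0 < wt W g)%R by rewrite lt_neqAle eq_sym g0 wt_ge0.
  exists y, (wt W g * e)%R; split=> //; first by rewrite mulr_gt0.
  move=> H H0; apply: le_trans (Lam_ge _ _ _ wg); last exact: iter_Lam_ge0.
  by rewrite EFinM -muleA lee_wpmul2l ?lee_fin ?wt_ge0// eH.
exfalso; move/negP : FN0; apply; apply/eqP/esum1 => g g0.
case: (eqVneq (iter n Lam F (act W g x) c) 0) => [->|gF]; first by rewrite mule0.
by exfalso; apply: nog; exists g.
Qed.

(** The walk follows a word for g with probability at least e, the product of the weights of the
    letters. *)
Lemma iter_Lam_act g : exists m (e : K), (0 < e)%R /\ forall F,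
  (forall x c, 0 <= F x c) -> forall x c,
  e%:E * F (act W g x) c <= iter m Lam F x c.
Proof.
have [l [wl lE]] := act_word W g.
suff [m [e [e0 eF]]] : exists m (e : K), (0 < e)%R /\ forall F,
    (forall x c, 0 <= F x c) -> forall x c,
    e%:E * F (foldr (act W) x l) c <= iter m Lam F x c.
  by exists m, e; split=> // F F0 x c; rewrite lE; exact: eF.
elim: l wl {lE} => [_|h l IHl /= /andP[h0 /IHl[m [e [e0 eF]]]]].
  by exists 0%N, 1%R; split=> // F F0 x c; rewrite mul1e.
exists m.+1, (e * wt W h)%R; split; first by rewrite mulr_gt0.
move=> F F0 x c; rewrite iterSr.
apply: le_trans (eF _ (Lam_ge0 F0) _ _).
by rewrite EFinM -muleA lee_wpmul2l ?lee_fin ?(ltW e0)//; exact: Lam_ge.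
Qed.

Lemma cvg_Lam (F_ : nat -> X -> C -> \bar K) F :
  (forall n x c, 0 <= F_ n x c) ->
  (forall x c, nondecreasing_seq (fun n => F_ n x c)) ->
  (forall x c, (fun n => F_ n x c) @ \oo --> F x c) ->
  forall x c, (fun n => Lam (F_ n) x c) @ \oo --> Lam F x c.
Proof.
move=> F0 nd cF x c; apply: cvg_esum => [n g _|g _ m n mn|g _].
- by rewrite mule_ge0// lee_fin wt_ge0.
- by rewrite lee_wpmul2l ?lee_fin ?wt_ge0//; exact: nd.
- exact: cvgeZl.
Qed.

Lemma cvg_iter_Lam k (F_ : nat -> X -> C -> \bar K) F :
  (forall n x c, 0 <= F_ n x c) ->
  (forall x c, nondecreasing_seq (fun n => F_ n x c)) ->
  (forall x c, (fun n => F_ n x c) @ \oo --> F x c) ->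
  forall x c, (fun n => iter k Lam (F_ n) x c) @ \oo --> iter k Lam F x c.
Proof.
move=> F0 nd cF; elim: k => // k IHk; apply: cvg_Lam => //.
  by move=> n; exact: iter_Lam_ge0.
by move=> x c m n mn; apply: le_iter_Lam => y e; exact: nd.
Qed.

Lemma cvg_tot (F_ : nat -> X -> C -> \bar K) F :
  (forall n, adm (F_ n)) ->
  (forall x c, nondecreasing_seq (fun n => F_ n x c)) ->
  (forall x c, (fun n => F_ n x c) @ \oo --> F x c) ->
  (fun n => tot (F_ n)) @ \oo --> tot F.
Proof.
move=> aF nd cF.
have cS x : (fun n => \esum_(c in orb x) F_ n x c) @ \oo -->
    \esum_(c in orb x) F x c.
  by apply: cvg_esum => [n c _|c _ m n mn|c _];
    [exact: adm_ge0|exact: nd|exact: cF].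
rewrite [X in _ --> X](_ : _ =
    \int[mu]_x limn (fun n => \esum_(c in orb x) F_ n x c)); last first.
  by apply: eq_integral => x _; apply/esym/cvg_lim.
apply: cvg_monotone_convergence => //.
- by move=> n; exact: measurable_fsum.
- by move=> n x _; exact: fsum_ge0.
- by move=> x _ m n mn; apply: le_esum => c _; exact: nd.
Qed.

Lemma fin_num01 (a : \bar K) : 0 <= a -> a <= 1 -> a \is a fin_num.
Proof. by move=> a0 a1; rewrite ge0_fin_numE// (le_lt_trans a1)// ltry. Qed.

Lemma cvg_ip_iter k (F_ : nat -> X -> C -> \bar K) F :
  (forall n, adm (F_ n)) -> (forall x c, 0 <= F x c <= 1) ->
  (forall x c, nondecreasing_seq (fun n => F_ n x c)) ->
  (forall x c, (fun n => F_ n x c) @ \oo --> F x c) ->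
  (fun n => ip (iter k Lam (F_ n)) (F_ n)) @ \oo --> ip (iter k Lam F) F.
Proof.
move=> aF F01 nd cF.
have F0 x c : 0 <= F x c by case/andP: (F01 x c).
have F1 x c : F x c <= 1 by case/andP: (F01 x c).
have Fn0 n x c : 0 <= F_ n x c by exact: adm_ge0.
apply: cvg_tot => [n|x c m n mn|x c].
- by apply: admM => //; exact: adm_iter.
- apply: lee_pmul => //; [exact: iter_Lam_ge0| |exact: nd].
  by apply: le_iter_Lam => y e; exact: nd.
- apply: cvgeM => //; last exact: cvg_iter_Lam.
  by rewrite mule_def_fin// fin_num01 ?iter_Lam_ge0 ?iter_Lam_le1.
Qed.

End walk.

(* The third hypothesis encodes r_n^2 <= r_0 r_(2n). *)
Lemma moment_bound (K : realType) (r : nat -> K) (C s : K) :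
  (0 < s)%R -> (forall n, 0 <= r n)%R ->
  (forall n t, 0 <= t -> 2 * t * r n <= r (2 * n)%N + t ^+ 2 * r 0%N)%R ->
  (forall n, r n <= C * s ^+ n)%R -> (r 1%N <= s * r 0%N)%R.
Proof.
move=> s0 r0 r2 rC.
have [r00|r00] := eqVneq (r 0%N) 0%R.
  rewrite r00 mulr0 leNgt; apply/negP => r1.
  (* With r_0 = 0, the value t = r_2 / r_1 gives 2 r_2 <= r_2, and then t = 1 gives 2 r_1 <= r_2 <=
     0. *)
  have t0 : (0 <= r 2%N / r 1%N)%R by rewrite divr_ge0.
  have := r2 1%N _ t0; rewrite r00 mulr0 addr0 muln1 -mulrA mulfVK ?gt_eqF//.
  have := r2 1%N 1%R ler01; rewrite r00 mulr0 addr0 muln1.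
  lra.
have r0p : (0 < r 0%N)%R by rewrite lt_neqAle eq_sym r00 r0.
rewrite -ler_pdivrMr//.
apply: (@doubling_bound _ (fun n => r n / r 0%N)%R (C / r 0%N)) => // n.
- by rewrite divr_ge0.
(* The optimal t in the moment inequality. *)
- have := r2 n (r n / r 0%N)%R (divr_ge0 (r0 n) (ltW r0p)).
  set q := (r n / r 0%N)%R.
  have -> : r n = (q * r 0%N)%R by rewrite /q mulfVK.
  move=> h; rewrite ler_pdivlMr//; lra.
- by rewrite mulrAC ler_pM2r ?invr_gt0.
Qed.

Definition ereal_indic (K : realType) (T : Type) (A : set T) (x : T) : \bar K := (\1_A x)%:E.

(** * Return probabilities and the walk watched on one class *)

Section return_prob.
Context (K : realType) d (X : measurableType d) (mu : probability X K).
Context (G C : choiceType) (W : coset_walk mu G C).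
Implicit Types (F H : X -> C -> \bar K) (f h : X -> \bar K) (A B : set X).
Local Notation Lam := (markov_op W).
Local Notation adm := (adm W).
Local Notation ip := (pairing W).
Local Notation tot := (tot W).
Local Notation cls := (cls W).
Local Notation orb := (orb W).
Local Notation diag := (diag_part W).

Definition hit_prob k : X -> C -> \bar K := iter k Lam (diag (cst 1)).
Definition class_return k x : \bar K := hit_prob k x (cls x).

Local Notation ind := (@ereal_indic K X).

Lemma indE A x : ind A x = (x \in A)%:R%:E.
Proof. by rewrite /ereal_indic indicE. Qed.

Lemma ind_ge0 A x : 0 <= ind A x. Proof. by rewrite lee_fin. Qed.

Lemma ind_le1 A x : ind A x <= 1.
Proof. by rewrite indE lee_fin; case: (_ \in _). Qed.

Lemma measurable_ind A : measurable A -> measurable_fun [set: X] (ind A).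
Proof. by move=> mA; apply/measurable_EFinP/measurable_indic. Qed.

Lemma diag_ge0 f : (forall x, 0 <= f x) -> forall x c, 0 <= diag f x c.
Proof. by move=> f0 x c; rewrite /diag_part; case: ifP. Qed.

Lemma le_diag f h : (forall x, f x <= h x) -> forall x c, diag f x c <= diag h x c.
Proof. by move=> fh x c; rewrite /diag_part; case: ifP. Qed.

Lemma diag_le1 f : (forall x, f x <= 1) -> forall x c, diag f x c <= 1.
Proof. by move=> f1 x c; rewrite /diag_part; case: ifP => // _; rewrite lee_fin. Qed.

Lemma adm_hit k : adm (hit_prob k).
Proof. by apply: adm_iter; apply: adm_diag. Qed.

Lemma hit_ge0 k x c : 0 <= hit_prob k x c.
Proof. exact: adm_ge0 (adm_hit k). Qed.

Lemma hit_le1 k x c : hit_prob k x c <= 1.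
Proof. by apply: iter_Lam_le1 => y e; exact: diag_le1. Qed.

Lemma measurable_ret k : measurable_fun [set: X] (class_return k).
Proof. exact: measurable_cls (adm_hit k). Qed.

Lemma ret_fin_num k x : class_return k x \is a fin_num.
Proof. by rewrite fin_num01 ?hit_ge0 ?hit_le1. Qed.

Section bounded_return.
Variables (B : set X) (k N : nat) (s : K).
Hypotheses (mB : measurable B) (s0 : (0 < s)%R) (s1 : (s <= 1)%R).
Hypothesis BN : forall x, B x ->
  exists n, (0 < n <= N)%N /\ class_return (n * k) x <= (s ^+ n)%:E.

(* T is the walk in blocks of k steps, killed outside B and watched at the
   class of its starting point; it is self-adjoint on L^2(X). Every point of B
   contracts within N blocks, so T^L 1 <= s^(L - N), and the moment bound turns
   this into a bound on T itself. *)
Let T f := fun x => ind B x * iter k Lam (diag f) x (cls x).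
Let g L := iter L T (ind B).

Let T_ge0 f : (forall x, 0 <= f x) -> forall x, 0 <= T f x.
Proof.
move=> f0 x; rewrite /T mule_ge0 ?ind_ge0//.
by apply: iter_Lam_ge0 => y c; exact: diag_ge0.
Qed.

Let mT f : (forall x, 0 <= f x) -> measurable_fun [set: X] f ->
  measurable_fun [set: X] (T f).
Proof.
move=> f0 mf; apply: emeasurable_funM; first exact: measurable_ind.
by apply: (measurable_cls (W := W)); apply: adm_iter; exact: adm_diag.
Qed.

Let le_T f h : (forall x, f x <= h x) -> forall x, T f x <= T h x.
Proof.
move=> fh x; rewrite lee_wpmul2l ?ind_ge0//.
by apply: le_iter_Lam => y c; exact: le_diag.
Qed.

Let le_iterT n f h : (forall x, f x <= h x) -> forall x, iter n T f x <= iter n T h x.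
Proof. by move=> fh; elim: n => //= n; exact: le_T. Qed.

Let TZ (c : K) f : (0 <= c)%R -> (forall x, 0 <= f x) ->
  T (fun x => c%:E * f x) = (fun x => c%:E * T f x).
Proof.
move=> c0 f0; apply/funext => x; rewrite /T.
rewrite (_ : diag _ = fun x e => c%:E * diag f x e); last first.
  by apply/funext => y; apply/funext => e; rewrite /diag_part; case: ifP; rewrite ?mule0.
rewrite iter_LamZ//; first by rewrite muleCA.
exact: diag_ge0.
Qed.

Let iterT_ge0 n f : (forall x, 0 <= f x) -> forall x, 0 <= iter n T f x.
Proof. by move=> f0; elim: n => //= n; exact: T_ge0. Qed.

Let iterTZ n (c : K) f : (0 <= c)%R -> (forall x, 0 <= f x) ->
  iter n T (fun x => c%:E * f x) = (fun x => c%:E * iter n T f x).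
Proof.
by move=> c0 f0; elim: n => //= n ->; rewrite TZ//; exact: iterT_ge0.
Qed.

Let g_ge0 L x : 0 <= g L x.
Proof. by apply: iterT_ge0 => y; exact: ind_ge0. Qed.

Let mg L : measurable_fun [set: X] (g L).
Proof.
elim: L => [|L IHL]; first exact: measurable_ind.
by apply: mT => // x; exact: g_ge0.
Qed.

Let gB L x : ind B x * g L x = g L x.
Proof.
rewrite indE; case: (boolP (x \in B)) => xB; first by rewrite mul1e.
rewrite mul0e; case: L => [|L]; first by rewrite /g /= indE (negbTE xB).
by rewrite /g iterS /T indE (negbTE xB) mul0e.
Qed.

Let g0B L x : g L x * g 0%N x = g L x.
Proof. by rewrite muleC gB. Qed.

(** The watched walk has to be in its class at the end of every block, whereas the return
    probability asks this of the last one only. *)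
Let iterT1_ret n x : iter n T (cst 1) x <= class_return (n * k) x \/ n = 0%N.
Proof.
case: n => [|n]; first by right.
left; elim: n x => [|n IHn] x.
  by rewrite mul1n /= /T -[leRHS]mul1e lee_wpmul2r ?ind_le1 ?hit_ge0.
rewrite iterS {1}/T /class_return /hit_prob mulSn iterD -[leRHS]mul1e.
apply: lee_pmul; rewrite ?ind_ge0 ?ind_le1//.
  apply: iter_Lam_ge0; apply: diag_ge0; apply: iterT_ge0 => y.
  by rewrite lee_fin.
apply: le_iter_Lam => y c; rewrite /diag_part.
by case: ifPn => [/eqP <-|_]; [exact: IHn|exact: hit_ge0].
Qed.

Let g_le1 L x : g L x <= 1.
Proof.
elim: L x => [|L IHL] x; first exact: ind_le1.
rewrite /g iterS /T -[leRHS]mule1; apply: lee_pmul.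
- exact: ind_ge0.
- by apply: iter_Lam_ge0; apply: diag_ge0; exact: g_ge0.
- exact: ind_le1.
- by apply: iter_Lam_le1 => y c; exact: diag_le1.
Qed.

Let g_decay L x : g L x <= (s ^- N * s ^+ L)%:E.
Proof.
elim/ltn_ind: L x => L IHL x.
have [Bx|Bx] := pselect (B x); last first.
  rewrite -gB indE memNset// mul0e lee_fin mulr_ge0// ?invr_ge0 exprn_ge0//;
  exact: ltW.
have [n [/andP[n0 nN] xn]] := BN Bx.
(* If fewer than n <= N blocks are left, the factor s^-N already makes the bound at least 1.
   Otherwise the first n blocks contract by s^n and the induction hypothesis covers the rest. *)
have [Ln|nL] := ltnP L n.
  apply: (le_trans (g_le1 _ _)); rewrite lee_fin mulrC ler_pdivlMr ?exprn_gt0//.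
  by rewrite mul1r ler_wiXn2l// ?(ltW s0)// (leq_trans (ltnW Ln)).
have LE : L = (n + (L - n))%N by rewrite subnKC.
pose c := (s ^- N * s ^+ (L - n))%R; have c0 : (0 <= c)%R.
  by rewrite mulr_ge0// ?invr_ge0 exprn_ge0// ltW.
rewrite LE /g iterD; apply: (@le_trans _ _
    (iter n T (fun x => c%:E * cst 1 x) x)).
  apply: le_iterT => y; rewrite mule1; apply: IHL.
  by rewrite -subn_gt0 subKn.
rewrite iterTZ//.
rewrite exprD (mulrCA _ (s ^+ n)%R) -/c (mulrC _ c) [leRHS]EFinM.
rewrite lee_wpmul2l ?lee_fin//.
have [|nE] := iterT1_ret n x; last by rewrite nE in n0.
by move=> /le_trans; apply.
Qed.

Let T_sym f h : measurable_fun [set: X] f -> measurable_fun [set: X] h ->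
  (forall x, 0 <= f x) -> (forall x, 0 <= h x) ->
  (forall x, ind B x * f x = f x) -> (forall x, ind B x * h x = h x) ->
  \int[mu]_x (T f x * h x) = \int[mu]_x (f x * T h x).
Proof.
move=> mf mh f0 h0 fB hB.
have af : adm (diag f) by exact: adm_diag.
have ah : adm (diag h) by exact: adm_diag.
transitivity (ip (iter k Lam (diag f)) (diag h)).
  rewrite ip_diag//; last exact: adm_iter.
  by apply: eq_integral => x _; rewrite /T muleAC hB muleC.
rewrite -[k]addn0 addnC -(ip_iter 0 k)//= ipC ip_diag//; last exact: adm_iter.
by apply: eq_integral => x _; rewrite /T muleA [f x * _]muleC fB muleC.
Qed.

(** By symmetry of T these integrals depend on i + j only: they are the moments of T at the vector
    1_B. *)
Let g_shift i j : \int[mu]_x (g i x * g j x) = \int[mu]_x g (i + j) x.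
Proof.
elim: j i => [|j IHj] i.
  by rewrite addn0; apply: eq_integral => x _; rewrite g0B.
by rewrite addnS -addSn -IHj [RHS]T_sym.
Qed.

Let g_fin L : \int[mu]_x g L x \is a fin_num.
Proof.
rewrite fin_num01//; first by apply: integral_ge0 => x _; exact: g_ge0.
have -> : 1 = \int[mu]_x (cst 1 x) :> \bar K.
  rewrite integral_cst// mul1e; exact/esym/probability_setT.
by apply: ge0_le_integral.
Qed.

Lemma bounded_return_le :
  ip (iter k Lam (diag (ind B))) (diag (ind B)) <= s%:E * mu B.
Proof.
have -> : mu B = \int[mu]_x g 0%N x by rewrite /g /= /ereal_indic integral_indic// setIT.
have -> : ip (iter k Lam (diag (ind B))) (diag (ind B)) = \int[mu]_x g 1%N x.
  rewrite ip_diag//.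
  - by apply: eq_integral => x _; rewrite /g /= /T muleC.
  - by apply: adm_iter; apply: adm_diag; [exact: measurable_ind|exact: ind_ge0].
  - exact: ind_ge0.
pose r L := fine (\int[mu]_x g L x).
have rE L : \int[mu]_x g L x = (r L)%:E by rewrite fineK ?g_fin.
rewrite !rE -EFinM lee_fin; apply: (@moment_bound _ r (s ^- N)) => // [n|n t t0|n].
- by rewrite /r fine_ge0//; apply: integral_ge0 => x _; exact: g_ge0.
(* The moment inequality is [amgm] for g_n and g_0, integrated over X. *)
- rewrite -lee_fin EFinD !EFinM -!rE mul2n -addnn -g_shift -EFinM.
  rewrite -[in leLHS](addn0 n) -g_shift -[0%N in leRHS]addn0 -g_shift.
  have [t20 tt0] : (0 <= 2 * t)%R /\ (0 <= t ^+ 2)%R.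
    by rewrite mulr_ge0 ?exprn_ge0.
  have mgg i j : measurable_fun [set: X] (fun x => g i x * g j x).
    exact: emeasurable_funM.
  have gg0 i j x : 0 <= g i x * g j x by apply: mule_ge0; exact: g_ge0.
  have mZ (c : K) i j : measurable_fun [set: X] (fun x => c%:E * (g i x * g j x)).
    by apply: emeasurable_funM => //; exact: measurable_cst.
  have Z0 (c : K) i j x : (0 <= c)%R -> 0 <= c%:E * (g i x * g j x).
    by move=> c0; apply: mule_ge0.
  rewrite -!ge0_integralZl_EFin//.
  rewrite -ge0_integralD//; last by move=> x _; exact: Z0.
  apply: ge0_le_integral => //.
  + by move=> x _; exact: Z0.
  + exact: emeasurable_funD.
  + by move=> x _; apply: amgm; rewrite ?g_ge0.
- rewrite -lee_fin -rE.
  have -> : (s ^- N * s ^+ n)%:E = \int[mu]_x (cst (s ^- N * s ^+ n)%:E x).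
    rewrite integral_cst// -[LHS]mule1; congr (_ * _).
    exact/esym/probability_setT.
  by apply: ge0_le_integral.
Qed.

End bounded_return.

End return_prob.

Lemma expr_eventually_small (K : realType) (M q : K) : (0 <= q < 1)%R ->
  exists m0, forall m, (m0 <= m)%N -> (M * q ^+ m <= 1)%R.
Proof.
move=> /andP[q0 q1].
have : (fun m => M * q ^+ m)%R @ \oo --> 0%R.
  by apply: cvg_geometric; rewrite ger0_norm.
move=> /cvgr_le/(_ 1%R ltr01)[m0 _ hm0]; exists m0 => m; exact: hm0.
Qed.

(** * From decay along a subsequence of times to decay at all large times *)

Section decay.
Context (K : realType) d (X : measurableType d) (mu : probability X K).
Context (G C : choiceType) (W : coset_walk mu G C).
Implicit Types (F H : X -> C -> \bar K) (f h : X -> \bar K) (A B : set X).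
Local Notation Lam := (markov_op W).
Local Notation adm := (adm W).
Local Notation ip := (pairing W).
Local Notation cls := (cls W).
Local Notation diag := (diag_part W).
Local Notation ind := (@ereal_indic K X).
Local Notation hit := (hit_prob W).
Local Notation ret := (class_return W).

(** The contraction time n may be unbounded on [A]. The sets [AN N] where it is at most N increase
    to [A], and the bounded case passes to the limit by monotone convergence. *)
Lemma return_le A k (s : K) : measurable A -> (0 < s)%R -> (s <= 1)%R ->
  (forall x, A x -> exists n, (0 < n)%N /\ ret (n * k) x <= (s ^+ n)%:E) ->
  ip (iter k Lam (diag (ind A))) (diag (ind A)) <= s%:E * mu A.
Proof.
move=> mA s0 s1 hA.
pose AN N := A `&` [set x | exists n, (0 < n <= N)%N /\ ret (n * k) x <= (s ^+ n)%:E].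
have mAN N : measurable (AN N).
  apply: measurableI => //.
  rewrite (_ : mkset _ = \bigcup_(n in [set n | (0 < n <= N)%N])
      [set x | ret (n * k) x <= (s ^+ n)%:E]); last first.
    by apply/seteqP; split=> x [n]; [move=> [nN xn]; exists n|move=> nN xn; exists n].
  apply: bigcup_measurable => n _; rewrite -[X in measurable X]setTI.
  exact: emeasurable_fun_infty_c (measurable_ret W _) _.
have AN_nd m n : (m <= n)%N -> AN m `<=` AN n.
  move=> mn x [Ax [i [/andP[i0 im] xi]]]; split=> //; exists i; split=> //.
  by rewrite i0 (leq_trans im).
have indcvg x : (fun N => ind (AN N) x) @ \oo --> ind A x.
  have [Ax|nAx] := pselect (A x).
    have [n [n0 xn]] := hA x Ax.
    rewrite indE mem_set//; apply: cvg_near_cst; exists n => // N /= nN.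
    by rewrite indE mem_set//; split=> //; exists n; rewrite n0.
  rewrite indE memNset//; apply: cvg_near_cst; apply: nearW => N.
  by rewrite indE memNset// => -[].
have ind_nd m n x : (m <= n)%N -> ind (AN m) x <= ind (AN n) x.
  move=> mn; rewrite !indE lee_fin ler_nat.
  by case: (boolP (x \in AN m)) => //; rewrite inE => /(AN_nd _ _ mn) xn; rewrite mem_set.
have := @cvg_ip_iter _ _ _ _ _ _ W k (fun N => diag (ind (AN N))) (diag (ind A)).
move=> /(_ _ _ _ _)/cvg_lim <- //.
- apply: lime_le.
    apply: ereal_nondecreasing_is_cvgn => m n mn; apply: le_ip.
    + by apply: adm_iter; apply: adm_diag; [exact: measurable_ind|exact: ind_ge0].
    + by apply: adm_iter; apply: adm_diag; [exact: measurable_ind|exact: ind_ge0].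
    + by apply: adm_diag; [exact: measurable_ind|exact: ind_ge0].
    + by apply: adm_diag; [exact: measurable_ind|exact: ind_ge0].
    + by apply: le_iter_Lam; apply: le_diag => x; exact: ind_nd.
    + by apply: le_diag => x; exact: ind_nd.
  apply: nearW => N; apply: (@le_trans _ _ (s%:E * mu (AN N))).
    apply: (@bounded_return_le _ _ _ _ _ _ _ _ _ N) => //.
    by move=> x [].
  by rewrite lee_wpmul2l ?lee_fin ?(ltW s0)// le_measure ?inE// => x [].
- by move=> N; apply: adm_diag; [exact: measurable_ind|exact: ind_ge0].
- by move=> x c; rewrite diag_ge0 ?diag_le1// => y; [exact: ind_le1|exact: ind_ge0].
- by move=> x c m n mn; apply: le_diag => y; exact: ind_nd.
- by move=> x c; rewrite /diag_part; case: ifP => _; [exact: indcvg|exact: cvg_cst].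
Qed.

Lemma iter_LamD n F H : (forall x c, 0 <= F x c) -> (forall x c, 0 <= H x c) ->
  iter n Lam (fun x c => F x c + H x c) =
  (fun x c => iter n Lam F x c + iter n Lam H x c).
Proof.
by move=> F0 H0; elim: n => //= n ->; rewrite LamD//; exact: iter_Lam_ge0.
Qed.

(** A step by a fixed g of positive weight is undone by a step by its inverse, so two steps lead
    back with probability at least e, the square of that weight. Even times can thus be increased at
    a bounded cost. *)
Lemma Lam2_ge : exists e : K, [/\ (0 < e)%R, (e <= 1)%R & forall n F,
  (forall x c, 0 <= F x c) ->
  forall x c, (e ^+ n)%:E * F x c <= iter (2 * n) Lam F x c].
Proof.
have [g g0] := wt_pos W.
pose e := (wt W g * wt W g)%R.
have e0 : (0 < e)%R by rewrite mulr_gt0.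
have L2 F : (forall x c, 0 <= F x c) -> forall x c, e%:E * F x c <= Lam (Lam F) x c.
  move=> F0 x c; have g'0 : (0 < wt W (ginv W g))%R by rewrite wt_ginv.
  apply: le_trans (Lam_ge _ _ (Lam_ge0 W F0) g'0).
  rewrite wt_ginv EFinM -muleA lee_wpmul2l ?lee_fin ?(ltW g0)//.
  apply: le_trans (Lam_ge _ _ F0 g0).
  by rewrite act_ginv.
exists e; split=> //.
  have := L2 (cst (cst 1)) (fun _ _ => lee01) point (cls point).
  rewrite /= mule1 -lee_fin => /le_trans; apply.
  by apply: Lam_le1; apply: Lam_le1.
elim=> [|n IHn] F F0 x c; first by rewrite expr0 mul1e.
rewrite exprS mulnS /= EFinM -muleA.
apply: le_trans (L2 _ (iter_Lam_ge0 W (2 * n) F0) x c).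
by rewrite lee_wpmul2l ?lee_fin ?(ltW e0)// IHn.
Qed.

(* A form of liminf_m p_(2m)^(1/m) <= s, with a uniform constant; this set is
   invariant under the walk within an S-class. *)
Definition lower_decay (s : K) : set X := [set x | exists M : nat, forall m0,
  exists2 m, (m0 <= m)%N & ret (2 * m) x <= (M%:R * s ^+ m)%:E].

Lemma measurable_lower_decay s : measurable (lower_decay s).
Proof.
rewrite (_ : lower_decay s = \bigcup_M \bigcap_m0 \bigcup_(m in [set m | (m0 <= m)%N])
    [set x | ret (2 * m) x <= (M%:R * s ^+ m)%:E]); last first.
  apply/seteqP; split=> x.
    by move=> [M hM]; exists M => // m0 _; have [m mm0 xm] := hM m0; exists m.
  by move=> [M _ hM]; exists M => m0; have [m mm0 xm] := hM m0 Logic.I; exists m.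
apply: bigcupT_measurable => M; apply: bigcapT_measurable => m0.
apply: bigcup_measurable => m _; rewrite -[X in measurable X]setTI.
exact: emeasurable_fun_infty_c (measurable_ret W _) _.
Qed.

(** A path of weight e and length 2k from x to a point y of the same class gives p_(2(m - k))(y) <=
    e^-1 p_(2m)(x). Hence y inherits the decay of x, with the constant multiplied by e^-1 s^k, and
    cannot lie outside the set. *)
Lemma lower_decay_invariant (s : K) k x : (0 < s)%R -> lower_decay s x ->
  iter (2 * k) Lam (diag (ind (~` lower_decay s))) x (cls x) = 0.
Proof.
move=> s0 [M hM]; apply: contrapT => /eqP /iter_Lam_neq0.
move=> /(_ (diag_ge0 W (@ind_ge0 _ _ _ _))) [y [e [yN0 e0 eH]]].
have [yx ny] : cls y = cls x /\ ~ lower_decay s y.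
  move: yN0; rewrite /diag_part; case: ifPn => [/eqP yx|]; last by rewrite eqxx.
  rewrite indE => yN0; split=> // ys; move: yN0.
  by rewrite memNset ?eqxx//; apply.
apply: ny.
exists (Num.bound (e^-1 * M%:R * s ^+ k)%R) => m0.
have [m m0m xm] := hM (m0 + k)%N.
have km : (k <= m)%N by rewrite (leq_trans _ m0m)// leq_addl.
exists (m - k)%N; first by rewrite leq_subRL// addnC.
have := eH (hit (2 * (m - k))) (hit_ge0 W _).
rewrite /hit_prob -iterD -mulnDr subnKC// -yx -/(ret _ _) => h.
have {h} := le_trans h (_ : _ <= (M%:R * s ^+ m)%:E).
rewrite {1}yx => /(_ xm); rewrite -lee_pdivlMl// -EFinM => h.
apply: (le_trans h); rewrite lee_fin -{1}(subnKC km) exprD !mulrA.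
rewrite ler_pM2r ?exprn_gt0// ltW//; apply: archi_boundP.
by rewrite !mulr_ge0// ?invr_ge0 ?exprn_ge0// ltW.
Qed.

(** A time m at which p_(2m) is small is rounded down to a multiple n k of k. By [Lam2_ge] the fewer
    than k missing double steps cost at most a factor e^-k. *)
Lemma lower_decay_ret (s s' : K) k x : (0 < s)%R -> (s < s')%R -> (s' <= 1)%R ->
  (0 < k)%N -> lower_decay s x ->
  exists n, (0 < n)%N /\ ret (n * (2 * k)) x <= ((s' ^+ k) ^+ n)%:E.
Proof.
move=> s0 ss' s'1 k0 [M hM].
have s'0 : (0 < s')%R by exact: lt_trans ss'.
have s1 : (s <= 1)%R by rewrite (le_trans (ltW ss')).
have [e [e0 e1 eF]] := Lam2_ge.
(* For n k >= m0 the slack (s / s')^(n k) absorbs both the factor e^-k and the constant M. *)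
have [|m0 hm0] := @expr_eventually_small _ (e ^- k * M%:R) (s / s').
  by rewrite divr_ge0 ?(ltW s0) ?(ltW s'0)//= ltr_pdivrMr// mul1r.
have [m m0m xm] := hM (m0 + k)%N.
pose n := (m %/ k)%N; exists n.
have km : (k <= m)%N by rewrite (leq_trans _ m0m)// leq_addl.
split; first by rewrite divn_gt0.
have mE : m = (m %% k + n * k)%N by rewrite addnC /n -divn_eq.
have m0n : (m0 <= n * k)%N.
  rewrite -(leq_add2r k) (leq_trans m0m)// {1}mE addnC leq_add2l.
  by rewrite ltnW// ltn_mod.
have := eF (m %% k)%N (hit (2 * (n * k))) (hit_ge0 W _) x (cls x).
rewrite /hit_prob -iterD -mulnDr -mE -!/(hit _ _ _) => /le_trans /(_ xm).
rewrite -lee_pdivlMl ?exprn_gt0// -EFinM mulnCA => h.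
apply: (le_trans h); rewrite lee_fin.
have sE : ((s' ^+ k) ^+ n = s' ^+ (n * k))%R by rewrite -exprM mulnC.
rewrite sE.
have hk := hm0 _ m0n; rewrite expr_div_n mulrA ler_pdivrMr ?exprn_gt0// mul1r in hk.
apply: le_trans hk; rewrite -mulrA; apply: ler_pM.
- by rewrite invr_ge0 exprn_ge0 ?ltW.
- by apply: mulr_ge0 => //; apply: exprn_ge0; exact: ltW.
- by rewrite lef_pV2 ?posrE ?exprn_gt0// ler_wiXn2l ?(ltW e0)// ltnW// ltn_mod.
- by rewrite ler_wpM2l// ler_wiXn2l ?(ltW s0)// [leqRHS]mE leq_addl.
Qed.

(** A walk started in the set and back in its class at time 2k ends in the set again, so the full
    diagonal may be replaced by its restriction to the set. [return_le] in blocks of 2k steps then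
    applies. *)
Lemma lower_decay_integral (s s' : K) k : (0 < s)%R -> (s < s')%R -> (s' <= 1)%R ->
  (0 < k)%N -> \int[mu]_x (ret (2 * k) x * ind (lower_decay s) x) <= (s' ^+ k)%:E.
Proof.
move=> s0 ss' s'1 k0; have s'0 : (0 < s')%R by exact: lt_trans ss'.
have mA := measurable_lower_decay s.
apply: (@le_trans _ _ ((s' ^+ k)%:E * mu (lower_decay s))); last first.
  by rewrite -[leRHS]mule1 lee_wpmul2l ?lee_fin ?exprn_ge0 ?(ltW s'0)// probability_le1.
rewrite (_ : \int[mu]_x _ =
    ip (iter (2 * k) Lam (diag (ind (lower_decay s)))) (diag (ind (lower_decay s)))).
  apply: return_le => //; [exact: exprn_gt0|exact: exprn_ile1 (ltW _) _|].
  by move=> x xA; exact: lower_decay_ret s0 ss' s'1 k0 xA.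
rewrite ip_diag; last exact: ind_ge0.
  2: by apply: adm_iter; apply: adm_diag; [exact: measurable_ind|exact: ind_ge0].
apply: eq_integral => x _.
have [xA|xA] := pselect (lower_decay s x); last by rewrite !indE !memNset// !mule0.
congr (_ * _); rewrite /class_return /hit_prob.
rewrite (_ : diag (cst 1) = fun x c => diag (ind (lower_decay s)) x c +
    diag (ind (~` lower_decay s)) x c); last first.
  apply/funext => y; apply/funext => c; rewrite /diag_part; case: ifP => _; last by rewrite adde0.
  by rewrite !indE in_setC; case: (_ \in _); rewrite /= ?adde0 ?add0e.
rewrite iter_LamD; first by rewrite lower_decay_invariant// adde0.
  by apply: diag_ge0 => z; exact: ind_ge0.
by apply: diag_ge0 => z; exact: ind_ge0.
Qed.

(** Markov's inequality bounds the measure of the set where f_k > t^k by (q / t)^k, which is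
    summable, and Borel-Cantelli concludes. *)
Lemma ae_geometric_decay (f : nat -> X -> \bar K) (q t : K) :
  (0 <= q)%R -> (q < t)%R ->
  (forall k, measurable_fun [set: X] (f k)) -> (forall k x, 0 <= f k x) ->
  (forall k, (0 < k)%N -> \int[mu]_x f k x <= (q ^+ k)%:E) ->
  \forall x \ae mu, exists j, forall i, (j <= i)%N -> f i x <= (t ^+ i)%:E.
Proof.
move=> q0 qt mf f0 fq; have t0 : (0 < t)%R by exact: le_lt_trans qt.
(* The shift by one is there because the integral bound is assumed for k > 0 only. *)
pose E k := [set x | (t ^+ k.+1)%:E < f k.+1 x].
have mE k : measurable (E k).
  by rewrite -[X in measurable X]setTI; exact: emeasurable_fun_o_infty.
have muE k : mu (E k) <= ((q / t) ^+ k.+1)%:E.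
  rewrite expr_div_n EFinM muleC lee_pdivlMl ?exprn_gt0//.
  apply: le_trans (fq k.+1 isT).
  have -> : mu (E k) = \int[mu]_x ind (E k) x.
    by rewrite /ereal_indic integral_indic// setIT.
  rewrite -ge0_integralZl_EFin ?exprn_ge0 ?(ltW t0)//; last 2 first.
  - by move=> x _; exact: ind_ge0.
  - exact: measurable_ind.
  apply: ge0_le_integral => //.
  - by move=> x _; rewrite mule_ge0 ?lee_fin ?exprn_ge0 ?(ltW t0).
  - by apply: emeasurable_funM => //; exact: measurable_ind.
  - move=> x _; rewrite !indE.
    case: (boolP (x \in E k)) => [|_]; last by rewrite mule0.
    by rewrite inE => /ltW xt; rewrite mule1.
have [N [mN N0 NE]] : mu.-negligible (lim_sup_set E).
  exists (lim_sup_set E); split=> //.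
    by apply: bigcapT_measurable => n; apply: bigcup_measurable.
  apply: lim_sup_set_cvg0 => //.
  have q01 : (0 <= q / t < 1)%R.
    by rewrite divr_ge0 ?(ltW t0)//= ltr_pdivrMr// mul1r.
  apply: (@le_lt_trans _ _ (\sum_(n <oo) (geometric (q / t) (q / t) n)%:E)).
    by apply: lee_nneseries => // n _; rewrite /geometric /= -exprS.
  have gc1 := @cvg_geometric_series _ (q / t)%R (q / t)%R.
  rewrite ger0_norm in gc1; last by case/andP: q01.
  have {}gc := gc1 (andP q01).2.
  rewrite (_ : \sum_(n <oo) _ = ((q / t) * (1 - q / t)^-1)%:E) ?ltry//.
  apply/cvg_lim => //.
  rewrite (_ : (fun n => _) = EFin \o series (geometric (q / t) (q / t))%R).
    exact: cvg_comp gc _.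
  by apply/funext => n; rewrite /= /series /= sumEFin.
exists N; split=> // x /= nx; apply: NE => n _.
apply: contrapT => xE; apply: nx; exists n.+1 => -[//|i] ni.
by rewrite leNgt; apply/negP => ti; apply: xE; exists i.
Qed.

(** Rate s along some times forces, on average over the set, an intermediate rate s' at all times,
    and then rate t at almost every point. *)
Lemma lower_decay_decay (s t : K) : (0 < s)%R -> (s < t)%R -> (t <= 1)%R ->
  \forall x \ae mu, lower_decay s x ->
    exists j, forall i, (j <= i)%N -> ret (2 * i) x <= (t ^+ i)%:E.
Proof.
move=> s0 st t1.
pose s' := ((s + t) / 2)%R.
have [ss' s't] : (s < s')%R /\ (s' < t)%R by rewrite /s'; split; lra.
have s'1 : (s' <= 1)%R by rewrite (le_trans (ltW s't)).
have s'0 : (0 <= s')%R by rewrite ltW// (lt_trans s0).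
apply: filterS (@ae_geometric_decay
  (fun k x => ret (2 * k) x * ind (lower_decay s) x) s' t s'0 s't _ _ _).
- move=> x [j xj] xs; exists j => i ji; have := xj i ji.
  by rewrite indE mem_set// mule1.
- move=> k; apply: emeasurable_funM; first exact: measurable_ret.
  by apply: measurable_ind; exact: measurable_lower_decay.
- by move=> k x; rewrite mule_ge0 ?hit_ge0 ?ind_ge0.
- by move=> k k0; exact: lower_decay_integral.
Qed.

End decay.

(* Convergence fails only if some rational interval is crossed infinitely
   often; on the return probabilities this is excluded by [lower_decay_decay]. *)
Lemma bounded_oscillation_cvg (K : realType) (u : nat -> K) :
  (forall n, 0 <= u n <= 1)%R ->
  (forall p q : rat, (0 < ratr p :> K)%R -> (ratr p < ratr q :> K)%R ->
    (ratr q <= 1 :> K)%R ->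
    (forall m, exists2 n, (m <= n)%N & u n <= ratr p)%R ->
    exists m, forall n, (m <= n)%N -> (u n <= ratr q)%R) ->
  exists2 l : K, (0 <= l <= 1)%R & u @ \oo --> l.
Proof.
move=> u01 hu.
pose E := [set q : K | (0 <= q)%R /\ exists m, forall n, (m <= n)%N -> (u n <= q)%R].
have E1 : E 1%R by split=> //; exists 0%N => n _; case/andP: (u01 n).
have hE : has_inf E by split; [exists 1%R|exists 0%R => q []].
(* The limit superior of u, as the infimum of its eventual upper bounds. *)
pose l := inf E.
have l0 : (0 <= l)%R by apply: lb_le_inf; [exists 1%R|move=> q []].
have l1 : (l <= 1)%R by apply: ge_inf => //; case: hE.
exists l; first by rewrite l0.
apply/cvgrPdist_le => e e0.
have [q [q0 [m hm]] ql] : exists2 q, E q & (q < l + e)%R.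
  by apply: inf_adherent => //; case: hE.
have lowu : exists m', forall n, (m' <= n)%N -> (l - e < u n)%R.
  apply: contrapT => nm.
  have io m' : exists2 n, (m' <= n)%N & (u n <= l - e)%R.
    apply: contrapT => nn; apply: nm; exists m' => n mn.
    by rewrite ltNge; apply/negP => un; apply: nn; exists n.
  have [n _ un] := io 0%N.
  have le0 : (0 <= l - e)%R by apply: le_trans un; case/andP: (u01 n).
  (* Two rationals below l: if u is infinitely often below the smaller one, it is eventually below
     the larger one, which contradicts the choice of l. *)
  have [p pI] : exists p : rat, ratr p \in `](l - e)%R, (l - e / 2)%R[.
    by apply: rat_in_itvoo; lra.
  have [q' qI] : exists q' : rat, ratr q' \in `](l - e / 2)%R, l[.
    by apply: rat_in_itvoo; lra.
  move: pI qI; rewrite !in_itv /= => /andP[p1 p2] /andP[q1 q2].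
  have [||||m' hm'] := hu p q'.
  - by lra.
  - by lra.
  - by lra.
  - by move=> m'; have [k mk uk] := io m'; exists k => //; lra.
  have : E (ratr q') by split; [lra|exists m'].
  by move=> /(ge_inf (proj2 hE)); rewrite leNgt q2.
have [m' hm'] := lowu.
exists (maxn m m') => // n /=; rewrite geq_max => /andP[mn m'n].
have := hm _ mn; have := hm' _ m'n; rewrite ler_norml => h1 h2.
by apply/andP; split; lra.
Qed.

(** * Almost everywhere existence of the limit of the roots *)

Section root_limit.
Context (K : realType) d (X : measurableType d) (mu : probability X K).
Context (G C : choiceType) (W : coset_walk mu G C).
Local Notation ret := (class_return W).

Lemma powR_inv_le (r s : K) n : (0 <= r)%R -> (0 <= s)%R -> (0 < n)%N ->
  (r `^ (n%:R^-1) <= s)%R = (r <= s ^+ n)%R.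
Proof.
move=> r0 s0 n0; have nN0 : n%:R != 0%R :> K by rewrite pnatr_eq0 -lt0n.
apply/idP/idP => h.
  rewrite -[r]powRr1// -(mulVf nN0) powRrM powR_mulrn ?powR_ge0//.
  by rewrite lerXn2r// nnegrE ?powR_ge0.
have -> : (s = (s ^+ n) `^ n%:R^-1)%R.
  by rewrite -powR_mulrn// -powRrM mulfV// powRr1.
by apply: ge0_ler_powR; rewrite ?invr_ge0 ?nnegrE ?exprn_ge0 ?ler0n.
Qed.

Lemma ae_root_cvg : \forall x \ae mu, exists2 l : K, (0 <= l <= 1)%R &
  (fun k => ret (2 * k) x `^ (2 * k)%:R^-1) @ \oo --> l%:E.
Proof.
(* The rates are squared because [lower_decay] counts pairs of steps while the root is taken per
   step. *)
pose P (p q : rat) (x : X) := (0 < ratr p :> K)%R -> (ratr p < ratr q :> K)%R ->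
    (ratr q <= 1 :> K)%R -> lower_decay W (ratr p ^+ 2)%R x ->
    exists j, forall i, (j <= i)%N -> ret (2 * i) x <= ((ratr q ^+ 2) ^+ i)%:E.
have aeP p q : \forall x \ae mu, P p q x.
  have [p0|p0] := boolP (0 < ratr p :> K)%R; last first.
    by apply: aeW => x p0'; rewrite p0' in p0.
  have [pq|pq] := boolP (ratr p < ratr q :> K)%R; last first.
    by apply: aeW => x _ pq'; rewrite pq' in pq.
  have [q1|q1] := boolP (ratr q <= 1 :> K)%R; last first.
    by apply: aeW => x _ _ q1'; rewrite q1' in q1.
  have q0 : (0 < ratr q :> K)%R by exact: lt_trans pq.
  have p20 : (0 < ratr p ^+ 2 :> K)%R by exact: exprn_gt0.
  have pq2 : (ratr p ^+ 2 < ratr q ^+ 2 :> K)%R by rewrite ltrXn2r// ltW.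
  have q21 : (ratr q ^+ 2 <= 1 :> K)%R by apply: exprn_ile1 => //; exact: ltW.
  by apply: filterS (lower_decay_decay W p20 pq2 q21) => x hx _ _ _.
(* Pairs of rationals are enumerated through their codes, with a trivial condition at numbers that
   code nothing. *)
have : \forall x \ae mu, forall m n : nat,
    oapp (fun p => oapp (fun q => P p q x) True (@choice.unpickle rat n))
      True (@choice.unpickle rat m).
  apply: ae_foralln => m; apply: ae_foralln => n.
  case: (@choice.unpickle rat m) => [p|] /=; last exact: aeW.
  by case: (@choice.unpickle rat n) => [q|] /=; [exact: aeP|exact: aeW].
apply: filterS => x hx.
have {}hx p q : P p q x by have := hx (choice.pickle p) (choice.pickle q); rewrite !choice.pickleK.
pose r k : K := fine (ret (2 * k) x).
have rE k : ret (2 * k) x = (r k)%:E by rewrite fineK ?ret_fin_num.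
have r01 k : (0 <= r k <= 1)%R by rewrite -!lee_fin -rE hit_ge0 hit_le1.
have r0 k : (0 <= r k)%R by case/andP: (r01 k).
pose v k := (r k `^ (2 * k)%:R^-1)%R.
suff [l l01 vl] : exists2 l : K, (0 <= l <= 1)%R & v @ \oo --> l.
  exists l => //; rewrite (_ : (fun k => _) = EFin \o v); first exact: cvg_comp vl _.
  by apply/funext => k; rewrite rE poweR_EFin.
apply: bounded_oscillation_cvg => [k|p q p0 pq q1 io].
  rewrite powR_ge0 /=; case: k => [|k].
    (* At k = 0 the exponent is the inverse of 0, which is 0 by convention, so the root is 1. *)
    by rewrite /v muln0 invr0 powRr0.
  by rewrite powR_inv_le// expr1n; case/andP: (r01 k.+1).
have [||||j hj] := hx p q => //.
  exists 1%N => m0; have [m m0m vm] := io (maxn m0 1).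
  move: m0m; rewrite geq_max => /andP[m0m m1]; exists m => //.
  by rewrite rE lee_fin mul1r -exprM -powR_inv_le// ?ltW// muln_gt0.
exists (maxn j 1) => i; rewrite geq_max => /andP[ji i1].
rewrite /v powR_inv_le// ?muln_gt0//; last by rewrite ltW// (lt_trans p0).
by rewrite exprM -lee_fin -rE hj.
Qed.

End root_limit.

(** * Almost invariant functions exclude fast return *)

Section dominated_walk.
Context (K : realType) d (X : measurableType d) (mu : probability X K).
Context (G C : choiceType) (W : coset_walk mu G C).
Implicit Types (F H : X -> C -> \bar K) (f h : X -> \bar K) (A B : set X).
Local Notation Lam := (markov_op W).
Local Notation adm := (adm W).
Local Notation ip := (pairing W).
Local Notation cls := (cls W).
Local Notation orb := (orb W).
Local Notation diag := (diag_part W).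
Local Notation ind := (@ereal_indic K X).
Local Notation hit := (hit_prob W).
Local Notation ret := (class_return W).

(** The free constant [M] makes the property stable under sums, multiples and domination;
    [decays_le_rate] removes it at the end. *)
Definition decays (s : K) F H := exists2 M : K, (0 <= M)%R &
  forall n, ip (iter n Lam F) H <= (M * s ^+ n)%:E.

Lemma decaysC s F H : adm F -> adm H -> decays s F H -> decays s H F.
Proof.
move=> aF aH [M M0 hM]; exists M => // n; apply: le_trans (hM n).
by rewrite ipC -[n]addn0 addnC -(ip_iter 0 n).
Qed.

Lemma decaysD s F F' H : adm F -> adm F' -> adm H ->
  decays s F H -> decays s F' H -> decays s (fun x c => F x c + F' x c) H.
Proof.
move=> aF aF' aH [M M0 hM] [M' M'0 hM']; exists (M + M')%R; first exact: addr_ge0.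
move=> n; rewrite iter_LamD; [|exact: aF.1|exact: aF'.1].
rewrite ipDl//; [|exact: adm_iter|exact: adm_iter].
by rewrite mulrDl EFinD leeD.
Qed.

Lemma decays_le s F F' H H' : adm F -> adm F' -> adm H -> adm H' ->
  (forall x c, F x c <= F' x c) -> (forall x c, H x c <= H' x c) ->
  decays s F' H' -> decays s F H.
Proof.
move=> aF aF' aH aH' FF' HH' [M M0 hM]; exists M => // n.
apply: le_trans (hM n); apply: le_ip => //; try exact: adm_iter.
exact: le_iter_Lam.
Qed.

Lemma decaysZ s (k : K) F H : (0 <= k)%R -> adm F -> adm H -> decays s F H ->
  decays s (fun x c => k%:E * F x c) H.
Proof.
move=> k0 aF aH [M M0 hM]; exists (k * M)%R; first exact: mulr_ge0.
move=> n; rewrite iter_LamZ//; last exact: aF.1.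
rewrite ipZl//; last exact: adm_iter.
by rewrite -mulrA EFinM lee_wpmul2l.
Qed.

Definition fast (s : K) j : set X :=
  [set x | forall i, (j <= i)%N -> ret (2 * i) x <= (s ^+ (2 * i))%:E].

Lemma measurable_fast s j : measurable (fast s j).
Proof.
rewrite (_ : fast s j = \bigcap_(i in [set i | (j <= i)%N])
    [set x | ret (2 * i) x <= (s ^+ (2 * i))%:E]); last first.
  by apply/seteqP; split=> x h i; exact: h.
apply: bigcap_measurableType => i _; rewrite -[X in measurable X]setTI.
exact: emeasurable_fun_infty_c (measurable_ret W _) _.
Qed.

Lemma adm_diag_ind A : measurable A -> adm (diag (ind A)).
Proof. by move=> mA; apply: adm_diag; [exact: measurable_ind|exact: ind_ge0]. Qed.

Lemma integral_le1 f : measurable_fun [set: X] f ->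
  (forall x, 0 <= f x <= 1) -> \int[mu]_x f x <= 1.
Proof.
move=> mf f01; have -> : 1 = \int[mu]_x (cst 1 x) :> \bar K.
  by rewrite integral_cst// mul1e; exact/esym/probability_setT.
by apply: ge0_le_integral => // x _; case/andP: (f01 x).
Qed.

(** At even times 2l the pairing is at most 1, and at most s^(2l) once l >= j; the factor s^-(2j)
    covers both cases. Odd times lie below the mean of the two neighbouring even ones, which costs
    one more factor s^-1. *)
Lemma fast_decays s j m i : (0 < s)%R -> (s <= 1)%R ->
  decays s (iter m Lam (diag (ind (fast s j)))) (iter i Lam (diag (ind (fast s j)))).
Proof.
move=> s0 s1; set D := diag _; pose A := fast s j.
have mA : measurable A by exact: measurable_fast.
have aD : adm D by exact: adm_diag_ind.
pose M := (s ^- (2 * j).+1)%R.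
have M0 : (0 <= M)%R by rewrite /M invr_ge0 exprn_ge0// ltW.
have even l : ip (iter (2 * l) Lam D) D <= (s ^- (2 * j) * s ^+ (2 * l))%:E.
  rewrite ip_diag; [|exact: adm_iter|exact: ind_ge0].
  have [lj|jl] := ltnP l j.
    apply: (@le_trans _ _ 1).
      apply: integral_le1.
        apply: emeasurable_funM; last exact: measurable_ind.
        exact: measurable_cls (adm_iter _ aD).
      move=> x; rewrite mule_ge0 ?ind_ge0 ?(adm_ge0 _ _ (adm_iter _ aD))//=.
      rewrite -[leRHS]mule1 lee_pmul ?ind_ge0 ?ind_le1 ?(adm_ge0 _ _ (adm_iter _ aD))//.
      by apply: iter_Lam_le1; apply: diag_le1 => y; exact: ind_le1.
    rewrite lee_fin mulrC ler_pdivlMr ?exprn_gt0// mul1r ler_wiXn2l ?(ltW s0)//.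
    by rewrite leq_mul2l ltnW.
  apply: (@le_trans _ _ (\int[mu]_x (cst (s ^+ (2 * l))%:E x))); last first.
    rewrite integral_cst// [X in _ * X](_ : _ = 1); last exact: probability_setT.
    rewrite mule1 lee_fin ler_peMl ?exprn_ge0 ?(ltW s0)//.
    by rewrite invf_ge1 ?exprn_gt0// exprn_ile1// ltW.
  apply: ge0_le_integral => //.
  - move=> x _; rewrite mule_ge0 ?ind_ge0 ?(adm_ge0 _ _ (adm_iter _ aD))//.
  - apply: emeasurable_funM; last exact: measurable_ind.
    exact: measurable_cls (adm_iter _ aD).
  - move=> x _; rewrite indE; case: (boolP (x \in _)) => [|_]; last first.
      by rewrite mule0 lee_fin exprn_ge0// ltW.
    rewrite inE mule1 => /(_ _ jl); apply: le_trans.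
    by apply: le_iter_Lam => y c; apply: le_diag => z; exact: ind_le1.
have rho n : ip (iter n Lam D) D <= (M * s ^+ n)%:E.
  have nE := odd_double_half n; set l := n./2 in nE.
  have Ms : (M * s = s ^- (2 * j))%R.
    by rewrite /M exprS invfM mulrAC mulVf ?mul1r// gt_eqF.
  case: (odd n) nE => /= nE; last first.
    rewrite -nE add0n -mul2n; apply: (le_trans (even l)); rewrite lee_fin.
    by rewrite ler_pM2r ?exprn_gt0// -Ms ler_piMr.
  rewrite -[in leRHS]nE -mul2n exprD expr1 mulrA Ms.
  have -> : n = (l.+1 + l)%N by rewrite -nE -addnn addSn.
  rewrite -ip_iter//.
  have := @ip_amgm _ _ _ _ _ _ W 1%R (iter l.+1 Lam D) (iter l Lam D) ler01.
  move=> /(_ (adm_iter _ aD) (adm_iter _ aD)).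
  rewrite expr1n mul1e !ip_iter// !addnn -!mul2n mulr1.
  move=> /le_trans /(_ (leeD (even _) (even _))).
  rewrite -EFinD -lee_pdivlMl// -EFinM => /le_trans; apply; rewrite lee_fin.
  have : (s ^+ (2 * l.+1) <= s ^+ (2 * l))%R.
    by rewrite ler_wiXn2l ?(ltW s0)// leq_mul2l ltnW.
  move=> /(ler_wpM2l (_ : 0 <= s ^- (2 * j))%R).
  by rewrite invr_ge0 exprn_ge0 ?(ltW s0)// => /(_ isT); lra.
exists M => // n; rewrite -iterD ip_iter//; apply: (le_trans (rho _)).
rewrite lee_fin ler_wpM2l// ler_wiXn2l ?(ltW s0)//.
by rewrite -addnA leq_addr.
Qed.

(* The functions bounded by multiples of [zeta (fast s j) n] exhaust those
   supported on cosets meeting some [fast s j]. *)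
Fixpoint zeta (A : set X) n : X -> C -> \bar K :=
  if n is m.+1 then fun x c => zeta A m x c + iter m Lam (diag (ind A)) x c
  else fun _ _ => 0.

Lemma adm_zeta A n : measurable A -> adm (zeta A n).
Proof.
move=> mA; elim: n => [|n IHn] /=.
  by split=> // g; exact: measurable_cst.
by apply: admD => //; apply: adm_iter; exact: adm_diag_ind.
Qed.

Lemma zeta_decays s j n : (0 < s)%R -> (s <= 1)%R ->
  decays s (zeta (fast s j) n) (zeta (fast s j) n).
Proof.
move=> s0 s1; have mA := measurable_fast s j.
have aD i : adm (iter i Lam (diag (ind (fast s j)))).
  by apply: adm_iter; exact: adm_diag_ind.
have dec0 H : adm H -> decays s (fun _ _ => 0) H.
  move=> aH; exists 0%R => // n'; rewrite mul0r.
  have -> : iter n' Lam (fun=> fun=> 0) = (fun _ _ => 0).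
    elim: n' => //= k ->; apply/funext => x; apply/funext => c.
    by apply: esum1 => g _; rewrite mule0.
  rewrite (_ : ip _ _ = 0)//; apply: integral0_eq => x _; apply: esum1 => c _.
  by rewrite mul0e.
have h1 i m : decays s (zeta (fast s j) m) (iter i Lam (diag (ind (fast s j)))).
  elim: m => [|m IHm] /=; first exact: dec0.
  by apply: decaysD => //; [exact: adm_zeta|exact: fast_decays].
suff h2 m : decays s (zeta (fast s j) n) (zeta (fast s j) m) by exact: h2.
elim: m => [|m IHm] /=.
  apply: decaysC; [by split=> // g; exact: measurable_cst|exact: adm_zeta|].
  by apply: dec0; exact: adm_zeta.
apply: decaysC; [|exact: adm_zeta|].
  by apply: admD => //; exact: adm_zeta.
by apply: decaysD => //; [exact: adm_zeta|exact: adm_zeta| |];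
  apply: decaysC => //; exact: adm_zeta.
Qed.

(** For r_n = <L^n F, F>, the arithmetic-geometric inequality with t = r_n and r_0 <= 1 gives r_n^2
    <= r_(2n), and [doubling_bound] drops the constant. *)
Lemma decays_le_rate s F : (0 < s)%R -> adm F -> ip F F <= 1 ->
  decays s F F -> ip (Lam F) F <= s%:E.
Proof.
move=> s0 aF F1 [M M0 hM].
have ip0 n : 0 <= ip (iter n Lam F) F by apply: ip_ge0 => //; exact: adm_iter.
pose r n := fine (ip (iter n Lam F) F).
have rE n : ip (iter n Lam F) F = (r n)%:E.
  by rewrite fineK// ge0_fin_numE// (le_lt_trans (hM n))// ltry.
have r0 n : (0 <= r n)%R by rewrite -lee_fin -rE.
rewrite (rE 1%N) lee_fin; apply: (@doubling_bound _ r M) => // n; last first.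
  by rewrite -lee_fin -rE.
have := @ip_amgm _ _ _ _ _ _ W (r n) (iter n Lam F) F (r0 n) (adm_iter n aF) aF.
rewrite ip_iter// addnn -mul2n !rE (rE 0%N) -!EFinM -EFinD lee_fin.
have : (r 0%N <= 1)%R by rewrite -lee_fin -rE.
have := r0 n; set a := r n; set e := r 0%N; set b := r _ => a0 e1 h.
have : (a ^+ 2 * e <= a ^+ 2)%R by rewrite ler_piMr// exprn_ge0.
move=> h2; rewrite expr2 in h h2 *; lra.
Qed.

(** The truncations min(F, j zeta_j) are dominated by functions that decay at rate s, and they
    increase to F because of the support condition. *)
Lemma fast_support_rate s F : (0 < s)%R -> (s <= 1)%R -> adm F ->
  (forall x c, 0 <= F x c <= 1) -> ip F F <= 1 ->
  (forall x c, F x c != 0 -> exists g j, c = cls (act W g x) /\ fast s j (act W g x)) ->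
  ip (Lam F) F <= s%:E.
Proof.
move=> s0 s1 aF F01 F1 Fsupp.
have F0 x c : 0 <= F x c by case/andP: (F01 x c).
pose V j x c : \bar K := j%:R%:E * zeta (fast s j) j x c.
have aV j : adm (V j).
  by apply: admZ => //; apply: adm_zeta; exact: measurable_fast.
pose F_ j x c := mine (F x c) (V j x c).
have aF_ j : adm (F_ j).
  split=> [x c|g]; first by rewrite le_min F0 (adm_ge0 _ _ (aV j)).
  by apply: measurable_mine; [exact: aF.2|exact: (aV j).2].
have leF j x c : F_ j x c <= F x c by rewrite ge_min lexx.
have leV j x c : F_ j x c <= V j x c by rewrite ge_min lexx orbT.
have fast_nd m n x : (m <= n)%N -> fast s m x -> fast s n x.
  by move=> mn h i ni; apply: h; exact: leq_trans ni.
have indnd m n : (m <= n)%N -> forall x, ind (fast s m) x <= ind (fast s n) x.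
  move=> mn x; rewrite !indE lee_fin ler_nat.
  case: (boolP (x \in fast s m)) => //; rewrite inE => /(fast_nd _ _ _ mn) h.
  by rewrite mem_set.
have zeta0 A n x c : measurable A -> 0 <= zeta A n x c.
  by move=> mA; exact: adm_ge0 (adm_zeta _ mA).
have zeta_mono A m n x c : (m <= n)%N -> zeta A m x c <= zeta A n x c.
  move=> /subnKC <-; elim: (n - m)%N => [|k IHk]; first by rewrite addn0.
  rewrite addnS /=; apply: (le_trans IHk); rewrite leeDl//.
  by apply: iter_Lam_ge0; apply: diag_ge0; exact: ind_ge0.
have zeta_nd m n x c : (m <= n)%N -> zeta (fast s m) m x c <= zeta (fast s n) n x c.
  move=> mn; apply: (@le_trans _ _ (zeta (fast s n) m x c)).
    suff h k : zeta (fast s m) k x c <= zeta (fast s n) k x c by exact: h.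
    elim: k => //= k IHk; apply: leeD => //.
    by apply: le_iter_Lam; apply: le_diag; exact: indnd.
  exact: zeta_mono.
have V_nd x c : nondecreasing_seq (fun j => V j x c).
  move=> m n mn; apply: lee_pmul; rewrite ?lee_fin ?ler_nat//.
    by apply: zeta0; exact: measurable_fast.
  exact: zeta_nd.
have F_nd x c : nondecreasing_seq (fun j => F_ j x c).
  move=> m n mn; rewrite le_min leF/=; apply: (le_trans (leV _ _ _)); exact: V_nd.
have F_cvg x c : (fun j => F_ j x c) @ \oo --> F x c.
  have [F0'|/Fsupp [g [j [cE gj]]]] := eqVneq (F x c) 0.
    rewrite F0' (_ : (fun j => _) = cst 0); first exact: cvg_cst.
    by apply/funext => j; apply/le_anti; rewrite -{1}F0' leF (adm_ge0 _ _ (aF_ j)).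
  have [m [e [e0 eF]]] := iter_Lam_act W g.
  apply: cvg_near_cst.
  (* Past j the point g x lies in [fast s n], past m the m-th iterate is a term of [zeta], and past
     e^-1 the product n e is at least 1, hence exceeds F. *)
  exists (maxn (maxn j m.+1) (Num.bound (e^-1)%R)) => // n /=.
  rewrite !geq_max -andbA => /and3P[jn mn en].
  rewrite /F_; apply/min_idPl.
  apply: (@le_trans _ _ 1); first by case/andP: (F01 x c).
  apply: (@le_trans _ _ (n%:R%:E * e%:E)).
    rewrite -EFinM lee_fin -ler_pdivrMr// mul1r (le_trans (ltW (archi_boundP _)))//.
      by rewrite invr_ge0 ltW.
    by rewrite ler_nat.
  rewrite lee_wpmul2l ?lee_fin//.
  apply: (@le_trans _ _ (iter m Lam (diag (ind (fast s n))) x c)).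
    have := eF (diag (ind (fast s n))) (diag_ge0 W (@ind_ge0 _ _ _ _)) x c.
    rewrite cE diag_cls indE mem_set ?mule1//.
    exact: fast_nd jn gj.
  apply: le_trans (zeta_mono _ _ _ _ _ mn).
  by rewrite /= leeDr//; apply: zeta0; exact: measurable_fast.
have := cvg_ip_iter (k := 1) aF_ F01 F_nd F_cvg; move=> /= /cvg_lim <- //.
apply: lime_le.
  apply: ereal_nondecreasing_is_cvgn => m n mn.
  apply: le_ip; [exact: adm_Lam|exact: adm_Lam|exact: aF_|exact: aF_| |].
    by apply: le_Lam => x c; exact: F_nd.
  by move=> x c; exact: F_nd.
apply: nearW => j; apply: decays_le_rate => //.
  by apply: le_trans F1; apply: le_ip.
have mA := measurable_fast s j; have aZ := adm_zeta j mA.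
apply: (decays_le (aF_ j) (aV j) (aF_ j) (aV j)) => //.
have dZ := zeta_decays j j s0 s1.
have dV : decays s (V j) (zeta (fast s j) j) by exact: decaysZ.
have dV' : decays s (zeta (fast s j) j) (V j) by exact: decaysC.
by apply: decaysZ.
Qed.

End dominated_walk.

(** * Correlations of almost invariant functions *)

Section almost_invariant.
Context (K : realType) d (X : measurableType d) (mu : probability X K).
Context (G C : choiceType) (W : coset_walk mu G C).
Implicit Types (F H : X -> C -> \bar K) (f h : X -> \bar K) (A B : set X).
Local Notation Lam := (markov_op W).
Local Notation adm := (adm W).
Local Notation ip := (pairing W).
Local Notation cls := (cls W).
Local Notation orb := (orb W).
Local Notation act := (act W).

Lemma ae_act g (P : X -> Prop) :
  (\forall x \ae mu, P x) -> \forall x \ae mu, P (act g x).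
Proof.
move=> [N [mN N0 PN]]; exists (act g @^-1` N); split.
- by have := act_measurable W g measurableT mN; rewrite setTI.
- by rewrite act_preserves.
- by move=> x; exact: PN.
Qed.

Lemma ae_le_integral (f h : X -> \bar K) :
  measurable_fun [set: X] f -> measurable_fun [set: X] h ->
  (forall x, 0 <= f x) -> (forall x, 0 <= h x) ->
  (\forall x \ae mu, f x <= h x) -> \int[mu]_x f x <= \int[mu]_x h x.
Proof.
move=> mf mh f0 h0 fh; apply: ae_ge0_le_integral => //.
by apply: filterS fh => x fhx _.
Qed.

Lemma integral_cst1 : \int[mu]_x (cst 1 x) = 1 :> \bar K.
Proof. by rewrite integral_cst// mul1e; exact: probability_setT. Qed.

Lemma esum_amgm (D : set C) (a b : C -> \bar K) :
  (forall c, 0 <= a c) -> (forall c, 0 <= b c) ->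
  2%:E * (\esum_(c in D) (a c * b c)) <=
  \esum_(c in D) (a c * a c) + \esum_(c in D) (b c * b c).
Proof.
move=> a0 b0; rewrite -esumZl//; last by move=> c _; rewrite mule_ge0.
rewrite -esumD; [|by move=> c _; rewrite mule_ge0|by move=> c _; rewrite mule_ge0].
apply: le_esum => c _.
by have := amgm ler01 (a0 c) (b0 c); rewrite expr1n mul1e mulr1.
Qed.

Lemma almost_invariant_no_fast_return (s : K) (F_ : nat -> X -> C -> \bar K) :
  (0 < s < 1)%R -> (\forall x \ae mu, exists j, fast W s j x) ->
  (forall n, adm (F_ n)) -> (forall n x c, 0 <= F_ n x c <= 1) ->
  (forall n, \forall x \ae mu, \esum_(c in orb x) (F_ n x c * F_ n x c) = 1) ->
  (forall g, \forall x \ae mu,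
    (fun n => \esum_(c in orb x) (F_ n (act g x) c * F_ n x c)) @ \oo --> (1 : \bar K)) ->
  False.
Proof.
move=> /andP[s0 s1] aefast aF F01 F1 Finv.
(* The points whose whole orbit returns fast; this set is conull and invariant. *)
pose X1 := \bigcap_n [set x | exists j, fast W s j (act (elt W n) x)].
have mX1 : measurable X1.
  apply: bigcapT_measurable => n.
  rewrite (_ : mkset _ = act (elt W n) @^-1` (\bigcup_j fast W s j)); last first.
    by apply/seteqP; split=> x [j]; [move=> xj; exists j|move=> _ xj; exists j].
  rewrite -[X in measurable X]setTI; apply: act_measurable => //.
  by apply: bigcupT_measurable => j; exact: measurable_fast.
have aeX1 : \forall x \ae mu, X1 x.
  have : \forall x \ae mu, forall n, exists j, fast W s j (act (elt W n) x).
    by apply: ae_foralln => n; exact: ae_act aefast.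
  by apply: filterS => x h n _; exact: h.
have X1E x : X1 x <-> forall g, exists j, fast W s j (act g x).
  split=> [h g|h n _]; last exact: h.
  by have [n ->] := elt_act W g; exact: h.
have X1g g x : X1 x -> X1 (act g x).
  rewrite !X1E => h k; have [l lE] := act_comp W k g.
  by have [j] := h l; rewrite lE; exists j.
have cls_act g x : orb x (cls (act g x)) by rewrite -(orb_act W g); exact: cls_orb.
(* Cutting down to [X1] and to the orbit makes the support condition of [fast_support_rate] hold at
   every (x, c). *)
pose F0 n x c := if `[< X1 x /\ orb x c >] then F_ n x c else 0.
have F0E n x c : X1 x -> orb x c -> F0 n x c = F_ n x c.
  by move=> xX xc; rewrite /F0 asboolT.
have F001 n x c : 0 <= F0 n x c <= 1.
  by rewrite /F0; case: ifP => // _; rewrite lexx lee01.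
have aF0 n : adm (F0 n).
  split=> [x c|g]; first by case/andP: (F001 n x c).
  rewrite (_ : (fun x => _) = fun x => ereal_indic K X1 x * F_ n x (cls (act g x))).
    by apply: emeasurable_funM; [exact: measurable_ind|exact: (aF n).2].
  apply/funext => x; rewrite indE /F0; case: asboolP => [[xX _]|nx].
    by rewrite mem_set// mul1e.
  by rewrite memNset ?mul0e// => xX; apply: nx.
have S0E n g x : X1 x -> \esum_(c in orb x) (F0 n (act g x) c * F0 n x c) =
    \esum_(c in orb x) (F_ n (act g x) c * F_ n x c).
  move=> xX; apply: eq_esum => c xc.
  by rewrite !F0E// ?orb_act//; exact: X1g.
have S0E1 n x : X1 x -> \esum_(c in orb x) (F0 n x c * F0 n x c) =
    \esum_(c in orb x) (F_ n x c * F_ n x c).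
  by move=> xX; apply: eq_esum => c xc; rewrite !F0E.
pose c_ n g := ip (fun x => F0 n (act g x)) (F0 n).
have aF0g n g : adm (fun x => F0 n (act g x)) by exact: adm_act.
have aS n g : adm (fun x c => F0 n (act g x) c * F0 n x c) by exact: admM.
have aS1 n : adm (fun x c => F0 n x c * F0 n x c) by exact: admM.
have ipF0 n : ip (F0 n) (F0 n) <= 1.
  rewrite -integral_cst1; apply: ae_le_integral => //.
  - exact: (measurable_fsum (aS1 n)).
  - by move=> x; exact: (fsum_ge0 _ (aS1 n)).
  - by apply: filterS2 aeX1 (F1 n) => x xX h; rewrite S0E1// h.
have rate n : ip (Lam (F0 n)) (F0 n) <= s%:E.
  apply: fast_support_rate => //; first exact: ltW.
  move=> x c; rewrite /F0; case: asboolP; last by rewrite eqxx.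
  move=> [xX xc] _; move: xc; rewrite orb_elt => -[m _ <-].
  by have [j xj] := xX m Logic.I; exists (elt W m), j.
have c_cvg g : (c_ ^~ g) @ \oo --> (1 : \bar K).
  rewrite -integral_cst1.
  have [|||||_ _] := @dominated_convergence _ X K mu setT measurableT
    (fun n x => \esum_(c in orb x) (F0 n (act g x) c * F0 n x c)) (cst 1) (cst 1).
  - by move=> n; exact: (measurable_fsum (aS n g)).
  - exact: measurable_cst.
  - apply: filterS2 aeX1 (Finv g) => x xX h _.
    by under eq_fun do rewrite S0E//.
  - exact: finite_measure_integrable_cst.
  (* The fibres at x and at g x are unit vectors, so their correlation is at most 1; this is the
     dominating constant. *)
  - have h : \forall x \ae mu, forall n,
        \esum_(c in orb x) (F0 n (act g x) c * F0 n x c) <= 1.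
      apply: ae_foralln => n.
      apply: filterS3 aeX1 (F1 n) (ae_act g (F1 n)) => x xX h1 h2.
      have := @esum_amgm (orb x) (F_ n (act g x)) (F_ n x).
      have F0' y c : 0 <= F_ n y c by case/andP: (F01 n y c).
      move=> /(_ (F0' _) (F0' _)); rewrite S0E// h1 -[in X in X + _](orb_act W g) h2.
      by rewrite -EFinD -lee_pdivlMl// -EFinM (_ : 2^-1 * (1 + 1) = 1)%R; last lra.
    apply: filterS h => x h n _; rewrite gee0_abs//.
    exact: (fsum_ge0 _ (aS n g)).
  - by [].
(* Finitely many weights already sum to more than s. Their part of <L F, F> is at most s for every n
   and tends to that sum, a contradiction. *)
have [_ [J [finJ JD] <-]] : exists2 y, [set \sum_(i \in A) (wt W i)%:E |
    A in fsets [set g | wt W g != 0%R]] y & s%:E < y.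
  by apply: ereal_sup_gt; rewrite -/(esum _ _) wt_sum lte_fin.
apply/negP; rewrite -leNgt.
have sumJ n : \sum_(g \in J) (wt W g)%:E * c_ n g <= s%:E.
  apply: le_trans (rate n); rewrite ip_LamE//.
  by apply: ereal_sup_ubound; exists J.
have cJ : (fun n => \sum_(g \in J) (wt W g)%:E * c_ n g) @ \oo -->
    \sum_(g \in J) (wt W g)%:E.
  rewrite fsbig_finite//= (_ : (fun n => _) =
      fun n => \sum_(g <- fset_set J) (wt W g)%:E * c_ n g); last first.
    by apply/funext => n; rewrite fsbig_finite.
  apply: cvg_nnesum => g _.
    by apply: nearW => n; rewrite mule_ge0 ?lee_fin ?wt_ge0// ip_ge0.
  by rewrite -[X in _ --> X]mule1; apply: cvgeZl.
rewrite -(cvg_lim _ cJ)//; apply: lime_le; first by apply/cvg_ex; eexists; exact: cJ.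
exact: nearW.
Qed.

End almost_invariant.

(** * Almost invariant vectors from slow return *)

Section moments.
Context (K : realType) d (X : measurableType d) (mu : probability X K).
Context (G C : choiceType) (W : coset_walk mu G C).
Implicit Types (F H : X -> C -> \bar K) (f h : X -> \bar K) (A B : set X).
Local Notation Lam := (markov_op W).
Local Notation adm := (adm W).
Local Notation ip := (pairing W).
Local Notation cls := (cls W).
Local Notation orb := (orb W).
Local Notation act := (act W).
Local Notation hit := (hit_prob W).
Local Notation ret := (class_return W).
Local Notation tot := (tot W).

(** The k-th moment of lambda(nu) at the unit vector 1_diag. *)
Definition return_moment k : K := fine (\int[mu]_x ret k x).

Lemma betaE k : \int[mu]_x ret k x = (return_moment k)%:E.
Proof.
rewrite fineK// fin_num01//; first by apply: integral_ge0 => x _; exact: hit_ge0.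
by apply: integral_le1 => [|x]; [exact: measurable_ret|rewrite hit_ge0 hit_le1].
Qed.

Lemma beta_ge0 k : (0 <= return_moment k)%R.
Proof. by rewrite -lee_fin -betaE; apply: integral_ge0 => x _; exact: hit_ge0. Qed.

Lemma ip_hit k l : ip (hit k) (hit l) = (return_moment (k + l))%:E.
Proof.
have a1 : adm (diag_part W (cst 1)) by exact: (adm_hit W 0).
rewrite /hit_prob ip_iter// ip_diag//; last exact: adm_iter.
by rewrite -betaE; apply: eq_integral => x _; rewrite mule1.
Qed.

(** Translations preserve the pairing, so each term of the average obeys [ip_amgm] with t = 1. This
    is the contraction property of lambda(nu). *)
Lemma ip_Lam_amgm F H : adm F -> adm H ->
  2%:E * ip (Lam F) H <= ip F F + ip H H.
Proof.
move=> aF aH; have aFg g : adm (fun x => F (act g x)) by exact: adm_act.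
rewrite ip_LamE// -esumZl//; last first.
  by move=> g _; rewrite mule_ge0 ?lee_fin ?wt_ge0// ip_ge0.
rewrite -[leRHS]mule1 -(wt_sum W) -ge0_esumZl; first last.
- by move=> g _; rewrite lee_fin wt_ge0.
- by rewrite adde_ge0// ip_ge0.
apply: le_esum => g _; rewrite muleCA [leRHS]muleC lee_wpmul2l ?lee_fin ?wt_ge0//.
have := ip_amgm ler01 (aFg g) aH.
by rewrite expr1n mul1e mulr1 ip_act.
Qed.

Lemma beta_step k : (return_moment (2 * k.+1) <= return_moment (2 * k))%R.
Proof.
have := ip_Lam_amgm (adm_hit W k) (adm_hit W k.+1).
rewrite -[Lam (hit k)]/(hit k.+1) !ip_hit !addnn -!mul2n -EFinM -EFinD lee_fin.
lra.
Qed.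

(** The integral of (u - w - t v)^2 >= 0 with its negative terms moved to the left. The bounds by 1
    make all pointwise values finite. *)
Lemma ip_square3 (t : K) (u v w : X -> C -> \bar K) : (0 <= t)%R ->
  adm u -> adm v -> adm w -> (forall x c, u x c <= 1) ->
  (forall x c, v x c <= 1) -> (forall x c, w x c <= 1) ->
  (2 * t)%:E * ip u v + 2%:E * ip u w <=
  ip u u + ip w w + (t ^+ 2)%:E * ip v v + (2 * t)%:E * ip w v.
Proof.
move=> t0 au av aw u1 v1 w1.
have t20 : (0 <= t ^+ 2)%R by exact: exprn_ge0.
have tt0 : (0 <= 2 * t)%R by rewrite mulr_ge0.
have a1 := admM au au; have a2 := admM aw aw; have a3 := admZ t20 (admM av av).
have a4 := admZ tt0 (admM aw av); have a5 := admZ tt0 (admM au av).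
have a6 := admZ (ler0n K 2) (admM au aw).
rewrite /pairing -(totZ t20 (admM av av)) -(totZ tt0 (admM aw av)).
rewrite -(totZ tt0 (admM au av)) -(totZ (ler0n K 2) (admM au aw)).
rewrite -(totD a5 a6) -(totD a1 a2) -(totD (admD a1 a2) a3).
rewrite -(totD (admD (admD a1 a2) a3) a4).
apply: le_tot => [||x c]; [exact: admD|exact: admD (admD (admD a1 a2) a3) a4|].
have [u0 v0 w0] : [/\ u x c \is a fin_num, v x c \is a fin_num & w x c \is a fin_num].
  by split; rewrite fin_num01 ?(adm_ge0 _ _ au) ?(adm_ge0 _ _ av) ?(adm_ge0 _ _ aw).
rewrite -(fineK u0) -(fineK v0) -(fineK w0) -!EFinM -!EFinD lee_fin -subr_ge0.
set a := fine _; set b := fine (v _ _); set e := fine (w _ _).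
by rewrite [leRHS](_ : _ = (a - e - t * b) ^+ 2)%R ?sqr_ge0//; ring.
Qed.

(** In spectral terms, x^(2k) (1 - x^2 - t x)^2 has a nonnegative integral. It controls the drop
    between consecutive odd moments by the drops between even ones. *)
Lemma beta_odd_step (t : K) k : (0 <= t)%R ->
  (2 * t * return_moment (2 * k).+1 + 2 * return_moment (2 * k).+2 <=
   return_moment (2 * k) + return_moment (2 * k).+4 + t ^+ 2 * return_moment (2 * k).+2
   + 2 * t * return_moment (2 * k).+3)%R.
Proof.
move=> t0; have h n := adm_hit W n; have h1 n := @hit_le1 _ _ _ _ _ _ W n.
have := ip_square3 t0 (h k) (h k.+1) (h k.+2) (h1 k) (h1 k.+1) (h1 k.+2).
rewrite !ip_hit -!EFinM -!EFinD lee_fin.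
by rewrite !addSn !addnS addnn -mul2n.
Qed.

Lemma beta_gt0 k : (0 < return_moment (2 * k))%R.
Proof.
have [e [e0 e1 eF]] := Lam2_ge W.
apply: (@lt_le_trans _ _ (e ^+ k)%R); first exact: exprn_gt0.
rewrite -lee_fin -betaE -[leLHS]mule1 -(integral_cst1 mu).
rewrite -ge0_integralZl_EFin ?exprn_ge0 ?(ltW e0)//.
apply: ge0_le_integral => //.
- by move=> x _; rewrite mule_ge0// lee_fin exprn_ge0// ltW.
- exact: measurable_ret.
- move=> x _; have := eF k (diag_part W (cst 1)) (diag_ge0 W (fun _ => lee01)) x (cls x).
  by rewrite diag_cls.
Qed.

(** Otherwise the even moments decay like (1 - e)^k, and Borel-Cantelli makes almost every point
    return fast. *)
Lemma beta_ratio (e : K) : (0 < e < 1)%R ->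
  (forall s, (0 < s < 1)%R -> ~ \forall x \ae mu, exists j, fast W s j x) ->
  exists k, ((1 - e) * return_moment (2 * k) <= return_moment (2 * k.+1))%R.
Proof.
move=> /andP[e0 e1] nofast; apply: contrapT => nk.
have step k : (return_moment (2 * k.+1) < (1 - e) * return_moment (2 * k))%R.
  by rewrite ltNge; apply/negP => h; apply: nk; exists k.
pose q := (1 - e)%R; have [q0 q1] : (0 < q)%R /\ (q < 1)%R by rewrite /q; split; lra.
have b k : (return_moment (2 * k) <= q ^+ k)%R.
  elim: k => [|k IHk].
    rewrite expr0 -lee_fin -betaE; apply: integral_le1 => [|x].
      exact: measurable_ret.
    by rewrite hit_ge0 hit_le1.
  by apply: (le_trans (ltW (step k))); rewrite exprS ler_pM2l.
pose t := ((1 + q) / 2)%R.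
have [t0 qt t1] : [/\ 0 < t, q < t & t < 1]%R by rewrite /t; split; lra.
(* The square root converts a rate per two steps into a rate per step. *)
apply: (nofast (Num.sqrt t)).
  by rewrite sqrtr_gt0 t0 -sqrtr1 ltr_sqrt.
apply: filterS (@ae_geometric_decay _ _ _ mu (fun k => ret (2 * k)) q t (ltW q0) qt _ _ _).
- move=> x [j hj]; exists j => i ji; rewrite exprM sqr_sqrtr; [exact: hj|exact: ltW].
- by move=> k; exact: measurable_ret.
- by move=> k x; exact: hit_ge0.
- by move=> k _; rewrite betaE lee_fin.
Qed.

End moments.

Definition efun (K : realType) (T U : Type) (H : T -> U -> K) : T -> U -> \bar K :=
  fun x c => (H x c)%:E.

(** * The normalized test vectors u_k + u_(k+1) *)

Section test_vectors.
Context (K : realType) d (X : measurableType d) (mu : probability X K).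
Context (G C : choiceType) (W : coset_walk mu G C).
Implicit Types (F : X -> C -> \bar K) (H : X -> C -> K).
Local Notation Lam := (markov_op W).
Local Notation adm := (adm W).
Local Notation ip := (pairing W).
Local Notation cls := (cls W).
Local Notation orb := (orb W).
Local Notation act := (act W).
Local Notation hit := (hit_prob W).
Local Notation tot := (tot W).
Local Notation beta := (return_moment W).
Local Notation E := (@efun K X C).

Definition fibre_sqnorm H x : \bar K := \esum_(c in orb x) ((H x c) ^+ 2)%:E.

Lemma esum_hit_le1 k x : \esum_(c in orb x) hit k x c <= 1.
Proof.
elim: k x => [|k IHk] x.
  rewrite esum_mkcond (eq_esum (b := fun c => if c \in [set cls x] then 1 else 0)).
    by rewrite -esum_mkcond esum_set1 ?lee01.
  move=> c _; rewrite /hit_prob /= /diag_part.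
  have [<-|xc] := eqVneq (cls x) c; first by rewrite !mem_set//; exact: cls_orb.
  by rewrite if_same memNset// => /esym cx; rewrite cx eqxx in xc.
rewrite -(wt_sum W) /hit_prob iterS /markov_op exchange_esum; last first.
  by move=> c g; rewrite mule_ge0 ?lee_fin ?wt_ge0//; exact: hit_ge0.
apply: le_esum => g _; rewrite esumZl ?wt_ge0//; last by move=> c _; exact: hit_ge0.
by rewrite -[leRHS]mule1 lee_wpmul2l ?lee_fin ?wt_ge0// -(orb_act W g); exact: IHk.
Qed.

Lemma hit_gt0 k x : exists2 c, orb x c & 0 < hit k x c.
Proof.
have [g g0] := wt_pos W; elim: k x => [|k IHk] x.
  exists (cls x); first exact: cls_orb.
  by rewrite /hit_prob /= diag_cls lte01.
have [c xc c0] := IHk (act g x); exists c; first by rewrite -(orb_act W g).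
apply: lt_le_trans (Lam_ge x c (hit_ge0 W k) g0).
by rewrite mule_gt0.
Qed.

#[local] Arguments return_moment : simpl never.

Lemma test_vector (e : K) : (0 < e)%R ->
  (forall s, (0 < s < 1)%R -> ~ \forall x \ae mu, exists j, fast W s j x) ->
  exists H, [/\ adm (E H), ip (E H) (E H) = 1, (1 - e)%:E <= ip (Lam (E H)) (E H) &
    forall x, 0 < fibre_sqnorm H x < +oo].
Proof.
move=> e0 nofast.
(* With relative drop at most t^2 between the even moments 2k and 2k+2, the odd drop is at most t
   x0. The total defect is (t^2 + t) x0 <= 2 t x0 <= e x0; the bound 1/2 ensures t^2 < 1 and t^2 <=
   t. *)
pose t := (Num.min (e / 2) 2^-1)%R; have t0 : (0 < t)%R.
  by rewrite lt_min; apply/andP; split; lra.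
have te : (t <= e / 2)%R by rewrite ge_min lexx.
have t1 : (t <= 2^-1)%R by rewrite ge_min lexx orbT.
have t21 : (0 < t ^+ 2 < 1)%R.
  by rewrite exprn_gt0//= expr2; nra.
have [k hk] := beta_ratio t21 nofast.
have hodd := beta_odd_step W k (ltW t0).
have hstep := beta_step W k.+1; have hstep0 := beta_step W k.
have b0 := beta_gt0 W k.
have := (beta_ge0 W (2 * k).+1, beta_ge0 W (2 * k).+2, beta_ge0 W (2 * k).+3).
rewrite (_ : 2 * k.+2 = (2 * k).+4)%N in hstep; last by rewrite !mulnS.
rewrite (_ : 2 * k.+1 = (2 * k).+2)%N in hstep hstep0 hk; last by rewrite !mulnS.
move=> [[b1 b2] b3].
have [x0 E0] : exists x, beta (2 * k) = x by eexists.
have [x1 E1] : exists x, beta (2 * k).+1 = x by eexists.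
have [x2 E2] : exists x, beta (2 * k).+2 = x by eexists.
have [x3 E3] : exists x, beta (2 * k).+3 = x by eexists.
have [x4 E4] : exists x, beta (2 * k).+4 = x by eexists.
rewrite E0 E1 E2 E3 E4 in hodd; rewrite E2 E4 in hstep; rewrite E0 E2 in hstep0 hk.
rewrite E0 in b0; rewrite E1 in b1; rewrite E2 in b2; rewrite E3 in b3.
pose M := (x0 + 2 * x1 + x2)%R.
have M0 : (0 < M)%R by rewrite /M; lra.
pose eta x c := hit k x c + hit k.+1 x c.
have aeta : adm eta by apply: admD; exact: adm_hit.
have hD n : ip eta (hit n) = (beta (k + n) + beta (k.+1 + n))%:E.
  by rewrite (ipDl (adm_hit W k) (adm_hit W k.+1) (adm_hit W n)) !ip_hit.
have hDr n : ip (hit n) eta = (beta (k + n) + beta (k.+1 + n))%:E.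
  by rewrite ipC hD.
have kk : (k + k = 2 * k)%N by rewrite mul2n addnn.
have ipeta : ip eta eta = M%:E.
  rewrite (ipDl (adm_hit W k) (adm_hit W k.+1) aeta) !hDr !addSn !addnS kk.
  by rewrite E0 E1 E2 /M -EFinD; congr EFin; ring.
have ipLam : ip (Lam eta) eta = (x1 + 2 * x2 + x3)%:E.
  rewrite (LamD W (hit_ge0 W k) (hit_ge0 W k.+1)).
  rewrite (ipDl (adm_hit W k.+1) (adm_hit W k.+2) aeta) !hDr !addSn !addnS kk.
  by rewrite E1 E2 E3 -EFinD; congr EFin; ring.
pose a := ((Num.sqrt M)^-1)%R.
have a0 : (0 < a)%R by rewrite invr_gt0 sqrtr_gt0.
have aa : (a * a = M^-1)%R by rewrite -invfM -expr2 sqr_sqrtr// ltW.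
have hfin n x c : hit n x c \is a fin_num by rewrite fin_num01 ?hit_ge0 ?hit_le1.
pose H x c := (a * fine (eta x c))%R.
have etafin x c : eta x c \is a fin_num by rewrite fin_numD !hfin.
have HE : E H = fun x c => a%:E * eta x c.
  by apply/funext => x; apply/funext => c; rewrite /efun /H EFinM fineK.
have aH : adm (E H) by rewrite HE; apply: admZ => //; exact: ltW.
have aL := adm_Lam aeta.
exists H; split=> // [||x].
- rewrite HE ipZl ?(ltW a0)// -?HE// ipC HE ipZl ?(ltW a0)// ipeta -!EFinM.
  by rewrite mulrA aa mulVf// gt_eqF.
- rewrite HE LamZ ?(ltW a0)//; last exact: aeta.1.
  rewrite ipZl ?(ltW a0)// -?HE// ipC HE ipZl ?(ltW a0)// ipC ipLam -!EFinM.
  rewrite mulrA aa lee_fin mulrC ler_pdivlMr//.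
  (* [beta_odd_step] and x4 <= x2 give 2t (x1 - x3) <= (x0 - x2) + t^2 x2, and both terms are at
     most t^2 x0. *)
  have : (2 * t * (x1 - x3) <= 2 * t * (t * x0))%R.
    have hT : (t ^+ 2 * x2 <= t ^+ 2 * x0)%R by rewrite ler_wpM2l// exprn_ge0// ltW.
    rewrite (_ : 2 * t * (t * x0) = 2 * (t ^+ 2 * x0))%R; last by ring.
    clear -hodd hstep hk hT; lra.
  rewrite ler_pM2l ?mulr_gt0// => h1.
  have : (t ^+ 2 * x0 <= t * x0)%R.
    rewrite ler_pM2r// expr2 ler_piMr ?(ltW t0)//.
    by apply: (le_trans t1); rewrite invf_le1 ?ler1n.
  have : (t * x0 <= e / 2 * x0)%R by rewrite ler_pM2r.
  have : (e * x0 <= e * M)%R by rewrite ler_pM2l// /M; clear -b0 b1 b2; lra.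
  move=> h2 h3 h4; clear -h1 h2 h3 h4 hk; rewrite /M in h2 *; lra.
- have SE : fibre_sqnorm H x = (a ^+ 2)%:E * \esum_(c in orb x) (eta x c * eta x c).
    rewrite /fibre_sqnorm -esumZl ?exprn_ge0 ?(ltW a0)//; last first.
      by move=> c _; rewrite mule_ge0 ?(adm_ge0 _ _ aeta).
    apply: eq_esum => c _; rewrite /H exprMn EFinM; congr (_ * _).
    by rewrite expr2 EFinM fineK.
  rewrite SE; apply/andP; split.
    rewrite mule_gt0 ?lte_fin ?exprn_gt0//.
    have [c xc c0] := hit_gt0 k x.
    have eta0 : 0 < eta x c by rewrite (lt_le_trans c0)// leeDl// hit_ge0.
    apply: (@lt_le_trans _ _ (eta x c * eta x c)); first by rewrite mule_gt0.
    apply: esum_ge; exists [set c]; first by split=> // _ ->.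
    by rewrite fsbig_set1.
  (* Since eta <= 2, its square is at most 2 eta, and each of its two summands has fibre sum at most
     1. *)
  apply: (@le_lt_trans _ _ ((a ^+ 2)%:E * (2%:E * (1 + 1)))); last first.
    by rewrite -EFinD -!EFinM ltry.
  rewrite lee_wpmul2l ?lee_fin ?exprn_ge0 ?(ltW a0)//.
  apply: (@le_trans _ _ (2%:E * (\esum_(c in orb x) hit k x c + \esum_(c in orb x) hit k.+1 x c))).
    rewrite -esumD; [|by move=> *; exact: hit_ge0|by move=> *; exact: hit_ge0].
    rewrite -esumZl//; last by move=> c _; rewrite adde_ge0 ?hit_ge0.
    apply: le_esum => c _; rewrite -/(eta x c) lee_wpmul2r ?(adm_ge0 _ _ aeta)//.
    have -> : 2%:E = 1 + 1 :> \bar K by rewrite -EFinD.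
    by rewrite leeD ?hit_le1.
  by rewrite lee_wpmul2l ?lee_fin// leeD ?esum_hit_le1.
Qed.

End test_vectors.

(** * Distances between fibres, and their normalization *)

Section distances.
Context (K : realType) d (X : measurableType d) (mu : probability X K).
Context (G C : choiceType) (W : coset_walk mu G C).
Implicit Types (F : X -> C -> \bar K) (H : X -> C -> K).
Local Notation Lam := (markov_op W).
Local Notation adm := (adm W).
Local Notation ip := (pairing W).
Local Notation cls := (cls W).
Local Notation orb := (orb W).
Local Notation act := (act W).
Local Notation tot := (tot W).
Local Notation sqnorm := (fibre_sqnorm W).
Local Notation E := (@efun K X C).

Definition sqdist H (y x : X) : \bar K :=
  \esum_(c in orb x) ((H y c - H x c) ^+ 2)%:E.

Lemma sqdist_ge0 H y x : 0 <= sqdist H y x.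
Proof. by apply: esum_ge0 => c _; rewrite lee_fin sqr_ge0. Qed.

Lemma adm_sq H : adm (E H) -> adm (fun x c => ((H x c) ^+ 2)%:E).
Proof.
move=> aH; split=> [x c|h]; first by rewrite lee_fin sqr_ge0.
by apply/measurable_EFinP/measurable_funX/measurable_EFinP; exact: aH.2.
Qed.

Lemma adm_sqdiff g H : adm (E H) ->
  adm (fun x c => ((H (act g x) c - H x c) ^+ 2)%:E).
Proof.
move=> aH; split=> [x c|h]; first by rewrite lee_fin sqr_ge0.
apply/measurable_EFinP/measurable_funX/measurable_funB; apply/measurable_EFinP.
  exact: (adm_act g aH).2.
exact: aH.2.
Qed.

Lemma measurable_sqnorm H : adm (E H) -> measurable_fun [set: X] (sqnorm H).
Proof. by move=> aH; exact: measurable_fsum (adm_sq aH). Qed.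

Lemma measurable_sqdist g H : adm (E H) ->
  measurable_fun [set: X] (fun x => sqdist H (act g x) x).
Proof. by move=> aH; exact: measurable_fsum (adm_sqdiff g aH). Qed.

(** Polarization with the cross term kept on the left, so that nothing infinite is subtracted. *)
Lemma sqdist_cross H y x : (forall x c, 0 <= H x c)%R -> orb y = orb x ->
  sqdist H y x + 2%:E * (\esum_(c in orb x) ((H y c)%:E * (H x c)%:E)) =
  sqnorm H y + sqnorm H x.
Proof.
move=> H0 yx; rewrite /fibre_sqnorm yx -esumZl//; last first.
  by move=> c _; rewrite mule_ge0 ?lee_fin.
rewrite -!esumD; try by move=> c _; rewrite ?lee_fin ?sqr_ge0 ?mulr_ge0.
by apply: eq_esum => c _; rewrite -!EFinM -!EFinD; congr EFin; ring.
Qed.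

Lemma sqdist_ip g H : adm (E H) -> ip (E H) (E H) = 1 ->
  \int[mu]_x sqdist H (act g x) x + 2%:E * ip (fun x => E H (act g x)) (E H) = 2%:E.
Proof.
move=> aH ip1; have H0 x c : (0 <= H x c)%R by rewrite -lee_fin; exact: aH.1.
have aHg := adm_act g aH.
rewrite -[RHS](_ : tot (fun x c => E H (act g x) c * E H (act g x) c) +
    tot (fun x c => E H x c * E H x c) = _); last first.
  by rewrite (tot_act g (admM aH aH)) -/(ip _ _) ip1 -EFinD.
rewrite /pairing -(totZ (ler0n K 2) (admM aHg aH)).
rewrite -(totD (adm_sqdiff g aH) (admZ (ler0n K 2) (admM aHg aH))).
rewrite -(totD (admM aHg aHg) (admM aH aH)); congr tot.
apply/funext => x; apply/funext => c; rewrite /efun.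
by rewrite -!EFinM -!EFinD; congr EFin; ring.
Qed.

Lemma ip_act_le1 g H : adm (E H) -> ip (E H) (E H) = 1 ->
  ip (fun x => E H (act g x)) (E H) <= 1.
Proof.
move=> aH ip1; have := ip_amgm ler01 (adm_act g aH) aH.
rewrite (ip_act g aH aH) ip1 mulr1 expr1n mul1e -EFinD -lee_pdivlMl// -EFinM.
by rewrite (_ : 2^-1 * (1 + 1) = 1)%R; last by lra.
Qed.

(** The correlations c_h are at most 1 and their average is at least 1 - e, so 1 - c_g <= e / w_g
    for each g of positive weight w_g. The integrated squared distance is 2 - 2 c_g. *)
Lemma sqdist_supp g H (e : K) : adm (E H) -> ip (E H) (E H) = 1 ->
  (1 - e)%:E <= ip (Lam (E H)) (E H) -> (0 < wt W g)%R ->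
  \int[mu]_x sqdist H (act g x) x <= (2 * e / wt W g)%:E.
Proof.
move=> aH ip1 He g0.
have gs : wt W g != 0%R by rewrite gt_eqF.
pose c_ h := ip (fun x => E H (act h x)) (E H).
have c0 h : 0 <= c_ h by exact: (ip_ge0 (adm_act h aH) aH).
have c1 h : c_ h <= 1 by exact: ip_act_le1.
have cfin h : c_ h \is a fin_num by rewrite fin_num01.
have w0 h : 0 <= (wt W h)%:E by rewrite lee_fin wt_ge0.
pose S := [set h | wt W h != 0%R].
have SI : S `&` [set g] = [set g] by apply/seteqP; split=> [h []//|h ->].
pose r := \esum_(h in S `&` ~` [set g]) (wt W h)%:E.
have wr : (wt W g)%:E + r = 1.
  by rewrite -(wt_sum W) (esumID [set g])// -/S SI esum_set1.
have rfin : r \is a fin_num.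
  have r0 : 0 <= r by apply: esum_ge0.
  by rewrite fin_num01// -wr leeDr.
have : (1 - e)%:E <= (wt W g)%:E * c_ g + r.
  apply: (le_trans He); rewrite ip_LamE//.
  rewrite (esumID [set g]); last by move=> h _; apply: mule_ge0 => //; exact: c0.
  rewrite -/S SI esum_set1; last by apply: mule_ge0 => //; exact: c0.
  apply: leeD => //.
  by apply: le_esum => h _; rewrite -[leRHS]mule1 lee_wpmul2l//; exact: c1.
have := sqdist_ip g aH ip1; rewrite -/(c_ g).
rewrite -(fineK (cfin g)); have := wr; rewrite -(fineK rfin).
move=> [wr']; move: (\int[mu]_x _) => [D| |]//= [DE].
rewrite lee_fin => h; rewrite lee_fin ler_pdivlMr//.
move: DE h wr'; set cg := fine (c_ g); set rr := fine r; set w := wt W g.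
move=> DE h wr'; have -> : D = (2 - 2 * cg)%R by lra.
have rE : rr = (1 - w)%R by lra.
by rewrite rE in h; clear -h; lra.
Qed.

Lemma sqdist_triangle H (z y x : X) : orb y = orb x ->
  sqdist H z x <= 2%:E * (sqdist H z y + sqdist H y x).
Proof.
move=> yx; rewrite /sqdist yx -esumD; try by move=> c _; rewrite lee_fin sqr_ge0.
rewrite -esumZl//; last by move=> c _; rewrite adde_ge0// lee_fin sqr_ge0.
apply: le_esum => c _; rewrite -EFinD -EFinM lee_fin -subr_ge0.
by rewrite [leRHS](_ : _ = (H z c - H y c - (H y c - H x c)) ^+ 2)%R ?sqr_ge0//; ring.
Qed.

Lemma foldr_act l : exists g, forall x, act g x = foldr act x l.
Proof.
elim: l => [|h l [g gE]]; first by have [n nE] := elt1 W; exists (elt W n).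
by have [k kE] := act_comp W h g; exists k => x; rewrite kE gE.
Qed.

(** Every element is a word in letters of positive weight. The triangle inequality costs a factor 2
    per letter, harmless for a fixed word, and invariance of mu removes the translation by the
    tail. *)
Lemma sqdist_words (H_ : nat -> X -> C -> K) : (forall n, adm (E (H_ n))) ->
  (forall g, (0 < wt W g)%R ->
    (fun n => \int[mu]_x sqdist (H_ n) (act g x) x) @ \oo --> (0 : \bar K)) ->
  forall g, (fun n => \int[mu]_x sqdist (H_ n) (act g x) x) @ \oo --> (0 : \bar K).
Proof.
move=> aH Hs g; have [l [wl lE]] := act_word W g.
elim: l wl g lE => [_|h l IHl /= /andP[h0 wl]] g lE.
  rewrite (_ : (fun n => _) = cst 0); first exact: cvg_cst.
  apply/funext => n; apply: integral0_eq => x _; apply: esum1 => c _.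
  by rewrite lE/= subrr expr0n.
have [k kE] := foldr_act l.
have h1 : (fun n => \int[mu]_x sqdist (H_ n) (act h x) x +
    \int[mu]_x sqdist (H_ n) (act k x) x) @ \oo --> (0 + 0 : \bar K).
  by apply: cvgeD => //; [exact: Hs|exact: IHl].
have h2 : (fun n => 2%:E * (\int[mu]_x sqdist (H_ n) (act h x) x +
    \int[mu]_x sqdist (H_ n) (act k x) x)) @ \oo --> (0 : \bar K).
  by rewrite -[X in _ --> X](mule0 2%:E) -[X in _ --> _ * X](adde0 0); apply: cvgeZl.
apply: (squeeze_cvge _ (cvg_cst 0) h2); apply: nearW => n.
rewrite integral_ge0/=; last by move=> x _; exact: sqdist_ge0.
have mh := measurable_sqdist h (aH n); have mk := measurable_sqdist k (aH n).
have mhk : measurable_fun [set: X] (fun x => sqdist (H_ n) (act h (act k x)) (act k x)).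
  exact: (measurableT_comp mh (act_measurable W k)).
have -> : \int[mu]_x sqdist (H_ n) (act h x) x =
    \int[mu]_x sqdist (H_ n) (act h (act k x)) (act k x).
  by apply/esym; apply: (integral_act W k mh) => x; exact: sqdist_ge0.
rewrite -ge0_integralD//; try by move=> x _; exact: sqdist_ge0.
rewrite -ge0_integralZl_EFin//; first last.
- exact: emeasurable_funD.
- by move=> x _; rewrite adde_ge0// sqdist_ge0.
apply: ge0_le_integral => //.
- by move=> x _; exact: sqdist_ge0.
- exact: measurable_sqdist.
- by apply: emeasurable_funM => //; exact: emeasurable_funD.
- by move=> x _; rewrite lE -kE; apply: sqdist_triangle; rewrite orb_act.
Qed.

Section normalization.
Variable H : X -> C -> K.
Hypotheses (aH : adm (E H)) (H1 : forall x, 0 < sqnorm H x < +oo).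

Let H0 x c : (0 <= H x c)%R.
Proof. by rewrite -lee_fin; exact: aH.1. Qed.

Definition fibre_norm x : K := Num.sqrt (fine (sqnorm H x)).
Local Notation phi := fibre_norm.

Lemma sqnormE x : sqnorm H x = (phi x ^+ 2)%:E.
Proof.
have /andP[n0 noo] := H1 x.
by rewrite sqr_sqrtr ?fineK// ?ge0_fin_numE ?fine_ge0 ?ltW.
Qed.

Lemma fibre_norm_gt0 x : (0 < phi x)%R.
Proof.
have /andP[n0 noo] := H1 x.
by rewrite sqrtr_gt0 fine_gt0// n0 noo.
Qed.

Lemma measurable_fibre_norm : measurable_fun [set: X] phi.
Proof.
apply: (@measurableT_comp _ _ _ _ _ _ (@Num.sqrt K)).
  by apply: continuous_measurable_fun; exact: sqrt_continuous.
by apply: measurableT_comp; [exact: fine_measurable|exact: measurable_sqnorm].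
Qed.

(** Cauchy-Schwarz, obtained from [esum_amgm] applied to the two fibres divided by their norms. *)
Lemma cross_le y x : orb y = orb x ->
  \esum_(c in orb x) ((H y c)%:E * (H x c)%:E) <= (phi y * phi x)%:E.
Proof.
move=> yx; have y0 := fibre_norm_gt0 y; have x0 := fibre_norm_gt0 x.
have nE z : orb z = orb x -> \esum_(c in orb x)
    (((phi z)^-1 * H z c)%:E * ((phi z)^-1 * H z c)%:E) = 1.
  move=> zx; rewrite -zx (eq_esum (b := fun c => ((phi z) ^- 2)%:E * ((H z c) ^+ 2)%:E)).
    rewrite esumZl -/(sqnorm H z) ?sqnormE ?invr_ge0 ?sqr_ge0//.
      by rewrite -EFinM mulVf// expf_neq0// gt_eqF// fibre_norm_gt0.
    by move=> c' _; rewrite lee_fin sqr_ge0.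
  by move=> c' _; rewrite -!EFinM; congr EFin; rewrite -exprVn; ring.
have := @esum_amgm _ _ (orb x) (fun c => ((phi y)^-1 * H y c)%:E)
  (fun c => ((phi x)^-1 * H x c)%:E).
have g0 z c : 0 <= ((phi z)^-1 * H z c)%:E.
  by rewrite lee_fin mulr_ge0// invr_ge0 ltW// fibre_norm_gt0.
move=> /(_ (g0 _) (g0 _)); rewrite (nE y yx) (nE x erefl).
rewrite (eq_esum (b := fun c => ((phi y * phi x)^-1)%:E * ((H y c)%:E * (H x c)%:E))).
  rewrite esumZl; last 2 first.
  - by rewrite invr_ge0 mulr_ge0// ltW.
  - by move=> c _; rewrite mule_ge0 ?lee_fin.
  rewrite muleA -EFinM -EFinD -lee_pdivlMl; last by rewrite mulr_gt0// invr_gt0 mulr_gt0.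
  move=> /le_trans; apply; rewrite -EFinM lee_fin invfM invrK.
  by rewrite mulrAC [(2^-1 * _)%R](_ : _ = 1)%R ?mul1r//; lra.
by move=> c _; rewrite -!EFinM; congr EFin; rewrite invfM; ring.
Qed.

(** The reverse triangle inequality in l^2 of the orbit. It passes almost invariance from the fibres
    to their norms. *)
Lemma fibre_norm_dist y x : orb y = orb x ->
  ((phi y - phi x) ^+ 2)%:E <= sqdist H y x.
Proof.
move=> yx; have := sqdist_cross H0 yx; have := cross_le yx; rewrite !sqnormE.
have := sqdist_ge0 H y x; move: (sqdist H y x) => [D| |] // D0; last by rewrite leey.
have : 0 <= \esum_(c in orb x) ((H y c)%:E * (H x c)%:E).
  by apply: esum_ge0 => c _; rewrite mule_ge0 ?lee_fin.
move: (esum _ _) => [e| |]// e0; rewrite !lee_fin => ele [DE].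
by rewrite !expr2 in DE *; lra.
Qed.

Definition normalized x c : K := ((phi x)^-1 * H x c)%R.

Lemma adm_normalized : adm (E normalized).
Proof.
split=> [x c|g].
  by rewrite lee_fin mulr_ge0// invr_ge0 ltW// fibre_norm_gt0.
apply/measurable_EFinP/measurable_funM; last by apply/measurable_EFinP; exact: aH.2.
rewrite (_ : (fun x => _) = fun x => phi x `^ (-1))%R.
  exact: (measurableT_comp (@measurable_powR K (-1)%R) measurable_fibre_norm).
by apply/funext => x; rewrite powR_inv1// ltW// fibre_norm_gt0.
Qed.

Lemma sqnorm_normalized x : sqnorm normalized x = 1.
Proof.
have x0 := fibre_norm_gt0 x.
rewrite /fibre_sqnorm (eq_esum (b := fun c => ((phi x) ^- 2)%:E * ((H x c) ^+ 2)%:E)).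
  rewrite esumZl -/(sqnorm H x) ?sqnormE ?invr_ge0 ?sqr_ge0//.
    by rewrite -EFinM mulVf// expf_neq0// gt_eqF.
  by move=> c' _; rewrite lee_fin sqr_ge0.
by move=> c _; rewrite exprMn exprVn EFinM.
Qed.

(** With a, b the unit fibres and p, q their former norms, a - b = (1 - p) a - (1 - q) b + (p a - q
    b). The first two terms have norms |1 - p| and |1 - q|, the third is the distance before
    normalization. *)
Lemma sqdist_normalized y x : orb y = orb x ->
  sqdist normalized y x <=
  3%:E * (((1 - phi y) ^+ 2)%:E + ((1 - phi x) ^+ 2)%:E + sqdist H y x).
Proof.
move=> yx.
have E1 z : orb z = orb x -> ((1 - phi z) ^+ 2)%:E =
    \esum_(c in orb x) (((1 - phi z) * normalized z c) ^+ 2)%:E.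
  move=> zx; rewrite -zx.
  rewrite (eq_esum (b := fun c => ((1 - phi z) ^+ 2)%:E * (normalized z c ^+ 2)%:E)).
    rewrite esumZl ?sqr_ge0// -/(sqnorm normalized z) ?sqnorm_normalized ?mule1//.
    by move=> c _; rewrite lee_fin sqr_ge0.
  by move=> c _; rewrite exprMn EFinM.
rewrite (E1 y yx) (E1 x erefl) /sqdist.
have p (r : K) : 0 <= (r ^+ 2)%:E by rewrite lee_fin sqr_ge0.
rewrite -esumD => [|c _|c _]; [|exact: p|exact: p].
rewrite -esumD => [|c _|c _]; [|by apply: adde_ge0; exact: p|exact: p].
rewrite -esumZl// => [|c _]; last by apply: adde_ge0; [apply: adde_ge0|]; exact: p.
apply: le_esum => c _; rewrite -!EFinD -EFinM lee_fin.
have HE z : H z c = (phi z * normalized z c)%R.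
  by rewrite /normalized mulVKf// gt_eqF// fibre_norm_gt0.
rewrite !HE; set a := normalized y c; set b := normalized x c.
set p1 := phi y; set q1 := phi x.
set u := ((1 - p1) * a)%R; set v := ((1 - q1) * b)%R; set w := (p1 * a - q1 * b)%R.
have -> : (a - b = u - v + w)%R by rewrite /u /v /w; ring.
(* The defect of (u - v + w)^2 <= 3 (u^2 + v^2 + w^2), written as a sum of squares. *)
rewrite -subr_ge0 [leRHS](_ : _ = (u + v) ^+ 2 + (u - w) ^+ 2 + (v + w) ^+ 2)%R.
  by rewrite !addr_ge0 ?sqr_ge0.
by ring.
Qed.

End normalization.

End distances.

(** * Extraction of a sequence that is almost invariant at almost every point *)

Section construction.
Context (K : realType) d (X : measurableType d) (mu : probability X K).
Context (G C : choiceType) (W : coset_walk mu G C).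
Implicit Types (F : X -> C -> \bar K) (H : X -> C -> K).
Local Notation Lam := (markov_op W).
Local Notation adm := (adm W).
Local Notation ip := (pairing W).
Local Notation orb := (orb W).
Local Notation act := (act W).
Local Notation sqnorm := (fibre_sqnorm W).
Local Notation sqdist := (sqdist W).
Local Notation E := (@efun K X C).

Lemma integral_sqnorm H : adm (E H) -> ip (E H) (E H) = \int[mu]_x sqnorm H x.
Proof.
move=> aH; apply: eq_integral => x _; apply: eq_esum => c _.
by rewrite /efun -EFinM expr2.
Qed.

Lemma integral_sq1 (phi : X -> K) : measurable_fun [set: X] phi ->
  (forall x, 0 <= phi x)%R -> \int[mu]_x ((phi x) ^+ 2)%:E = 1 ->
  \int[mu]_x ((1 - phi x) ^+ 2)%:E + 2%:E * \int[mu]_x (phi x)%:E = 2%:E.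
Proof.
move=> mphi phi0 phi1.
have m1 : measurable_fun [set: X] (fun x => ((1 - phi x) ^+ 2)%:E).
  by apply/measurable_EFinP/measurable_funX/measurable_funB.
have m2 : measurable_fun [set: X] (fun x => ((phi x) ^+ 2)%:E).
  exact/measurable_EFinP/measurable_funX.
have m3 : measurable_fun [set: X] (fun x => (phi x)%:E) by exact/measurable_EFinP.
have -> : \int[mu]_x ((1 - phi x) ^+ 2)%:E + 2%:E * \int[mu]_x (phi x)%:E =
    \int[mu]_x (cst 1 x) + \int[mu]_x ((phi x) ^+ 2)%:E; last first.
  by rewrite integral_cst1 phi1 -EFinD.
rewrite -ge0_integralZl_EFin//; last by move=> x _; rewrite lee_fin.
rewrite -!ge0_integralD//; try by move=> x _; rewrite ?lee_fin ?sqr_ge0 ?mulr_ge0.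
- by apply: eq_integral => x _; rewrite -EFinM -!EFinD; congr EFin; ring.
- by apply: emeasurable_funM.
Qed.

(** At stage j only the first j + 1 sequences are controlled, so it is enough to pass finitely many
    thresholds. The bound 2^-j is summable, as Borel-Cantelli requires. *)
Lemma cvge0_diagonal (D : nat -> nat -> \bar K) :
  (forall m, D m @ \oo --> (0 : \bar K)) ->
  exists v : nat -> nat, forall j m, (m <= j)%N ->
    D m (v j) <= ((2^-1 : K) ^+ j)%:E.
Proof.
move=> D0.
suff /choice [v hv] : forall j, exists n, forall m, (m <= j)%N ->
    D m n <= ((2^-1 : K) ^+ j)%:E by exists v.
move=> j; have e0 : (0 < (2^-1 : K) ^+ j)%R by rewrite exprn_gt0 ?invr_gt0.
have ev m : \forall n \near \oo, D m n <= ((2^-1 : K) ^+ j)%:E.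
  have /fine_cvgP[fD /cvgr_le/(_ _ e0) cD] := D0 m.
  by move: fD cD; apply: filterS2 => n fDn; rewrite -lee_fin /= fineK.
have /choice[N hN] : forall m, exists N, forall n, (N <= n)%N ->
    D m n <= ((2^-1 : K) ^+ j)%:E.
  by move=> m; have [N _ hN] := ev m; exists N => n; exact: hN.
exists (\max_(m < j.+1) N m) => m mj; apply: hN.
exact: (@leq_bigmax _ (fun m : 'I_j.+1 => N m) (Ordinal (mj : m < j.+1)%N)).
Qed.

(** The second hypothesis is spectral gap in the form in which it is used: almost invariant
    nonnegative unit vectors of L^2(X) have mean tending to 1, hence tend to the constant 1. *)
Lemma exists_almost_invariant :
  (forall s, (0 < s < 1)%R -> ~ \forall x \ae mu, exists j, fast W s j x) ->
  (forall phi : nat -> X -> K,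
    (forall n, measurable_fun [set: X] (phi n)) -> (forall n x, 0 <= phi n x)%R ->
    (forall n, \int[mu]_x ((phi n x) ^+ 2)%:E = 1) ->
    (forall g, (fun n => \int[mu]_x ((phi n (act g x) - phi n x) ^+ 2)%:E) @ \oo -->
       (0 : \bar K)) ->
    (fun n => \int[mu]_x (phi n x)%:E) @ \oo --> (1 : \bar K)) ->
  exists xi : nat -> X -> C -> K, [/\ forall n, adm (E (xi n)),
    forall n x, sqnorm (xi n) x = 1 &
    \forall x \ae mu, forall g,
      (fun n => sqdist (xi n) (act g x) x) @ \oo --> (0 : \bar K)].
Proof.
move=> nofast SG.
have /choice[H_ hH] : forall n, exists H, [/\ adm (E H), ip (E H) (E H) = 1,
    (1 - n.+1%:R^-1)%:E <= ip (Lam (E H)) (E H) & forall x, 0 < sqnorm H x < +oo].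
  by move=> n; apply: test_vector.
have aH n : adm (E (H_ n)) by case: (hH n).
have ip1 n : ip (E (H_ n)) (E (H_ n)) = 1 by case: (hH n).
have rate n : (1 - n.+1%:R^-1)%:E <= ip (Lam (E (H_ n))) (E (H_ n)) by case: (hH n).
have H1 n x : 0 < sqnorm (H_ n) x < +oo by case: (hH n).
have D0 g : (fun n => \int[mu]_x sqdist (H_ n) (act g x) x) @ \oo --> (0 : \bar K).
  apply: (sqdist_words aH) => {}g g0.
  have h : (fun n => (2 * n.+1%:R^-1 / wt W g)%:E) @ \oo --> (0 : \bar K).
    have hr : (fun n => (2 / wt W g) * n.+1%:R^-1)%R @ \oo --> (0 : K)%R.
      rewrite -[X in _ --> X](mulr0 (2 / wt W g)%R).
      by apply: cvgM; [exact: cvg_cst|exact: cvg_harmonic].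
    rewrite (_ : (fun n => _) = EFin \o (fun n => (2 / wt W g) * n.+1%:R^-1)%R).
      exact: cvg_comp hr _.
    by apply/funext => n /=; rewrite mulrAC.
  apply: (squeeze_cvge _ (cvg_cst 0) h); apply: nearW => n.
  rewrite integral_ge0/=; last by move=> x _; exact: sqdist_ge0.
  exact: sqdist_supp.
pose phi n := fibre_norm W (H_ n).
have phi0 n x : (0 < phi n x)%R by exact: (fibre_norm_gt0 (H1 n)).
have mphi n : measurable_fun [set: X] (phi n) by exact: measurable_fibre_norm.
have phi1 n : \int[mu]_x ((phi n x) ^+ 2)%:E = 1.
  rewrite -(ip1 n) integral_sqnorm//; apply: eq_integral => x _.
  by rewrite (sqnormE (H1 n)).
have cphi : (fun n => \int[mu]_x (phi n x)%:E) @ \oo --> (1 : \bar K).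
  apply: SG => // [n x|g]; first exact: ltW.
  apply: (squeeze_cvge _ (cvg_cst 0) (D0 g)); apply: nearW => n.
  rewrite integral_ge0/=; last by move=> x _; rewrite lee_fin sqr_ge0.
  apply: ge0_le_integral => //.
  - by move=> x _; rewrite lee_fin sqr_ge0.
  - apply/measurable_EFinP/measurable_funX/measurable_funB => //.
    exact: (measurableT_comp (mphi n) (act_measurable W g)).
  - exact: measurable_sqdist.
  - by move=> x _; apply: (fibre_norm_dist (aH n) (H1 n)); rewrite orb_act.
pose V n := \int[mu]_x ((1 - phi n x) ^+ 2)%:E.
have V0 n : 0 <= V n by apply: integral_ge0 => x _; rewrite lee_fin sqr_ge0.
have VE n : V n + 2%:E * \int[mu]_x (phi n x)%:E = 2%:E.
  by apply: integral_sq1 => // x; exact: ltW.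
have cV : V @ \oo --> (0 : \bar K).
  rewrite (_ : V = fun n => 2%:E - 2%:E * \int[mu]_x (phi n x)%:E).
    rewrite -[X in _ --> X](subee (x := 2%:E))// -[X in _ --> _ - X](mule1 2%:E).
    apply: cvgeB => //; [exact: cvg_cst|exact: cvgeZl].
  apply/funext => n; have := VE n; have := V0 n.
  have : 0 <= \int[mu]_x (phi n x)%:E.
    by apply: integral_ge0 => x _; rewrite lee_fin ltW.
  move: (V n) (\int[mu]_x (phi n x)%:E) => [v| |] [w| |]//= _ _.
  + by move=> [e]; congr EFin; lra.
  + by rewrite gt0_muley ?lte_fin.
  + by rewrite gt0_muley ?lte_fin.
pose xi n := normalized W (H_ n).
have axi n : adm (E (xi n)) by exact: adm_normalized.
have D_ g : (fun n => \int[mu]_x sqdist (xi n) (act g x) x) @ \oo --> (0 : \bar K).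
  have h : (fun n => 3%:E * (V n + V n + \int[mu]_x sqdist (H_ n) (act g x) x))
      @ \oo --> (0 : \bar K).
    rewrite -[X in _ --> X](mule0 3%:E); apply: cvgeZl => //.
    rewrite -[X in _ --> X](adde0 0); apply: cvgeD => //.
    by rewrite -[X in _ --> X](adde0 0); apply: cvgeD.
  apply: (squeeze_cvge _ (cvg_cst 0) h); apply: nearW => n.
  rewrite integral_ge0/=; last by move=> x _; exact: sqdist_ge0.
  have mV : measurable_fun [set: X] (fun x => ((1 - phi n x) ^+ 2)%:E).
    by apply/measurable_EFinP/measurable_funX/measurable_funB.
  have mVg := measurableT_comp mV (act_measurable W g).
  have mD := measurable_sqdist g (aH n).
  have Vg : V n = \int[mu]_x ((1 - phi n (act g x)) ^+ 2)%:E.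
    by apply/esym; apply: (integral_act W g mV) => x; rewrite lee_fin sqr_ge0.
  rewrite {1}Vg -!ge0_integralD//;
    try by move=> x _; rewrite ?adde_ge0 ?sqdist_ge0 ?lee_fin ?sqr_ge0.
    rewrite -ge0_integralZl_EFin//; last 2 first.
    - by move=> x _; rewrite ?adde_ge0 ?sqdist_ge0 ?lee_fin ?sqr_ge0.
    - by apply: emeasurable_funD => //; exact: emeasurable_funD.
    apply: ge0_le_integral => //.
    - by move=> x _; exact: sqdist_ge0.
    - exact: measurable_sqdist.
    - by apply: emeasurable_funM => //; apply: emeasurable_funD => //; exact: emeasurable_funD.
    - by move=> x _; apply: (sqdist_normalized (H1 n)); rewrite orb_act.
  exact: emeasurable_funD.
have [v hv] := @cvge0_diagonal
  (fun m n => \int[mu]_x sqdist (xi n) (act (elt W m) x) x) (fun m => D_ (elt W m)).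
exists (fun j => xi (v j)); split=> [n|n x|]; first exact: axi.
  exact: (sqnorm_normalized (H1 _)).
have h m : \forall x \ae mu,
    (fun j => sqdist (xi (v j)) (act (elt W m) x) x) @ \oo --> (0 : \bar K).
  (* The indices [v j] control the m-th element from stage m on; the value 0 before that keeps the
     bound 2^-j valid at every j. The rate 3/4 is any number strictly between 1/2 and 1. *)
  pose f j x := if (m <= j)%N then sqdist (xi (v j)) (act (elt W m) x) x else 0.
  have qt : (2^-1 < 3 / 4 :> K)%R by lra.
  apply: filterS (@ae_geometric_decay _ _ _ mu f 2^-1%R (3 / 4)%R _ qt _ _ _).
  - move=> x [j0 hj0].
    have h : (fun j => ((3 / 4 : K) ^+ j)%:E) @ \oo --> (0 : \bar K).
      have hr : (fun j => (3 / 4 : K) ^+ j)%R @ \oo --> (0 : K)%R.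
        by apply: cvg_expr; rewrite ger0_norm; lra.
      exact: (cvg_comp hr (@cvg_id _ _)) || exact: cvg_comp hr _.
    apply: (squeeze_cvge _ (cvg_cst 0) h).
    exists (maxn m j0) => // j /=; rewrite geq_max => /andP[mj j0j].
    by rewrite sqdist_ge0/=; have := hj0 _ j0j; rewrite /f mj.
  - by rewrite invr_ge0.
  - move=> j; rewrite /f; case: (m <= j)%N; last exact: measurable_cst.
    exact: measurable_sqdist.
  - by move=> j x; rewrite /f; case: (m <= j)%N => //; exact: sqdist_ge0.
  - move=> j _; rewrite /f; case: (boolP (m <= j)%N) => [mj|_]; first exact: hv.
    by rewrite integral0_eq// lee_fin exprn_ge0// invr_ge0.
have : \forall x \ae mu, forall m,
    (fun j => sqdist (xi (v j)) (act (elt W m) x) x) @ \oo --> (0 : \bar K).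
  by apply: ae_foralln.
apply: filterS => x hx g; have [m mE] := elt_act W g.
by rewrite mE; exact: hx.
Qed.

End construction.

(** * The action of the support of the measure *)

Section orbit_action.
Context (K : realType) d (X : measurableType d).
Context (mu : standard_probability K X) (R : pmp_eqrel mu).
Variable nu : full_group R -> K.
Hypotheses (nuP : countable_prob nu) (nuS : symmetric_prob nu) (nuG : generates nu).
Local Notation Gam := (generated (supp nu)).

Lemma generated_subgroup (D : set (full_group R)) : is_subgroup (generated D).
Proof.
split.
- by move=> H [[H1 _ _] _].
- move=> g h Dg Dh H HD; have [[_ HM _] _] := HD; apply: HM; [exact: Dg|exact: Dh].
- by move=> g Dg H HD; have [[_ _ HV] _] := HD; apply: HV; exact: Dg.
Qed.

Lemma supp_generated : supp nu `<=` Gam.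
Proof. by move=> g sg H [_]; apply. Qed.

Lemma supp_neq0 : exists g, supp nu g.
Proof.
have [_ _ nu1] := nuP; apply: contrapT => nog; move: nu1; rewrite esum1.
  by move=> /eqP; rewrite eqe eq_sym oner_eq0.
move=> g _; case: (eqVneq (nu g) 0%R) => [->//|gs].
by exfalso; apply: nog; exists g.
Qed.

Definition word (l : seq (full_group R)) : full_group R := foldr mul 1%g l.

Lemma word_cat l m : word (l ++ m) = (word l * word m)%g.
Proof. by elim: l => [|g l IHl] /=; rewrite ?mul1g// IHl mulgA. Qed.

(** By symmetry of nu the inverse of a letter is a letter, so the words in the support form a
    subgroup. *)
Lemma generated_word g : Gam g -> exists2 l, all (fun h => nu h != 0%R) l & g = word l.
Proof.
apply: (smallest_sub (G := supp nu)
  (X := [set g | exists2 l, all (fun h => nu h != 0%R) l & g = word l])).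
  split=> [|_ _ [l al ->] [m am ->]|_ [l al ->]].
  - by exists [::].
  - by exists (l ++ m); rewrite ?all_cat ?al ?am ?word_cat.
  - elim: l al => [_|h l IHl /= /andP[hs /IHl[m am mE]]].
      by exists [::] => //; rewrite /= invg1.
    exists (m ++ [:: (h^-1)%g]); first by rewrite all_cat am /= -nuS hs.
    by rewrite word_cat -mE /= mulg1 invgM.
by move=> h hs; exists [:: h]; rewrite /= ?andbT ?mulg1.
Qed.

(** Words are coded by sequences of natural numbers through an injection of the support into them;
    indices that correspond to no letter are sent to a fixed [g0]. *)
Lemma generated_enum : exists e : nat -> full_group R,
  (forall n, Gam (e n)) /\ (forall g, Gam g -> exists n, g = e n).
Proof.
have [_ /countable_injP[f finj] _] := nuP; have [g0 g0s] := supp_neq0.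
have /choice[s sE] : forall n, exists g, supp nu g /\
    forall h, supp nu h -> f h = n -> g = h.
  move=> n; have [[g [gs gn]]|ng] := pselect (exists g, supp nu g /\ f g = n).
    by exists g; split=> // h hs hn; apply: finj; rewrite ?inE// gn hn.
  by exists g0; split=> // h hs hn; exfalso; apply: ng; exists h.
pose e n := word [seq s i | i <- odflt [::] (@choice.unpickle (seq nat) n)].
exists e; split=> [n|g /generated_word[l al ->]].
  have [G1 GM _] := generated_subgroup (supp nu).
  rewrite /e; elim: (odflt _ _) => //= i l IHl; apply: GM => //.
  by apply: supp_generated; exact: (sE i).1.
exists (choice.pickle [seq f h | h <- l]); rewrite /e choice.pickleK /= -map_comp.
congr word; elim: l al => //= h l IHl /andP[hs /IHl <-].
by congr cons; apply/esym; exact: (sE _).2.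
Qed.

(** Each of these exact identities holds almost everywhere; as the generated group is countable,
    they hold together at almost every point. *)
Definition good_point (x : X) : Prop :=
  [/\ forall g, Gam g -> eqclass R x (full_fun g x),
      forall g h, Gam g -> Gam h -> full_fun (g * h)%g x = full_fun g (full_fun h x),
      full_fun (1 : full_group R)%g x = x &
      forall y, eqclass R x y -> exists2 g, Gam g & y = full_fun g x].

Lemma full_mul_ae (g h : full_group R) :
  \forall x \ae mu, full_fun (g * h)%g x = full_fun g (full_fun h x).
Proof.
by apply: filterS (repr_pi_full (rep_mul (repr g) (repr h))) => x.
Qed.

Lemma good_point_ae : \forall x \ae mu, good_point x.
Proof.
have [e [eG Ge]] := generated_enum.
have h1 : \forall x \ae mu, forall n, eqclass R x (full_fun (e n) x).
  by apply: ae_foralln => n; exact: rep_in.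
have h2 : \forall x \ae mu, forall m n,
    full_fun (e m * e n)%g x = full_fun (e m) (full_fun (e n) x).
  by apply: ae_foralln => m; apply: ae_foralln => n; exact: full_mul_ae.
have h3 : \forall x \ae mu, full_fun (1 : full_group R)%g x = x.
  exact: repr_pi_full (rep_one R).
have h12 : \forall x \ae mu, (forall n, eqclass R x (full_fun (e n) x)) /\
    forall m n, full_fun (e m * e n)%g x = full_fun (e m) (full_fun (e n) x).
  by apply: filterS2 h1 h2.
have h4 : \forall x \ae mu, [set full_fun g x | g in Gam] = eqclass R x by exact: nuG.
apply: filterS3 h12 h3 h4 => x [x1 x2] x3 x4; split=> // [g|g h|y].
- by move=> /Ge[n ->].
- by move=> /Ge[m ->] /Ge[n ->].
- by rewrite -x4 => -[g gG <-]; exists g.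
Qed.

Lemma full_measurable (g : full_group R) : measurable_fun [set: X] (full_fun g).
Proof. exact: rep_measurable. Qed.

(** The points whose translates by all group elements avoid a null set that contains the bad points.
    Invariance holds because composition is exact at good points and the group is closed under
    products. *)
Lemma good_domain : exists X0 : set X, [/\ measurable X0,
  \forall x \ae mu, X0 x, X0 `<=` good_point &
  forall g x, Gam g -> X0 x -> X0 (full_fun g x)].
Proof.
have [e [eG Ge]] := generated_enum.
have [N [mN N0 NE]] := good_point_ae.
pose Y := ~` N.
have Ygood x : Y x -> good_point x.
  by move=> Yx; apply: contrapT => nx; apply: Yx; exact: NE.
have aeY : \forall x \ae mu, Y x by exists N; split=> //; rewrite /Y setCK.
pose X0 := Y `&` \bigcap_n (full_fun (e n) @^-1` Y).
exists X0; split.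
- apply: measurableI; first exact: measurableC.
  apply: bigcapT_measurable => n; rewrite -[X in measurable X]setTI.
  by apply: full_measurable => //; exact: measurableC.
- have : \forall x \ae mu, forall n, Y (full_fun (e n) x).
    by apply: ae_foralln => n; exact: ae_rep.
  by apply: filterS2 aeY => x Yx h; split=> // n _; exact: h.
- by move=> x [/Ygood].
- move=> g x gG [Yx hx]; have [m gE] := Ge _ gG; split; first by rewrite gE; exact: hx.
  move=> n _ /=; have [_ xM _ _] := Ygood _ Yx.
  have [_ GM _] := generated_subgroup (supp nu).
  rewrite -xM//; have [k ->] := Ge _ (GM _ _ (eG n) gG); exact: hx.
Qed.

End orbit_action.

(** * The walk over an invariant conull set, and its agreement with the given random walk *)

Section orbit_walk.
Context (K : realType) d (X : measurableType d).
Context (mu : standard_probability K X) (R : pmp_eqrel mu) (S : sub_eqrel R).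
Variable nu : full_group R -> K.
Hypotheses (nuP : countable_prob nu) (nuS : symmetric_prob nu).
Local Notation Gam := (generated (supp nu)).
Variables (X0 : set X) (e : nat -> full_group R).
Hypotheses (mX0 : measurable X0) (aeX0 : \forall x \ae mu, X0 x).
Hypotheses (X0good : X0 `<=` good_point nu).
Hypotheses (X0G : forall g x, Gam g -> X0 x -> X0 (full_fun g x)).
Hypotheses (Ge : forall g, Gam g -> exists n, g = e n).

Let G1 : Gam 1%g. Proof. by have [] := generated_subgroup (supp nu). Qed.
Let GM g h : Gam g -> Gam h -> Gam (g * h)%g.
Proof. by have [_ GM _] := generated_subgroup (supp nu); exact: GM. Qed.
Let GV g : Gam g -> Gam (g^-1)%g.
Proof. by have [_ _ GV] := generated_subgroup (supp nu); exact: GV. Qed.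

(** Also the identity for g outside the generated group: the index type is the whole full group, and
    such g have weight 0. *)
Definition oact (g : full_group R) (x : X) : X :=
  if `[< X0 x /\ Gam g >] then full_fun g x else x.

(** Off [X0] nothing moves, so the only coset reached from x is its own class. *)
Definition oorb (x : X) : set (set X) :=
  if `[< X0 x >] then quotient_class S x else [set eqclass S x].

Lemma oactE g x : X0 x -> Gam g -> oact g x = full_fun g x.
Proof. by move=> xX gG; rewrite /oact asboolT. Qed.

Lemma oact_notin g x : ~ X0 x -> oact g x = x.
Proof. by move=> xX; rewrite /oact asboolF// => -[]. Qed.

Lemma oact_id g x : ~ Gam g -> oact g x = x.
Proof. by move=> gG; rewrite /oact asboolF// => -[]. Qed.

Lemma oact_domain g x : X0 (oact g x) <-> X0 x.
Proof.
have [xX|xX] := pselect (X0 x); last by rewrite oact_notin.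
have [gG|gG] := pselect (Gam g); last by rewrite oact_id.
by rewrite oactE//; split=> // _; exact: X0G.
Qed.

Lemma oact1 x : oact 1%g x = x.
Proof.
have [xX|xX] := pselect (X0 x); last by rewrite oact_notin.
by rewrite oactE//; have [_ _ -> _] := X0good xX.
Qed.

Lemma oactM g h x : Gam g -> Gam h -> oact (g * h)%g x = oact g (oact h x).
Proof.
move=> gG hG; have [xX|xX] := pselect (X0 x); last by rewrite !oact_notin.
rewrite !oactE//; [|exact: X0G|exact: GM].
by have [_ -> //] := X0good xX.
Qed.

Lemma oact_eqclass g x : X0 x -> eqclass R x (oact g x).
Proof.
move=> xX; have [gG|gG] := pselect (Gam g).
  by rewrite oactE//; have [h _ _ _] := X0good xX; exact: h.
by rewrite oact_id//; have [h _ _] := pmp_eqrelP R; exact: h.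
Qed.

Lemma eqclass_oact x y : X0 x -> eqclass R x y -> exists2 g, Gam g & y = oact g x.
Proof.
move=> xX xy; have [_ _ _ h] := X0good xX; have [g gG ->] := h y xy.
by exists g => //; rewrite oactE.
Qed.

Lemma oact_measurable g : measurable_fun [set: X] (oact g).
Proof.
have [gG|gG] := pselect (Gam g); last first.
  rewrite (_ : oact g = id); first exact: measurable_id.
  by apply/funext => x; rewrite oact_id.
move=> _ A mA; rewrite setTI.
rewrite (_ : _ @^-1` _ = (X0 `&` full_fun g @^-1` A) `|` (~` X0 `&` A)).
  apply: measurableU; apply: measurableI => //; last exact: measurableC.
  by rewrite -[X in measurable X]setTI; exact: full_measurable.
apply/seteqP; split=> x /=.
  have [xX|xX] := pselect (X0 x); first by rewrite oactE// => h; left.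
  by rewrite oact_notin// => h; right.
by move=> [[xX]|[xX]]; [rewrite oactE|rewrite oact_notin].
Qed.

Lemma oact_preserves g A : measurable A -> mu (oact g @^-1` A) = mu A.
Proof.
move=> mA; have mgA : measurable (oact g @^-1` A).
  by rewrite -[X in measurable X]setTI; exact: oact_measurable.
have [gG|gG] := pselect (Gam g); last first.
  by congr (mu _); apply/seteqP; split=> x /=; rewrite oact_id.
have mfA : measurable (full_fun g @^-1` A).
  by rewrite -[X in measurable X]setTI; exact: full_measurable.
rewrite -(conull_setI mgA mX0 aeX0) -[RHS](rep_preserves (repr g) mA).
rewrite -[RHS](conull_setI mfA mX0 aeX0); congr (mu _).
by apply/seteqP; split=> x [/= xA xX]; split=> //=; rewrite ?oactE// in xA *.
Qed.

Lemma oact_comp g h : exists k, forall x, oact k x = oact g (oact h x).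
Proof.
have [gG|gG] := pselect (Gam g); last by exists h => x; rewrite [RHS]oact_id.
have [hG|hG] := pselect (Gam h); last by exists g => x; rewrite [in RHS](oact_id _ hG).
by exists (g * h)%g => x; rewrite oactM.
Qed.

Lemma oact_inv g x : oact g (oact (g^-1)%g x) = x.
Proof.
have [gG|gG] := pselect (Gam g).
  by rewrite -oactM ?mulgV ?oact1//; exact: GV.
by rewrite !oact_id// => /GV; rewrite invgK.
Qed.

Lemma oact_word g : exists l : seq (full_group R), all (fun h => 0 < nu h)%R l /\
  forall x, oact g x = foldr oact x l.
Proof.
have [nu0 _ _] := nuP.
have [gG|gG] := pselect (Gam g); last first.
  by exists [::]; split=> // x; rewrite oact_id.
have [l al ->] := generated_word nuS gG; exists l; split.
  by apply: sub_all al => h hs; rewrite lt_neqAle eq_sym hs nu0.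
move=> x; elim: l al => [_|h l IHl /= /andP[hs al]]; first by rewrite /= oact1.
rewrite oactM; [|exact: supp_generated|].
  by rewrite IHl.
by elim: l al {IHl} => [_|k l IHl /= /andP[ks al]] //=; apply: GM;
  [exact: supp_generated|exact: IHl].
Qed.

Lemma quotient_class_oact g x : X0 x -> quotient_class S (oact g x) = quotient_class S x.
Proof.
move=> xX; suff E : eqclass R (oact g x) = eqclass R x.
  by rewrite /quotient_class E.
have [_ Rsym Rtr] := pmp_eqrelP R; have h := oact_eqclass g xX.
apply/seteqP; split=> y; first exact: Rtr.
by apply: Rtr; exact: Rsym.
Qed.

Lemma oorb_oact g x : oorb (oact g x) = oorb x.
Proof.
have [xX|xX] := pselect (X0 x); last by rewrite oact_notin.
rewrite /oorb asboolT; last by rewrite oact_domain.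
by rewrite asboolT// quotient_class_oact.
Qed.

Lemma oorb_elt x : oorb x = range (fun n => eqclass S (oact (e n) x)).
Proof.
rewrite /oorb; case: asboolP => xX; last first.
  apply/seteqP; split=> [_ ->|_ [n _ <-]]; last by rewrite oact_notin.
  by exists 0%N => //; rewrite oact_notin.
apply/seteqP; split=> [c [[y ->]]|_ [n _ <-]]; last first.
  exact/eqclass_quotient/oact_eqclass.
have [Srefl _ _] := sub_eqrelP S.
move=> /(_ y (Srefl y)) /(eqclass_oact xX)[g gG ->].
by have [n ->] := Ge gG; exists n.
Qed.

Lemma eqclassP x y : eqclass S x = eqclass S y <-> sub_rel S (x, y).
Proof.
have [Srefl Ssym Str] := sub_eqrelP S; split=> [E|xy].
  have : eqclass S y y by exact: Srefl.
  by rewrite -E; apply.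
apply/seteqP; split=> z; first by apply: Str; exact: Ssym.
exact: Str.
Qed.

Lemma ocls_measurable g h :
  measurable [set x | eqclass S (oact g x) = eqclass S (oact h x)].
Proof.
have mp : measurable_fun [set: X] (fun x => (oact g x, oact h x)).
  by apply: measurable_fun_pair; exact: oact_measurable.
have := mp measurableT _ (sub_measurable S); rewrite setTI.
by rewrite (_ : _ @^-1` _ = [set x | eqclass S (oact g x) = eqclass S (oact h x)])//;
  apply/seteqP; split=> x /=; rewrite eqclassP.
Qed.

Lemma oelt_act g : exists n, forall x, oact g x = oact (e n) x.
Proof.
have [/Ge[n ->]|gG] := pselect (Gam g); first by exists n.
by have [n nE] := Ge G1; exists n => x; rewrite -nE oact1 oact_id.
Qed.

Lemma oelt1 : exists n, forall x, oact (e n) x = x.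
Proof. by have [n nE] := Ge G1; exists n => x; rewrite -nE oact1. Qed.

Lemma supp_sum : \esum_(g in [set g | nu g != 0%R]) (nu g)%:E = 1.
Proof.
have [_ _ <-] := nuP; rewrite esum_mkcond; apply: eq_esum => g _.
by case: ifPn => // /negP; rewrite inE /= => /negP; rewrite negbK => /eqP ->.
Qed.

Lemma supp_countable : countable [set g | nu g != 0%R].
Proof. by have [] := nuP. Qed.

Lemma nu_ge0 g : (0 <= nu g)%R. Proof. by have [] := nuP. Qed.

Definition orbit_walk : coset_walk mu (full_group R) (set X) :=
  @CosetWalk K d X mu (full_group R) (set X)
    oact (fun g => (g^-1)%g) (fun x => eqclass S x) oorb nu e
    oact_measurable oact_preserves oact_comp oact_inv (@invgK _) oact_word
    oorb_oact oorb_elt ocls_measurable oelt_act oelt1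
    nu_ge0 supp_countable supp_sum (fun g => esym (nuS g)).

Local Notation W := orbit_walk.

Definition point_markov (f : X -> \bar K) (y : X) : \bar K :=
  \esum_(g in [set g | nu g != 0%R]) (nu g)%:E * f (oact g y).

Lemma point_markov_ge0 f : (forall x, 0 <= f x) -> forall x, 0 <= point_markov f x.
Proof.
by move=> f0 x; apply: esum_ge0 => g _; rewrite mule_ge0 ?lee_fin ?nu_ge0.
Qed.

Lemma iter_Lam_markov k F x c :
  iter k (markov_op W) F x c = iter k point_markov (F ^~ c) x.
Proof.
elim: k x => //= k IHk x; apply: eq_esum => g _; by rewrite IHk.
Qed.

Lemma eqclass_domain x y : X0 x -> eqclass R x y -> X0 y.
Proof. by move=> xX /(eqclass_oact xX)[g _ ->]; rewrite oact_domain. Qed.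

Lemma transition_ge0 y z : 0 <= transition nu y z.
Proof. by apply: esum_ge0 => g _; rewrite lee_fin nu_ge0. Qed.

(** After the two sums are exchanged, each group element g contributes at the single point z = g
    y. *)
Lemma esum_transition y (f : X -> \bar K) : X0 y -> (forall z, 0 <= f z) ->
  \esum_(z in eqclass R y) (transition nu y z * f z) = point_markov f y.
Proof.
move=> yX f0; have nu0 := nu_ge0.
transitivity (\esum_(z in eqclass R y) \esum_(g in [set: full_group R])
    (if full_fun g y == z then (nu g)%:E * f z else 0)).
  apply: eq_esum => z _; rewrite muleC /transition esum_mkcond -ge0_esumZl//.
    apply: eq_esum => g _; case: (eqVneq (full_fun g y) z) => [gz|gz].
      by rewrite mem_set// muleC.
    by rewrite memNset ?mule0//= => gz'; rewrite gz' eqxx in gz.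
  by move=> g _; case: ifP => // _; rewrite lee_fin.
rewrite exchange_esum; last by move=> z g; case: ifP => // _; rewrite mule_ge0 ?lee_fin.
rewrite /point_markov [RHS]esum_mkcond; apply: eq_esum => g _.
rewrite (@esum_single _ _ _ _ _ (full_fun g y)).
- rewrite eqxx; case: ifPn => [/asboolP yg|/asboolP yg].
    case: ifPn => [|/negP]; rewrite inE /= => gs.
      by rewrite oactE//; exact: supp_generated.
    by move/negP : gs; rewrite negbK => /eqP ->; rewrite mul0e.
  case: ifPn => //; rewrite inE => gs; exfalso; apply: yg.
  by rewrite -oactE//; [exact: oact_eqclass|exact: supp_generated].
- by move=> z; case: ifP => // _; rewrite mule_ge0 ?lee_fin.
- by move=> z _ zg; case: eqP => // /esym.
Qed.

Lemma walk_ge0 k x z : 0 <= walk nu k x z.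
Proof.
case: k => [|k] /=; first by case: eqP.
elim: k z => [|k IHk] z; apply: esum_ge0 => y _;
  apply: mule_ge0; rewrite ?transition_ge0//; first by rewrite /=; case: eqP.
exact: IHk.
Qed.

(** [walk] appends its new step at the end, so the last step is absorbed into f and the induction
    runs over all f. *)
Lemma esum_walk k x (f : X -> \bar K) : X0 x -> (forall z, 0 <= f z) ->
  \esum_(z in eqclass R x) (walk nu k x z * f z) = iter k point_markov f x.
Proof.
move=> xX; have [Rrefl Rsym Rtr] := pmp_eqrelP R.
elim: k f => [|k IHk] f f0.
  rewrite (@esum_single _ _ _ _ _ x) /=.
  - by rewrite asboolT ?eqxx ?mul1e//; exact: Rrefl.
  - by move=> z; rewrite mule_ge0//; case: eqP.
  - by move=> z _ /eqP/negbTE ->; rewrite mul0e.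
rewrite iterSr -IHk; last exact: point_markov_ge0.
transitivity (\esum_(z in eqclass R x) \esum_(y in eqclass R x)
    (walk nu k x y * (transition nu y z * f z))).
  apply: eq_esum => z _ /=; rewrite muleC -ge0_esumZl//.
    by apply: eq_esum => y _; rewrite muleC muleA.
  by move=> y _; rewrite mule_ge0 ?walk_ge0 ?transition_ge0.
rewrite exchange_esum; last first.
  by move=> z y; rewrite !mule_ge0 ?walk_ge0 ?transition_ge0.
apply: eq_esum => y xy; rewrite ge0_esumZl ?walk_ge0//; last first.
  by move=> z _; rewrite mule_ge0 ?transition_ge0.
congr (_ * _); rewrite -esum_transition//; last exact: eqclass_domain xy.
rewrite (_ : eqclass R x = eqclass R y)//; apply/seteqP; split=> z; last exact: Rtr.
by apply: Rtr; exact: Rsym.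
Qed.

Lemma return_probE k x : X0 x -> return_prob S nu k x = class_return W k x.
Proof.
move=> xX; rewrite /class_return /hit_prob iter_Lam_markov.
rewrite -(esum_walk k xX); last by move=> z; rewrite /diag_part; case: ifP.
rewrite /return_prob esum_mkcond [RHS]esum_mkcond; apply: eq_esum => z _.
rewrite /diag_part /=; case: (eqVneq (eqclass S z) (eqclass S x)) => [/esym zx|zx].
  have xz : eqclass S x z by apply/(eqclassP x z).1.
  have xzR : eqclass R x z by exact: sub_subset xz.
  by rewrite mule1 !mem_set.
rewrite mule0 if_same memNset// => xz; move/eqP : zx; apply.
by apply/esym; exact/(eqclassP x z).2.
Qed.

End orbit_walk.

(** * The cospectral radius in terms of fast return *)

Section radius.
Context (K : realType) d (X : measurableType d).
Context (mu : standard_probability K X) (R : pmp_eqrel mu) (S : sub_eqrel R).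
Variable nu : full_group R -> K.
Hypotheses (nuP : countable_prob nu) (nuS : symmetric_prob nu).
Local Notation Gam := (generated (supp nu)).
Variables (X0 : set X) (e : nat -> full_group R).
Hypotheses (mX0 : measurable X0) (aeX0 : \forall x \ae mu, X0 x).
Hypotheses (X0good : X0 `<=` good_point nu).
Hypotheses (X0G : forall g x, Gam g -> X0 x -> X0 (full_fun g x)).
Hypotheses (Ge : forall g, Gam g -> exists n, g = e n).
Local Notation W := (orbit_walk S nuP nuS mX0 aeX0 X0good X0G Ge).

Let retE k x : X0 x -> return_prob S nu k x = class_return W k x.
Proof. exact: return_probE. Qed.

Lemma ae_cospectral_fun : \forall x \ae mu, exists2 l : K, (0 <= l <= 1)%R &
  cospectral_fun S nu x = l%:E /\
  (fun k => class_return W (2 * k) x `^ (2 * k)%:R^-1) @ \oo --> l%:E.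
Proof.
apply: filterS2 aeX0 (ae_root_cvg W) => x xX [l l01 cl]; exists l => //; split=> //.
rewrite /cospectral_fun (_ : (fun k => _) = fun k => class_return W (2 * k) x `^ (2 * k)%:R^-1).
  exact/cvg_lim.
by apply/funext => k; rewrite retE.
Qed.

Lemma root_ret_le (s : K) k x : (0 < s)%R -> (0 < k)%N ->
  (class_return W (2 * k) x `^ (2 * k)%:R^-1 <= s%:E) =
  (class_return W (2 * k) x <= (s ^+ (2 * k))%:E).
Proof.
move=> s0 k0; have rf := ret_fin_num W (2 * k) x.
rewrite -(fineK rf) poweR_EFin !lee_fin powR_inv_le ?(ltW s0)// ?muln_gt0//.
by rewrite fine_ge0//; exact: hit_ge0.
Qed.

Lemma cospectral_radiusE : cospectral_radius S nu =
  ess_sup mu (fun x => `|cospectral_fun S nu x|).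
Proof.
rewrite /cospectral_radius unlock /= [X in if 0 < X then _ else _](_ : _ = 1) ?lte01//.
exact: probability_setT.
Qed.

(** At almost every point the roots converge to some l in [0, 1]. Fast return at rate s gives l <= s
    there, and conversely l < s gives fast return at rate s from some time on. *)
Lemma cospectral_radius1P : cospectral_radius S nu = 1 <->
  forall s : K, (0 < s < 1)%R -> ~ \forall x \ae mu, exists j, fast W s j x.
Proof.
rewrite cospectral_radiusE; split=> [r1 s /andP[s0 s1] hs|nofast].
  have : ess_sup mu (fun x => `|cospectral_fun S nu x|) <= s%:E.
    apply/ess_supP; apply: filterS2 ae_cospectral_fun hs.
    move=> x [l /andP[l0 l1] [-> cl]] [j hj].
    rewrite /= ger0_norm// lee_fin -lee_fin -(cvg_lim _ cl)//.
    apply: lime_le; first by apply/cvg_ex; exists l%:E.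
    exists (maxn j 1) => // k /=; rewrite geq_max => /andP[jk k1].
    by rewrite root_ret_le//; exact: hj.
  by rewrite r1 lee_fin leNgt s1.
apply/eqP; rewrite eq_le; apply/andP; split.
  apply/ess_supP; apply: filterS ae_cospectral_fun => x [l /andP[l0 l1] [-> _]].
  by rewrite /= ger0_norm.
rewrite leNgt; apply/negP => r1.
have [s [/andP[s0 s1] rs]] : exists s : K, (0 < s < 1)%R /\
    ess_sup mu (fun x => `|cospectral_fun S nu x|) < s%:E.
  move: r1; case: (ess_sup _ _) => [r| |]// r1.
    (* A number strictly between r and 1; the maximum with 1/2 keeps it positive whatever r is. *)
    exists (Num.max 2^-1 ((r + 1) / 2))%R; rewrite lte_fin in r1.
    rewrite lte_fin !lt_max gt_max; split; last by apply/orP; right; lra.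
    by apply/andP; split; [apply/orP; left|apply/andP; split]; lra.
  by exists 2^-1%R; split=> //; [lra|exact: ltNyr].
apply: (nofast s); first by rewrite s0.
apply: filterS2 ae_cospectral_fun (ess_sup_ge mu (fun x => `|cospectral_fun S nu x|)).
move=> x [l /andP[l0 l1] [-> cl]] lr.
have ls : (l < s)%R.
  by rewrite -lte_fin; apply: le_lt_trans rs; apply: le_trans lr; rewrite /= ger0_norm.
have nb : nbhs (l%:E : \bar K) [set y | y < s%:E].
  by apply: open_nbhs_nbhs; split; [exact: open_ereal_lt_ereal|rewrite /= lte_fin].
have [j _ hj] := cl _ nb.
exists (maxn j 1) => k; rewrite geq_max => /andP[jk k1].
by rewrite -root_ret_le//; apply: ltW; exact: hj.
Qed.

End radius.

(** * The two implications *)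

Lemma cvge0_poweR12 (K : realType) (u : nat -> \bar K) : (forall n, 0 <= u n) ->
  u @ \oo --> (0 : \bar K) -> (fun n => u n `^ 2^-1) @ \oo --> (0 : \bar K).
Proof.
move=> u0 /fine_cvgP[fu cu]; apply/fine_cvgP; split.
  by apply: filterS fu => n; exact: fin_num_poweR.
rewrite (_ : _ \o _ = Num.sqrt \o (fine \o u)).
  rewrite -[X in _ --> X]sqrtr0; apply: (cvg_comp _ _ cu); exact: sqrt_continuous.
by apply/funext => n /=; rewrite fine_poweR powR12_sqrt// fine_ge0.
Qed.

Section complex_functions.
Context (K : realType).
Local Notation cplx r := (Complex r 0%R : complex K).

Lemma cabs2_real (r : K) : cabs2 (cplx r) = (r ^+ 2)%:E.
Proof. by rewrite /cabs2 /= expr0n /= addr0 sqr_sqrtr ?sqr_ge0. Qed.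

Lemma cplxB (r s : K) : (cplx r - cplx s = cplx (r - s))%R.
Proof. by apply/eqP; rewrite eq_complex /= subr0 !eqxx. Qed.

Lemma cabs2_ge0 (z : complex K) : 0 <= cabs2 z.
Proof. by rewrite lee_fin sqr_ge0. Qed.

End complex_functions.

(** * Spectral gap for nonnegative functions *)

Section spectral_gap_mean.
Context (K : realType) d (X : measurableType d).
Context (mu : standard_probability K X) (R : pmp_eqrel mu) (S : sub_eqrel R).
Variable nu : full_group R -> K.
Hypotheses (nuP : countable_prob nu) (nuS : symmetric_prob nu).
Local Notation Gam := (generated (supp nu)).
Variables (X0 : set X) (e : nat -> full_group R).
Hypotheses (mX0 : measurable X0) (aeX0 : \forall x \ae mu, X0 x).
Hypotheses (X0good : X0 `<=` good_point nu).
Hypotheses (X0G : forall g x, Gam g -> X0 x -> X0 (full_fun g x)).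
Hypotheses (Ge : forall g, Gam g -> exists n, g = e n).
Local Notation W := (orbit_walk S nuP nuS mX0 aeX0 X0good X0G Ge).
Local Notation cplx r := (Complex r 0%R : complex K).

(** If the means m stay below 1 - eps along infinitely many indices, the centred and normalized
    functions there are almost invariant unit vectors of mean zero. *)
Lemma spectral_gap_mean : spectral_gap Gam -> forall phi : nat -> X -> K,
    (forall n, measurable_fun [set: X] (phi n)) -> (forall n x, 0 <= phi n x)%R ->
    (forall n, \int[mu]_x ((phi n x) ^+ 2)%:E = 1) ->
    (forall g, (fun n => \int[mu]_x ((phi n (act W g x) - phi n x) ^+ 2)%:E) @ \oo -->
       (0 : \bar K)) ->
    (fun n => \int[mu]_x (phi n x)%:E) @ \oo --> (1 : \bar K).
Proof.
move=> gap phi mphi phi0 phi1 Dphi.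
have phiE0 n x : 0 <= (phi n x)%:E by rewrite lee_fin.
have mE n : measurable_fun [set: X] (fun x => (phi n x)%:E) by exact/measurable_EFinP.
have I0 n : 0 <= \int[mu]_x (phi n x)%:E by apply: integral_ge0.
have I1 n : \int[mu]_x (phi n x)%:E <= 1.
  have := @integral_sq1 K d X mu (phi n) (mphi n) (phi0 n) (phi1 n).
  have : 0 <= \int[mu]_x ((1 - phi n x) ^+ 2)%:E.
    by apply: integral_ge0 => x _; rewrite lee_fin sqr_ge0.
  move=> h0 h; have : 2%:E * \int[mu]_x (phi n x)%:E <= 2%:E by rewrite -[leRHS]h leeDr.
  by rewrite -lee_pdivlMl// -EFinM mulVf.
pose m n := fine (\int[mu]_x (phi n x)%:E).
have mEq n : \int[mu]_x (phi n x)%:E = (m n)%:E by rewrite fineK// fin_num01.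
have m0 n : (0 <= m n)%R by rewrite -lee_fin -mEq.
have m1 n : (m n <= 1)%R by rewrite -lee_fin -mEq.
apply: contrapT => nc.
have [eps [eps0 heps]] : exists eps : K, (0 < eps)%R /\
    forall N, exists n, (N <= n)%N /\ (m n < 1 - eps)%R.
  apply: contrapT => ne; apply: nc.
  rewrite (_ : (fun n => _) = EFin \o m); last by apply/funext => n; rewrite mEq.
  suff cm : m @ \oo --> (1 : K)%R by exact: cvg_comp cm _.
  apply/cvgrPdist_le => eps eps0; apply: contrapT => nn; apply: ne; exists eps.
  split=> // N; apply: contrapT => hN; apply: nn; exists N => // n /= Nn.
  rewrite ger0_norm ?subr_ge0// lerBlDl -lerBlDr leNgt; apply/negP => h.
  by apply: hN; exists n.
have /choice[v hv] := heps.
have vj j : (j <= v j)%N by case: (hv j).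
have mv j : (m (v j) < 1 - eps)%R by case: (hv j).
(* The centred function has squared norm 1 - m^2. Since m^2 <= m < 1 - eps, this is at least eps, so
   normalization costs at most a factor eps^-1 in squared distances. *)
pose a j := ((Num.sqrt (1 - m (v j) ^+ 2))^-1)%R.
have m2 j : (eps <= 1 - m (v j) ^+ 2)%R.
  have := mv j; have := m0 (v j); have := m1 (v j); set q := m _ => q1 q0 qe.
  have : (q ^+ 2 <= q)%R by rewrite expr2 ler_piMr.
  by lra.
have m2p j : (0 < 1 - m (v j) ^+ 2)%R by exact: lt_le_trans (m2 j).
have a2 j : (a j ^+ 2 = (1 - m (v j) ^+ 2)^-1)%R.
  by rewrite /a exprVn sqr_sqrtr ?(ltW (m2p j)).
have a0 j : (0 < a j)%R by rewrite invr_gt0 sqrtr_gt0.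
pose h j x := (a j * (phi (v j) x - m (v j)))%R.
have mh j : measurable_fun [set: X] (h j).
  by apply: measurable_funM => //; apply: measurable_funB.
have vh j : \int[mu]_x ((h j x) ^+ 2)%:E = 1.
  have msq : measurable_fun [set: X] (fun x => ((phi (v j) x - m (v j)) ^+ 2)%:E).
    by apply/measurable_EFinP/measurable_funX/measurable_funB.
  have -> : \int[mu]_x ((h j x) ^+ 2)%:E =
      (a j ^+ 2)%:E * \int[mu]_x ((phi (v j) x - m (v j)) ^+ 2)%:E.
    rewrite -ge0_integralZl_EFin ?sqr_ge0//; last by move=> x _; rewrite lee_fin sqr_ge0.
    by apply: eq_integral => x _; rewrite /h exprMn EFinM.
  have : \int[mu]_x ((phi (v j) x - m (v j)) ^+ 2)%:E +
      (2 * m (v j))%:E * \int[mu]_x (phi (v j) x)%:E =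
      \int[mu]_x (cst (m (v j) ^+ 2)%:E x) + \int[mu]_x ((phi (v j) x) ^+ 2)%:E.
    have mp2 : measurable_fun [set: X] (fun x => ((phi (v j) x) ^+ 2)%:E).
      exact/measurable_EFinP/measurable_funX.
    rewrite -ge0_integralZl_EFin ?mulr_ge0//.
    rewrite -!ge0_integralD//; try by move=> x _; rewrite ?lee_fin ?sqr_ge0 ?mulr_ge0.
      by apply: eq_integral => x _; rewrite -EFinM -!EFinD; congr EFin; ring.
    exact: emeasurable_funM.
  rewrite phi1 mEq integral_cst// [X in _ * X + _](_ : _ = 1); last exact: probability_setT.
  rewrite mule1 -EFinM -EFinD.
  have : 0 <= \int[mu]_x ((phi (v j) x - m (v j)) ^+ 2)%:E.
    by apply: integral_ge0 => x _; rewrite lee_fin sqr_ge0.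
  move: (\int[mu]_x _) => [D| |]//= _ [DE].
  rewrite a2 -EFinM; congr EFin.
  have -> : D = (1 - m (v j) ^+ 2)%R by rewrite expr2 in DE *; lra.
  by rewrite mulVf// gt_eqF.
have iphi n : mu.-integrable [set: X] (EFin \o phi n).
  apply/integrableP; split; first exact: mE.
  apply: (@le_lt_trans _ _ (\int[mu]_x (phi n x)%:E)); last by rewrite mEq ltry.
  by rewrite le_eqVlt; apply/orP; left; apply/eqP/eq_integral => x _; rewrite /= ger0_norm.
have ih j : \int[mu]_x (h j x)%:E = 0.
  have -> : \int[mu]_x (h j x)%:E =
      \int[mu]_x ((a j)%:E * ((EFin \o phi (v j)) x - (EFin \o cst (m (v j))) x)).
    by apply: eq_integral => x _; rewrite /= -EFinB -EFinM.
  have ic := finite_measure_integrable_cst mu (m (v j)) (@measurableT _ X).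
  have E1 : \int[mu]_x (EFin \o phi (v j)) x = (m (v j))%:E by exact: mEq.
  have E2 : \int[mu]_x (EFin \o cst (m (v j))) x = (m (v j))%:E.
    transitivity (\int[mu]_x (cst (m (v j))%:E x)) => //.
    by rewrite integral_cst// [X in _ * X](_ : _ = 1) ?mule1//; exact: probability_setT.
  have iB := integrableB measurableT (iphi (v j)) ic.
  rewrite (integralZl measurableT iB) (integralB measurableT (iphi (v j)) ic).
  by rewrite E1 E2 subee// mule0.
apply: gap; exists (fun j x => cplx (h j x)).
have cab j : \int[mu]_x cabs2 (cplx (h j x)) = 1.
  by rewrite -(vh j); apply: eq_integral => x _; rewrite cabs2_real.
split=> [j|j|g gG].
- split; first split.
  + by split; [exact: mh|rewrite (_ : _ \o _ = cst 0%R)].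
  + by rewrite /L2norm cab poweR1r ltry.
  + exact: ih.
  + by rewrite integral0.
- by rewrite /L2norm cab poweR1r.
apply: cvge0_poweR12; first by move=> j; apply: integral_ge0 => x _; exact: cabs2_ge0.
(* The Koopman operator moves points by the chosen representative of g^-1, which agrees with the
   corrected action on [X0]. *)
have DE j : \int[mu]_x cabs2 (koopman g (fun x => cplx (h j x)) x - cplx (h j x))%R =
    (a j ^+ 2)%:E * \int[mu]_x ((phi (v j) (act W (g^-1)%g x) - phi (v j) x) ^+ 2)%:E.
  have mg : measurable_fun [set: X] (fun x =>
      ((phi (v j) (act W (g^-1)%g x) - phi (v j) x) ^+ 2)%:E).
    apply/measurable_EFinP/measurable_funX/measurable_funB => //.
    exact: (measurableT_comp (mphi _) (act_measurable W _)).
  rewrite -ge0_integralZl_EFin ?sqr_ge0//; last by move=> x _; rewrite lee_fin sqr_ge0.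
  apply: ge0_ae_eq_integral => //.
  - rewrite (_ : (fun x => _) = fun x => ((h j (full_fun (g^-1)%g x) - h j x) ^+ 2)%:E).
      apply/measurable_EFinP/measurable_funX/measurable_funB => //.
      exact: (measurableT_comp (mh _) (full_measurable _)).
    by apply/funext => x; rewrite /koopman cplxB cabs2_real.
  - by apply: emeasurable_funM.
  - by move=> x _; exact: cabs2_ge0.
  - by move=> x _; rewrite mule_ge0 ?lee_fin ?sqr_ge0.
  apply: filterS aeX0 => x xX _; rewrite /koopman cplxB cabs2_real.
  have [_ _ GV] := generated_subgroup (supp nu).
  rewrite /= oactE//; last exact: GV.
  by rewrite -EFinM -exprMn; congr EFin; congr (_ ^+ 2)%R; rewrite /h; ring.
rewrite (_ : (fun j => _) = fun j => (a j ^+ 2)%:E *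
  \int[mu]_x ((phi (v j) (act W (g^-1)%g x) - phi (v j) x) ^+ 2)%:E); last first.
  by apply/funext => j; exact: DE.
have cv : (fun j => \int[mu]_x ((phi (v j) (act W (g^-1)%g x) - phi (v j) x) ^+ 2)%:E)
    @ \oo --> (0 : \bar K).
  apply: (cvg_comp _ _ _ (Dphi (g^-1)%g)) => A [N _ hN]; exists N => // j Nj.
  by apply: hN; exact: leq_trans (vj j).
have cv2 : (fun j => (eps^-1)%:E *
    \int[mu]_x ((phi (v j) (act W (g^-1)%g x) - phi (v j) x) ^+ 2)%:E)
    @ \oo --> (0 : \bar K).
  by rewrite -[X in _ --> X](mule0 (eps^-1)%:E); apply: cvgeZl.
apply: (squeeze_cvge _ (cvg_cst 0) cv2); apply: nearW => j.
have I j0 : 0 <= \int[mu]_x ((phi (v j0) (act W (g^-1)%g x) - phi (v j0) x) ^+ 2)%:E.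
  by apply: integral_ge0 => x _; rewrite lee_fin sqr_ge0.
rewrite mule_ge0 ?lee_fin ?sqr_ge0//= lee_wpmul2r// lee_fin a2.
by rewrite lef_pV2 ?posrE.
Qed.

End spectral_gap_mean.

(** * Borel functions on the coset space, read along group elements *)

Section coset_functions_measurable.
Context (K : realType) d (X : measurableType d).
Context (mu : standard_probability K X) (R : pmp_eqrel mu) (S : sub_eqrel R).
Variable nu : full_group R -> K.
Hypotheses (nuP : countable_prob nu) (nuS : symmetric_prob nu).
Local Notation Gam := (generated (supp nu)).
Variables (X0 : set X) (e : nat -> full_group R).
Hypotheses (mX0 : measurable X0) (aeX0 : \forall x \ae mu, X0 x).
Hypotheses (X0good : X0 `<=` good_point nu).
Hypotheses (X0G : forall g x, Gam g -> X0 x -> X0 (full_fun g x)).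
Hypotheses (Ge : forall g, Gam g -> exists n, g = e n).
Local Notation W := (orbit_walk S nuP nuS mX0 aeX0 X0good X0G Ge).

Definition real_fibre (u : coset_space S -> K) (x : X) (c : set X) : K :=
  if pselect (quotient_class S x c) is left h then u (Coset h) else 0%R.

Lemma normc_fibre (xi : coset_space S -> complex K) x c :
  Normc.normc (fibre xi x c) = real_fibre (fun p => Normc.normc (xi p)) x c.
Proof.
by rewrite /fibre /real_fibre; case: pselect => // _; rewrite /= expr0n /= addr0 sqrtr0.
Qed.

Lemma measurable_normc (xi : coset_space S -> complex K) : cmeasurable xi ->
  measurable_fun [set: coset_space S] (fun p => Normc.normc (xi p)).
Proof.
move=> [mr mi].
rewrite (_ : (fun p => _) = Num.sqrt \o (fun p =>
    (complex.Re (xi p) ^+ 2 + complex.Im (xi p) ^+ 2)%R)); last first.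
  by apply/funext => p /=; case: (xi p).
apply: measurableT_comp.
  by apply: continuous_measurable_fun; exact: sqrt_continuous.
by apply: measurable_funD; apply: measurable_funX.
Qed.

(** Over [X0], the preimage of a Borel set is a [coset_graph] along g, whose measurability is the
    definition of the Borel structure on R/S. *)
Lemma measurable_real_fibre (u : coset_space S -> K) g :
  measurable_fun [set: coset_space S] u ->
  measurable_fun [set: X] (fun x => if `[< X0 x >]
    then real_fibre u x (eqclass S (oact nu X0 g x)) else 0%R).
Proof.
move=> mu_; wlog gG : g / Gam g.
  move=> wl; have [gG|gG] := pselect (Gam g); first exact: wl.
  have [G1 _ _] := generated_subgroup (supp nu).
  rewrite (_ : oact nu X0 g = oact nu X0 1%g); first exact: wl.
  by apply/funext => x; rewrite oact_id// (oact1 X0good).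
move=> _ B mB; rewrite setTI.
rewrite (_ : _ @^-1` B = (X0 `&` coset_graph (repr g) (u @^-1` B)) `|`
    (~` X0 `&` (if `[< B 0%R >] then setT else set0))).
  apply: measurableU; apply: measurableI => //.
  - by have := mu_ measurableT _ mB; rewrite setTI; apply.
  - exact: measurableC.
  - by case: ifP.
apply/seteqP; split=> x /=.
  case: asboolP => xX; last by move=> B0; right; split=> //; rewrite asboolT.
  rewrite /real_fibre; case: pselect => [h Bu|nh]; last first.
    by exfalso; apply: nh; apply: eqclass_quotient; exact: (oact_eqclass X0good).
  by left; split=> //; exists (Coset h) => //=; split=> //; rewrite oactE.
case=> [[xX [p Bp [px pc]]]|[xX]]; last first.
  by case: asboolP => // B0 _; rewrite asboolF.
rewrite asboolT// oactE// -/(full_fun g x) -pc -px /real_fibre.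
case: pselect => [h|nh]; last by exfalso; apply: nh; exact: coset_in.
by rewrite (_ : Coset h = p)//; exact: coset_space_inj.
Qed.

End coset_functions_measurable.

Section preliminaries.
Context (K : realType).

(** The integral of a nonnegative function is the supremum over the simple functions below it, so
    monotonicity is available for the counting functions in [mu_R] and [mu_RS]. *)
Lemma le_ge0_integral d (X : measurableType d) (mu : {measure set X -> \bar K})
    (f h : X -> \bar K) : (forall x, 0 <= f x) -> (forall x, f x <= h x) ->
  \int[mu]_x f x <= \int[mu]_x h x.
Proof.
move=> f0 fh; have h0 x : 0 <= h x by exact: le_trans (fh x).
rewrite !ge0_integralTE//; apply: le_ereal_sup => _ [u uf <-].
by exists u => // x; exact: le_trans (fh x).
Qed.

Lemma counting_ge1 (T : choiceType) (A : set T) : A !=set0 -> 1 <= counting A :> \bar K.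
Proof.
move=> [a Aa]; rewrite /counting; case: asboolP => [fA|_]; last exact: leey.
rewrite lee_fin ler1n lt0n cardfs_eq0; apply/eqP => A0.
have : a \in fset_set A by rewrite in_fset_set// inE.
by rewrite A0 finmap.inE.
Qed.

Lemma poweR12M (u : \bar K) : 0 <= u -> u `^ 2^-1 * u `^ 2^-1 = u.
Proof.
case: u => [r| |]// r0; last by rewrite poweRyr// mulyy.
by rewrite poweR_EFin -EFinM powR12_sqrt// -expr2 sqr_sqrtr.
Qed.

Lemma poweR12_eq1 (u : \bar K) : 0 <= u -> u `^ 2^-1 = 1 -> u = 1.
Proof. by move=> u0 u1; rewrite -(poweR12M u0) u1 mule1. Qed.

Lemma cvge0_sqr (u : nat -> \bar K) : (forall n, 0 <= u n) ->
  (fun n => u n `^ 2^-1) @ \oo --> (0 : \bar K) -> u @ \oo --> (0 : \bar K).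
Proof.
move=> u0 cu; rewrite (_ : u = fun n => u n `^ 2^-1 * u n `^ 2^-1); last first.
  by apply/funext => n; rewrite poweR12M.
by rewrite -[X in _ --> X](mule0 (0 : \bar K)); apply: cvgeM.
Qed.

Lemma le_esum_term (T : choiceType) (D : set T) (a : T -> \bar K) i :
  D i -> a i <= \esum_(j in D) a j.
Proof.
move=> Di; apply: esum_ge; exists [set i]; first by split=> // _ ->.
by rewrite fsbig_set1.
Qed.

Lemma normc_ge0 (a : complex K) : (0 <= Normc.normc a)%R.
Proof. by case: a => x y; rewrite /= sqrtr_ge0. Qed.

Lemma normc_dist (a b : complex K) :
  ((Normc.normc a - Normc.normc b) ^+ 2)%:E <= cabs2 (b - a)%R.
Proof.
have h1 := le_normcD (a - b)%R b; have h2 := le_normcD (b - a)%R a.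
rewrite subrK in h1; rewrite subrK in h2.
have E : Normc.normc (a - b)%R = Normc.normc (b - a)%R by rewrite -normcN opprB.
rewrite E in h1.
rewrite lee_fin -[X in (X <= _)%R](real_normK (num_real _)) ler_sqr ?nnegrE ?normc_ge0//.
by rewrite ler_norml; apply/andP; split; lra.
Qed.

End preliminaries.


(** * Coamenability forces radius 1 *)

Section almost_invariant_fibres.
Context (K : realType) d (X : measurableType d).
Context (mu : standard_probability K X) (R : pmp_eqrel mu) (S : sub_eqrel R).
Variable nu : full_group R -> K.
Hypotheses (nuP : countable_prob nu) (nuS : symmetric_prob nu).
Local Notation Gam := (generated (supp nu)).
Variables (X0 : set X) (e : nat -> full_group R).
Hypotheses (mX0 : measurable X0) (aeX0 : \forall x \ae mu, X0 x).
Hypotheses (X0good : X0 `<=` good_point nu).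
Hypotheses (X0G : forall g x, Gam g -> X0 x -> X0 (full_fun g x)).
Hypotheses (Ge : forall g, Gam g -> exists n, g = e n).
Local Notation W := (orbit_walk S nuP nuS mX0 aeX0 X0good X0G Ge).


(** Where the graph of g meets a [mu_R]-null set, the fibre of that set has at least one point, so
    the set of such x has measure at most 0. *)
Lemma mu_R_ae (P : set (X * X)) g : almost_everywhere (mu_R R) P ->
  \forall x \ae mu, P (x, oact nu X0 g x).
Proof.
move=> [N [mN N0 PN]]; pose B := X0 `&` [set x | N (x, oact nu X0 g x)].
have mB : measurable B.
  apply: measurableI => //.
  have mp : measurable_fun [set: X] (fun x => (x, oact nu X0 g x)).
    by apply: measurable_fun_pair; [exact: measurable_id|exact: oact_measurable].
  by have := mp measurableT _ mN; rewrite setTI.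
have B0 : mu B = 0.
  apply/eqP; rewrite eq_le measure_ge0 andbT -N0 /mu_R -(setIT B) -integral_indic//.
  apply: le_ge0_integral => x; first by rewrite lee_fin.
  rewrite indicE; case: (boolP (x \in B)) => [|_]; last first.
    rewrite /counting; case: ifP => _; last exact: leey.
    by rewrite lee_fin ler0n.
  rewrite inE => -[xX Bx]; apply: counting_ge1; exists (oact nu X0 g x); split=> //.
  exact: (oact_eqclass X0good).
have aeB : \forall x \ae mu, ~ B x by exists B; split=> // x /= /contrapT.
apply: filterS2 aeX0 aeB => x xX nB; apply: contrapT => nP; apply: nB; split=> //.
exact: PN.
Qed.

Lemma coamenable_cospectral_radius : coamenable S -> cospectral_radius S nu = 1.
Proof.
move=> [xi [xiL2 xi1 xiR]]; apply/(cospectral_radius1P S nuP nuS mX0 aeX0 X0good X0G Ge).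
move=> s s01 aefast.
(* The entries of a unit fibre have modulus at most 1, so the cutoffs change nothing almost
   everywhere and make the bounds hold at every point. *)
pose H n x c : K := if `[< X0 x >] then Num.min 1%R (Normc.normc (fibre (xi n) x c)) else 0%R.
have H0 n x c : (0 <= H n x c)%R.
  by rewrite /H; case: ifP => // _; rewrite le_min ler01 normc_ge0.
have H1 n x c : (H n x c <= 1)%R.
  by rewrite /H; case: ifP => // _; rewrite ge_min lexx.
have unit_fibre : \forall x \ae mu, forall n,
    \esum_(c in quotient_class S x) cabs2 (fibre (xi n) x c) = 1.
  apply: ae_foralln => n; apply: filterS (xi1 n) => x; apply: poweR12_eq1.
  by apply: esum_ge0 => c _; exact: cabs2_ge0.
have HE x : X0 x -> (forall n, \esum_(c in quotient_class S x) cabs2 (fibre (xi n) x c) = 1) ->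
    forall n c, quotient_class S x c -> H n x c = Normc.normc (fibre (xi n) x c).
  move=> xX x1 n c xc; rewrite /H asboolT//; apply/min_idPr.
  have := le_esum_term (fun c => cabs2 (fibre (xi n) x c)) xc.
  by rewrite x1 lee_fin -[X in (_ <= X)%R -> _](expr1n _ 2) ler_sqr ?nnegrE ?normc_ge0.
have sqE x : X0 x -> (forall n, \esum_(c in quotient_class S x) cabs2 (fibre (xi n) x c) = 1) ->
    forall n, fibre_sqnorm W (H n) x = 1.
  move=> xX x1 n; rewrite -(x1 n) /fibre_sqnorm /= /oorb asboolT//.
  by apply: eq_esum => c xc; rewrite (HE x).
apply: (@almost_invariant_no_fast_return _ _ _ _ _ _ W s (fun n => efun (H n))) => //.
- move=> n; split=> [x c|g]; first by rewrite lee_fin.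
  apply/measurable_EFinP.
  rewrite (_ : (fun x => _) = fun x => Num.min (if `[< X0 x >] then
    real_fibre (fun p => Normc.normc (xi n p)) x (eqclass S (oact nu X0 g x)) else 0%R) 1%R).
    apply: measurable_funX || apply: measurable_minr => //.
    apply: (measurable_real_fibre mX0 X0good).
    exact/measurable_normc/(xiL2 n).1.
  apply/funext => x; rewrite /H normc_fibre; case: ifP => _; first by rewrite minC.
  by rewrite /Num.min ltr01.
- by move=> n x c; rewrite !lee_fin H0 H1.
- move=> n; apply: filterS2 aeX0 unit_fibre => x xX x1.
  rewrite -(sqE x xX x1 n) /fibre_sqnorm; apply: eq_esum => c _.
  by rewrite /efun -EFinM -expr2.
- move=> g; have ug := ae_act W g unit_fibre.
  have cg := mu_R_ae g xiR.
  have aeX0u : \forall x \ae mu, X0 x /\ forall n,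
      \esum_(c in quotient_class S x) cabs2 (fibre (xi n) x c) = 1.
    exact: filterS2 aeX0 unit_fibre.
  apply: filterS3 aeX0u ug cg => x [xX x1] gx1 /= cgx.
  have gxX : X0 (oact nu X0 g x) by apply/(oact_domain X0G).
  have qE : quotient_class S (oact nu X0 g x) = quotient_class S x.
    exact: (quotient_class_oact S X0good).
  have sq0 : (fun n => sqdist W (H n) (act W g x) x) @ \oo --> (0 : \bar K).
    have c0 : (fun n => \esum_(c in quotient_class S x)
        cabs2 (fibre (xi n) x c - fibre (xi n) (oact nu X0 g x) c)%R) @ \oo --> (0 : \bar K).
      apply: cvge0_sqr; last exact: cgx (oact_eqclass X0good g xX).
      by move=> n; apply: esum_ge0 => c _; exact: cabs2_ge0.
    apply: (squeeze_cvge _ (cvg_cst 0) c0).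
    apply: nearW => n; rewrite sqdist_ge0 /= /sqdist /= {1}/oorb asboolT//.
    apply: le_esum => c xc; rewrite (HE x)// (HE (oact nu X0 g x))//; last by rewrite qE.
    exact: normc_dist.
  (* For unit fibres the correlation is 1 minus half the squared distance. *)
  have crossE n : \esum_(c in orb W x) (efun (H n) (act W g x) c * efun (H n) x c) =
      1 - (2^-1)%:E * sqdist W (H n) (act W g x) x.
    have := sqdist_cross (H0 n) (orb_act W g x).
    rewrite !sqE// -/(efun _ _ _) => E.
    have S0 := sqdist_ge0 W (H n) (act W g x) x.
    have C0 : 0 <= \esum_(c in orb W x) (efun (H n) (act W g x) c * efun (H n) x c).
      by apply: esum_ge0 => c _; rewrite mule_ge0// lee_fin.
    move: E S0 C0; rewrite /efun; move: (sqdist _ _ _ _) => A; move: (\esum_(c in _) _) => B.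
    have y2 : 2%:E * +oo = +oo :> \bar K by rewrite gt0_muley// lte_fin.
    case: A => [a| |]; case: B => [b| |]//=; rewrite ?y2//.
    by rewrite -!EFinM -EFinB => -[E] _ _; congr EFin; lra.
  suff : (fun n => \esum_(c in orb W x) (efun (H n) (act W g x) c * efun (H n) x c)) @ \oo
      --> (1 : \bar K) by [].
  rewrite (funext crossE) -[X in _ --> X]sube0; apply: cvgeB => //; first exact: cvg_cst.
  by rewrite -[X in _ --> X](mule0 (2^-1)%:E); apply: cvgeZl.
Qed.

End almost_invariant_fibres.

Section preliminaries.
Context (K : realType).

(** A simple function below f may be cut down to the conull set Y, where it lies below h, without
    changing its integral. *)
Lemma ae_le_ge0_integral d (X : measurableType d) (mu : {measure set X -> \bar K})
    (Y : set X) (f h : X -> \bar K) : measurable Y -> (\forall x \ae mu, Y x) ->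
  (forall x, 0 <= f x) -> (forall x, 0 <= h x) -> (forall x, Y x -> f x <= h x) ->
  \int[mu]_x f x <= \int[mu]_x h x.
Proof.
move=> mY aeY f0 h0 fh; rewrite ge0_integralTE//; apply: ge_ereal_sup => _ [u uf <-].
rewrite -integralT_nnsfun.
rewrite (ge0_ae_eq_integral (g := fun x => (u x * \1_Y x)%:E))//.
- apply: le_ge0_integral => x; first by rewrite lee_fin mulr_ge0.
  rewrite indicE; case: (boolP (x \in Y)); last by rewrite mulr0.
  by rewrite inE mulr1 => /fh; apply: le_trans; exact: uf.
- exact/measurable_EFinP.
- by apply/measurable_EFinP/measurable_funM => //; exact: measurable_indic.
- by move=> x _; rewrite lee_fin.
- by move=> x _; rewrite lee_fin mulr_ge0.
- by apply: filterS aeY => x xY _; rewrite indicE mem_set// mulr1.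
Qed.

Lemma counting_le_esum (T : choiceType) (A : set T) :
  counting A <= \esum_(i in A) 1 :> \bar K.
Proof.
rewrite /counting; case: asboolP => fA.
  apply: esum_ge; exists A; first by split=> // i.
  by rewrite fsbig_finite//= (sumEFin _ _ (fun=> 1%R)) big_const_seq count_predT iter_addr_0.
suff -> : \esum_(i in A) (1 : \bar K) = +oo by [].
apply/eqyP => r r0; have [B BA rB] := infinite_set_fset (Num.truncn r).+1 fA.
apply: esum_ge; exists [set` B]; first by split.
rewrite fsbig_finite//= set_fsetK (sumEFin _ _ (fun=> 1%R)) lee_fin.
rewrite big_const_seq count_predT iter_addr_0.
apply: (le_trans (ltW (truncnS_gt r))); rewrite ler_nat.
exact: leq_trans rB _.
Qed.

(** The bound is checked on simple functions one at a time, level set by level set, so it applies to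
    a bare set function such as [mu_RS]. *)
Lemma le_raw_integral d (T : measurableType d) (m : set T -> \bar K) (f : T -> \bar K)
    (b : \bar K) : m set0 = 0 -> (forall A, 0 <= m A) -> (forall x, 0 <= f x) ->
  (forall u : {nnsfun T >-> K}, (forall x, (u x)%:E <= f x) ->
     \sum_(r <- fset_set (range u)) (r%:E * m (u @^-1` [set r])) <= b) ->
  \int[m]_x f x <= b.
Proof.
move=> m0 mge0 f0 ub.
have sE (u : {nnsfun T >-> K}) : sintegral m u =
    \sum_(r <- fset_set (range u)) (r%:E * m (u @^-1` [set r])).
  rewrite /sintegral -fsbig_finite//; apply/esym/fsbig_widen => // r [_ nr] /=.
  rewrite (_ : _ @^-1` _ = set0) ?m0 ?mule0//.
  by apply/seteqP; split=> x //= xr; apply: nr; exists x.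
have sge0 (u : {nnsfun T >-> K}) : 0 <= sintegral m u.
  rewrite sE big_seq; apply: sume_ge0 => r.
  by rewrite in_fset_set// inE => -[x _ <-]; rewrite mule_ge0// lee_fin.
rewrite /integral patch_setT.
have -> : f ^\+ = f by apply/funext => x; rewrite (@ge0_funeposE _ _ [set: T]) ?inE.
apply: (@le_trans _ _ (ereal_sup [set sintegral m u |
    u in [set u : {nnsfun T >-> K} | forall x, (u x)%:E <= f x]])).
  apply: geeDl; rewrite oppe_le0; apply: le_trans (sge0 (@nnsfun0 _ T K)) _.
  apply: ereal_sup_ubound; exists (@nnsfun0 _ T K) => // x /=.
  exact: funeneg_ge0.
by apply: ge_ereal_sup => _ [u uf <-]; rewrite sE; exact: ub.
Qed.

End preliminaries.


(** * Vectors of L^2(R/S) built from fibre functions *)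

Section coset_vectors.
Context (K : realType) d (X : measurableType d).
Context (mu : standard_probability K X) (R : pmp_eqrel mu) (S : sub_eqrel R).
Variable nu : full_group R -> K.
Hypotheses (nuP : countable_prob nu) (nuS : symmetric_prob nu).
Local Notation Gam := (generated (supp nu)).
Variables (X0 : set X) (e : nat -> full_group R).
Hypotheses (mX0 : measurable X0) (aeX0 : \forall x \ae mu, X0 x).
Hypotheses (X0good : X0 `<=` good_point nu).
Hypotheses (X0G : forall g x, Gam g -> X0 x -> X0 (full_fun g x)).
Hypotheses (Ge : forall g, Gam g -> exists n, g = e n).
Local Notation W := (orbit_walk S nuP nuS mX0 aeX0 X0good X0G Ge).
Local Notation cplx r := (Complex r 0%R : complex K).

Lemma mu_RS0 : mu_RS (S := S) set0 = 0.
Proof.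
rewrite /mu_RS; under eq_integral => x _.
  rewrite [X in counting X](_ : _ = set0); last by apply/seteqP; split=> c // [].
  rewrite (_ : counting set0 = 0); last by rewrite /counting asboolT// fset_set0.
  over.
by rewrite integral0.
Qed.

Lemma counting_ge0 (T : choiceType) (A : set T) : 0 <= counting A :> \bar K.
Proof. by rewrite /counting; case: ifP => _ //; rewrite lee_fin ler0n. Qed.

Lemma mu_RS_ge0 A : 0 <= mu_RS (S := S) A.
Proof. by apply: integral_ge0 => x _; exact: counting_ge0. Qed.

(** Off [X0] admissibility controls H at the class of x only, hence the value 0 there. *)
Definition coset_vector (H : X -> set X -> K) (p : coset_space S) : complex K :=
  cplx (if `[< X0 (coset_pt p) >] then H (coset_pt p) (coset_cls p) else 0%R).

(** Borel sets are tested along arbitrary representatives g of the full group, while H is measurable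
    along the enumerated elements. [X0] is covered by the sets where g agrees with the n-th of
    them. *)
Lemma cmeasurable_coset_vector H : adm W (efun H) -> cmeasurable (coset_vector H).
Proof.
move=> aH; split; last by rewrite (_ : _ \o _ = cst 0%R).
move=> _ B mB; rewrite setTI.
suff mB' : coset_borel ((@complex.Re K \o coset_vector H) @^-1` B) by exact: mB'.
move=> g.
have -> : coset_graph g ((@complex.Re K \o coset_vector H) @^-1` B) =
   (X0 `&` \bigcup_n ([set x | g x = oact nu X0 (e n) x] `&`
      [set x | B (H x (eqclass S (oact nu X0 (e n) x)))])) `|`
   (~` X0 `&` ([set x | eqclass R x (g x)] `&` (if `[< B 0%R >] then setT else set0))).
  apply/seteqP; split=> x.
    move=> [p Bp [px pc]]; move: Bp; rewrite /coset_vector /= px pc.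
    have Rg : eqclass R x (g x).
      by apply: (@quotient_eqclass _ _ _ _ _ S); rewrite -pc; move: (coset_in p); rewrite px.
    case: asboolP => xX BH; last by right; split=> //; split=> //=; rewrite asboolT.
    have [h hG gE] := eqclass_oact X0good xX Rg; have [n hE] := Ge hG.
    by left; split=> //; exists n => //; rewrite -hE; split=> //=; rewrite -gE.
  case=> [[xX [n _ [/= gE BH]]]|[xX [Rg]]].
    have Rg : eqclass R x (g x) by rewrite gE; exact: (oact_eqclass X0good).
    by exists (Coset (eqclass_quotient S Rg)) => //; rewrite /coset_vector /= asboolT// gE.
  case: asboolP => // B0 _.
  by exists (Coset (eqclass_quotient S Rg)) => //; rewrite /coset_vector /= asboolF.
apply: measurableU; apply: measurableI => //.
- apply: bigcupT_measurable => n; apply: measurableI.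
    have mp : measurable_fun [set: X] (fun x => (g x, oact nu X0 (e n) x)).
      by apply: measurable_fun_pair; [exact: rep_measurable|exact: oact_measurable].
    by have := mp measurableT _ (measurable_diagonal mu); rewrite setTI.
  have mH : measurable_fun [set: X] (fun x => H x (eqclass S (oact nu X0 (e n) x))).
    by apply/measurable_EFinP; exact: aH.2 (e n).
  by have := mH measurableT _ mB; rewrite setTI.
- exact: measurableC.
- apply: measurableI; last by case: ifP.
  by apply: measurable_eqclass_rep; [exact: pmp_measurable|exact: rep_measurable].
Qed.

Definition domain_fibre (u : coset_space S -> K) x c : K :=
  if `[< X0 x >] then real_fibre u x c else 0%R.

Lemma domain_fibre_ge0 u x c : (forall p, 0 <= u p)%R -> (0 <= domain_fibre u x c)%R.
Proof.
by move=> u0; rewrite /domain_fibre /real_fibre; case: ifP => // _; case: pselect.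
Qed.

Lemma adm_domain_fibre (u : coset_space S -> K) :
  measurable_fun [set: coset_space S] u -> (forall p, 0 <= u p)%R ->
  adm W (efun (domain_fibre u)).
Proof.
move=> mu_ u0; split=> [x c|g]; first by rewrite lee_fin domain_fibre_ge0.
by apply/measurable_EFinP; exact: (measurable_real_fibre mX0 X0good g mu_).
Qed.

Lemma mu_RS_le_tot A : measurable A ->
  mu_RS A <= tot W (efun (domain_fibre \1_A)).
Proof.
move=> mA; apply: (ae_le_ge0_integral mX0 aeX0).
- by move=> x; exact: counting_ge0.
- by move=> x; apply: esum_ge0 => c _; rewrite lee_fin domain_fibre_ge0.
move=> x xX; apply: (le_trans (counting_le_esum _ _)).
rewrite esum_mkcond [leRHS]esum_mkcond; apply: le_esum => c _.
case: ifPn => [|_]; last by case: ifP => // _; rewrite lee_fin domain_fibre_ge0.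
rewrite inE => -[p Ap [px pc]].
have xc : quotient_class S x c by rewrite -px -pc; exact: coset_in.
rewrite mem_set; last by rewrite /= /oorb asboolT.
rewrite /efun /domain_fibre asboolT// /real_fibre; case: pselect => // h.
rewrite (_ : Coset h = p); last exact: coset_space_inj.
by rewrite indicE mem_set.
Qed.

(** A simple function below the squared modulus is compared level by level with fibre sums; these
    are then added under a genuine integral over X. *)
Lemma L2norm_coset_vector H : adm W (efun H) -> tot W (fun x c => ((H x c) ^+ 2)%:E) < +oo ->
  L2norm (@mu_RS _ _ _ _ _ S) (coset_vector H) < +oo.
Proof.
move=> aH Hoo; apply: poweR_lty; apply: le_lt_trans Hoo.
apply: le_raw_integral.
- exact: mu_RS0.
- exact: mu_RS_ge0.
- by move=> p; exact: cabs2_ge0.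
move=> u uf.
have mu_ r : measurable (u @^-1` [set r]).
  by rewrite -[X in measurable X]setTI; exact: measurable_funP.
have mi r : measurable_fun [set: coset_space S] (\1_(u @^-1` [set r]) : _ -> K).
  exact: measurable_indic.
have i0 r p : (0 <= \1_(u @^-1` [set r]) p :> K)%R by [].
(* The absolute value makes the family nonnegative at every r; on the range of u it changes
   nothing. *)
apply: (@le_trans _ _ (\sum_(r <- fset_set (range u))
    tot W (fun x c => `|r|%:E * efun (domain_fibre \1_(u @^-1` [set r])) x c))).
  rewrite big_seq [leRHS]big_seq; apply: lee_sum => r.
  rewrite in_fset_set// inE => -[p _ pr].
  have r0 : (0 <= r)%R by rewrite -pr.
  have aD := adm_domain_fibre (mi r) (i0 r).
  rewrite ger0_norm//.
  apply: (@le_trans _ _ (r%:E * tot W (efun (domain_fibre \1_(u @^-1` [set r]))))).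
    by apply: lee_wpmul2l => //; exact: mu_RS_le_tot.
  rewrite /tot -ge0_integralZl_EFin//; last 2 first.
  - by move=> x _; exact: fsum_ge0.
  - exact: measurable_fsum.
  under eq_integral => x _.
    rewrite -esumZl//; last by move=> c _; rewrite lee_fin domain_fibre_ge0.
    over.
  by [].
have aD r : adm W (fun x c => `|r|%:E * efun (domain_fibre \1_(u @^-1` [set r])) x c).
  have aD := adm_domain_fibre (mi r) (i0 r).
  split=> [x c|g]; first by rewrite mule_ge0 ?lee_fin ?domain_fibre_ge0.
  by apply: emeasurable_funM => //; exact: aD.2.
rewrite /tot -ge0_integral_sum//; last 2 first.
- by move=> r; exact: measurable_fsum.
- by move=> r x _; exact: fsum_ge0 x (aD r).
apply: le_ge0_integral => x; first by apply: sume_ge0 => r _; exact: fsum_ge0 x (aD r).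
rewrite -esum_sum; last by move=> c r _ _; rewrite mule_ge0 ?lee_fin ?domain_fibre_ge0.
apply: le_esum => c xc.
have [xX|xX] := pselect (X0 x); last first.
  rewrite big1 ?lee_fin ?sqr_ge0// => r _.
  by rewrite /efun /domain_fibre asboolF// mule0.
have h : quotient_class S x c by move: xc; rewrite /= /oorb asboolT.
pose p := Coset h.
have dE r : domain_fibre \1_(u @^-1` [set r]) x c = (u p == r)%:R%R.
  rewrite /domain_fibre asboolT// /real_fibre; case: pselect => // h'.
  rewrite (_ : Coset h' = p); last exact: coset_space_inj.
  rewrite indicE; congr (_%:R)%R; congr nat_of_bool; apply/idP/idP.
    by rewrite inE => /= ->.
  by move=> /eqP <-; rewrite inE.
have := uf p; rewrite /coset_vector /= asboolT// cabs2_real; apply: le_trans.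
(* At a given (x, c), only the level r = u p contributes. *)
rewrite (big_rem (u p)) /=; last by rewrite in_fset_set// inE; exists p.
rewrite /efun dE eqxx mule1 ger0_norm// big1_seq ?adde0// => r /=.
rewrite mem_rem_uniq ?fset_uniq// inE => /andP[ru _].
by rewrite dE eq_sym (negbTE ru) mule0.
Qed.

End coset_vectors.

(** * Radius 1 gives coamenability *)

Section coamenability.
Context (K : realType) d (X : measurableType d).
Context (mu : standard_probability K X) (R : pmp_eqrel mu) (S : sub_eqrel R).
Variable nu : full_group R -> K.
Hypotheses (nuP : countable_prob nu) (nuS : symmetric_prob nu).
Local Notation Gam := (generated (supp nu)).
Variables (X0 : set X) (e : nat -> full_group R).
Hypotheses (mX0 : measurable X0) (aeX0 : \forall x \ae mu, X0 x).
Hypotheses (X0good : X0 `<=` good_point nu).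
Hypotheses (X0G : forall g x, Gam g -> X0 x -> X0 (full_fun g x)).
Hypotheses (Ge : forall g, Gam g -> exists n, g = e n).
Local Notation W := (orbit_walk S nuP nuS mX0 aeX0 X0good X0G Ge).
Local Notation vec := (@coset_vector K d X mu R S X0).

Lemma fibre_coset_vector H x c : X0 x -> quotient_class S x c ->
  fibre (vec H) x c = (Complex (H x c) 0%R : complex K).
Proof.
by move=> xX xc; rewrite /fibre; case: pselect => // h; rewrite /coset_vector /= asboolT.
Qed.

Lemma cospectral_radius_coamenable : spectral_gap Gam ->
  cospectral_radius S nu = 1 -> coamenable S.
Proof.
move=> gap /(cospectral_radius1P S nuP nuS mX0 aeX0 X0good X0G Ge) nofast.
have [xi [axi xi1 Dxi]] := exists_almost_invariant nofast
  (@spectral_gap_mean _ _ _ _ _ S _ nuP nuS _ _ mX0 aeX0 X0good X0G Ge gap).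
exists (fun n => vec (xi n)); split.
- move=> n; split; first exact: (cmeasurable_coset_vector (axi n)).
  apply: (L2norm_coset_vector (axi n)).
  rewrite /tot (_ : \int[mu]_x _ = \int[mu]_x (cst 1 x)).
    by rewrite integral_cst1 ltry.
  by apply: eq_integral => x _; exact: xi1.
- move=> n; apply: filterS aeX0 => x xX; rewrite /l2norm.
  rewrite (_ : \esum_(c in _) _ = 1) ?poweR1r// -(xi1 n x) /fibre_sqnorm /= /oorb asboolT//.
  by apply: eq_esum => c xc; rewrite fibre_coset_vector// cabs2_real.
have [N [mN N0 NP]] := filterS2 _ (fun x (h1 : X0 x) h2 => conj h1 h2) aeX0 Dxi.
(* The exceptional set is a strip over the null set N; its fibre is empty at every x outside N. *)
exists (N `*` setT); split; first exact: measurableX.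
- apply/eqP; rewrite eq_le; apply/andP; split; last first.
    by apply: integral_ge0 => x _; exact: counting_ge0.
  rewrite -(@integral0 _ _ _ mu setT) /mu_R.
  apply: (@ae_le_ge0_integral _ _ _ _ (~` N)).
  + exact: measurableC.
  + by exists N; split=> // x /= /contrapT.
  + by move=> x; exact: counting_ge0.
  + by [].
  move=> x nN; rewrite (_ : [set y | _] = set0); last by apply/seteqP; split=> y // [_ []].
  by rewrite /counting asboolT// fset_set0.
move=> [x y] /= nxy; split=> //; apply: NP => -[xX Dx]; apply: nxy => xy.
have [g gG yE] := eqclass_oact X0good xX xy.
have yX : X0 y by rewrite yE; apply/(oact_domain X0G).
have qE : quotient_class S y = quotient_class S x.
  by rewrite yE; exact: quotient_class_oact X0good _ _ xX.
apply: cvge0_poweR12; first by move=> n; apply: esum_ge0 => c _; exact: cabs2_ge0.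
rewrite (_ : (fun n => _) = fun n => sqdist W (xi n) (act W g x) x); first exact: Dx.
apply/funext => n; rewrite /sqdist /= /oorb asboolT//; apply: eq_esum => c xc.
rewrite !fibre_coset_vector ?qE// cplxB cabs2_real -yE -sqrrN opprB //.
Qed.

End coamenability.

Theorem proposition5p1 (K : realType) (d : measure_display)
    (X : measurableType d) (mu : standard_probability K X)
    (R : pmp_eqrel mu) (S : sub_eqrel R) (nu : full_group R -> K) :
  ergodic R ->
  countable_prob nu -> symmetric_prob nu -> generates nu ->
  spectral_gap (generated (supp nu)) ->
  coamenable S <-> cospectral_radius S nu = 1.
Proof.
move=> _ nuP nuS nuG gap.
have [X0 [mX0 aeX0 X0good X0G]] := good_domain nuP nuS nuG.
have [e [_ Ge]] := generated_enum nuP nuS.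
split.
  exact: (@coamenable_cospectral_radius _ _ _ _ _ S _ nuP nuS _ _ mX0 aeX0 X0good X0G Ge).
exact: (@cospectral_radius_coamenable _ _ _ _ _ S _ nuP nuS _ _ mX0 aeX0 X0good X0G Ge gap).
Qed.
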